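(* For arbitrary $w$ and for complex values $x_1,x_2$ with $\operatorname{Re}(x_1)>0$ and $\operatorname{Re}(x_2)>0$, satisfying $x_2^2n^2+x_1^2k^2\neq -w^2$ for all natural numbers $n$ and $k$, there holds $$\frac{\left(1-e^{-\frac{2\pi}{x_2}\sqrt{x_1^2+w^2}}\right)\left(1-e^{-\frac{2\pi}{x_2}\sqrt{4x_1^2+w^2}}\right)\left(1-e^{-\frac{2\pi}{x_2}\sqrt{9x_1^2+w^2}}\right)\cdots}{\left(1-e^{-\frac{2\pi}{x_1}\sqrt{x_2^2+w^2}}\right)\left(1-e^{-\frac{2\pi}{x_1}\sqrt{4x_2^2+w^2}}\right)\left(1-e^{-\frac{2\pi}{x_1}\sqrt{9x_2^2+w^2}}\right)\cdots}$$ $$=\left(\frac{x_1}{x_2}\right)^{\frac{\pi w^2}{2x_1x_2}}\sqrt{\frac{\sinh\left(\frac{\pi w}{x_1}\right)}{\sinh\left(\frac{\pi w}{x_2}\right)}}\;\exp\left(\frac{\pi}{12}\left(\frac{x_1}{x_2}-\frac{x_2}{x_1}\right)+\pi\sum_{n=1}^{\infty}\left\{\frac{\sqrt{x_2^2n^2+w^2}}{x_1}-\frac{\sqrt{x_1^2n^2+w^2}}{x_2}-\frac{x_2n}{x_1}+\frac{x_1n}{x_2}\right\}\right).$$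
   Context: The numerator and denominator on the left are the infinite products over $n=1,2,3,\dots$ of $1-e^{-\frac{2\pi}{x_2}\sqrt{x_1^2n^2+w^2}}$ and $1-e^{-\frac{2\pi}{x_1}\sqrt{x_2^2n^2+w^2}}$ respectively.
   Formalization: The outer square root is the branch continued from w=0 (the principal root can give the wrong sign); also x_2²n² ≠ -w² for n≥1 is assumed, at w=0 the sinh quotient is x_2/x_1, and the identity is claimed when both products converge, which is shown for Re(x_1/x_2)>0. *)

(* Defs.v *)
From Stdlib Require Import Reals.
From Coquelicot Require Import Coquelicot.

Open Scope C_scope.

Definition Cexp (z : C) : C :=
  ((exp (Re z) * cos (Im z))%R, (exp (Re z) * sin (Im z))%R).

Definition Csinh (z : C) : C := (Cexp z - Cexp (- z)) / 2.

(* Principal argument, in (-PI, PI]; meaningless at 0. *)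
Definition Carg (z : C) : R :=
  if Rle_dec 0 (Im z) then acos (Re z / Cmod z) else (- acos (Re z / Cmod z))%R.

Definition Clog (z : C) : C := (ln (Cmod z), Carg z).

Definition Cpower (z a : C) : C := Cexp (a * Clog z).

(* Principal square root: Re >= 0, and Im >= 0 on the negative real axis. *)
Definition Csqrt (z : C) : C :=
  let a := sqrt ((Cmod z + Re z) / 2) in
  let b := sqrt ((Cmod z - Re z) / 2) in
  if Rle_dec 0 (Im z) then (a, b) else (a, (- b)%R).

(* f 1 * f 2 * ... * f n *)
Fixpoint Cprod (f : nat -> C) (n : nat) : C :=
  match n with
  | O => 1
  | S m => Cprod f m * f (S m)
  end.

(* Convergence of an infinite product over n = 1, 2, 3, ... in the usual sense:
   after dropping finitely many factors the partial products have a nonzero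
   limit.  In particular the value is 0 only if some factor is 0. *)
Definition is_infprod (f : nat -> C) (P : C) : Prop :=
  filterlim (Cprod f) eventually (locally P) /\
  exists (N : nat) (L : C), L <> 0 /\
    filterlim (Cprod (fun k => f (N + k)%nat)) eventually (locally L).

Definition disp (x w : C) (n : nat) : C := Csqrt (x ^ 2 * INR n ^ 2 + w ^ 2).

Definition factor (x y w : C) (n : nat) : C :=
  1 - Cexp (- (2 * PI / y) * disp x w n).

Definition summand (x1 x2 w : C) (n : nat) : C :=
  disp x2 w n / x1 - disp x1 w n / x2 - x2 * INR n / x1 + x1 * INR n / x2.

(* The removable singularity at w = 0 is filled in. *)
Definition sinh_ratio (x1 x2 w : C) : C :=
  if Ceq_dec w 0 then x2 / x1
  else Csinh (PI * w / x1) / Csinh (PI * w / x2).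

(* r is the value at w of the branch of the square root of sinh_ratio obtained
   by continuing Csqrt (x2 / x1) from w = 0, along a path on which all the
   principal roots disp x1 _ n and disp x2 _ n stay continuous, and which meets
   no zero of them before its end.  The principal root of sinh_ratio would not
   do: its argument passes through PI as w, x1, x2 vary, even where every
   disp is analytic.  For x1, x2 > 0 and w real, r is the positive root (take
   the segment from 0 to w). *)
Definition sqrt_sinh_ratio (x1 x2 w r : C) : Prop :=
  let I := fun t : R => (0 <= t <= 1)%R in
  exists (v rho : R -> C),
    continuous_on I v /\ v 0%R = 0 /\ v 1%R = w /\
    (forall n : nat, (1 <= n)%nat ->
       continuous_on I (fun t => disp x1 (v t) n) /\
       continuous_on I (fun t => disp x2 (v t) n) /\
       (forall t : R, (0 <= t < 1)%R ->
          disp x1 (v t) n <> 0 /\ disp x2 (v t) n <> 0)) /\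
    continuous_on I rho /\ rho 0%R = Csqrt (x2 / x1) /\ rho 1%R = r /\
    (forall t : R, I t -> rho t ^ 2 = sinh_ratio x1 x2 (v t)).

(* Main.v *)
(* With t = x1/x2 and d_i(n) = sqrt(x_i^2 n^2 + w^2):
   1. Euler's product for sinh writes 1 - exp(-2 pi d_1(n)/x2) as a product over k of
      1 + w^2/(x1^2 n^2 + x2^2 k^2), up to its value at w = 0 and elementary terms.  In the
      quotient of the two products over n <= N the square n, k <= N cancels, and the tails
      are exp(w^2 sigma_N) (1 + o(1)), with sigma_N the difference of two tail sums of
      1/(x1^2 n^2 + x2^2 k^2).  So P1/P2 = C D1/D2 exp(pi s + c w^2), where D_i is the
      product of d_i(n)/(x_i n), and C and c = lim sigma_N do not depend on w.
   2. C and c are read off at w = T x2, T -> +oo: there P1 and P2 tend to 1, and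
      Euler-Maclaurin gives the asymptotics of s.  In particular this yields the modular
      transformation of the Dedekind eta function (w = 0) instead of using it.
   3. D_1/D_2 is continuous along the path that defines the branch of the square root, and
      its square is the sinh ratio up to x2/x1.
   4. A path exists: in the plane of w^2 the cuts are horizontal rays going left, so one
      leaves 0 along an arc bulging far to the right, and comes down on w^2 from above. *)

Require Import Defs.
From Stdlib Require Import Reals Lra Lia Psatz.
From Coquelicot Require Import Coquelicot.
Local Open Scope C_scope.

(** * Limits, exponential and derivatives of complex functions *)

(** Nothing is continued analytically in w. The row identity and all estimates hold for each complex
    w directly, because [disp x w n] and [x n] both have nonnegative real part: their sum stays of
    order n wherever the principal root jumps. A path is thus needed only for the branch of the
    square root. The sum of 1/(x1^2 n^2 + x2^2 k^2) does not converge absolutely, so rows and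
    columns cannot be exchanged in the limit; only finite squares cancel, and sigma_N is what the
    exchange leaves over. Its limit is not computed from the double series: sigma_N is bounded, its
    convergence is extracted from that of exp(w^2 sigma_N), and its value is forced by growth, since
    K exp(kappa T^2) has a finite nonzero limit only for kappa = 0. One limit therefore fixes c and
    C together. On the ray w = T x2 both dispersions are x2 times roots that depend on t and T alone
    and whose radicands stay off the cut. The inequality Re(x1/x2) > 0, on which all these estimates
    rest, is extracted from the convergence of the two products. *)

Lemma clim_split {T : Type} (F : (T -> Prop) -> Prop) {FF : Filter F}
  (f : T -> C) (l : C) :
  filterlim f F (locally l) <->
  filterlim (fun t => Re (f t)) F (locally (Re l)) /\
  filterlim (fun t => Im (f t)) F (locally (Im l)).
Proof.
split.
- intros H; split; apply filterlim_locally; intros eps;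
  apply filterlim_locally with (eps := eps) in H;
  (eapply filter_imp; [ | exact H ]); intros t [Ht1 Ht2]; assumption.
- intros [H1 H2]; apply filterlim_locally; intros eps.
  apply filterlim_locally with (eps := eps) in H1.
  apply filterlim_locally with (eps := eps) in H2.
  generalize (filter_and _ _ H1 H2); apply filter_imp.
  intros t [Ht1 Ht2]; split; assumption.
Qed.

Lemma RtoC_neq_0 (x : R) : x <> 0%R -> RtoC x <> 0.
Proof. intros H E; apply H, (f_equal Re E). Qed.

Lemma RtoC_PI_neq_0 : RtoC PI <> 0.
Proof. apply RtoC_neq_0, Rgt_not_eq, PI_RGT_0. Qed.

Lemma Cmod_le_Re_Im (z : C) : (Cmod z <= Rabs (Re z) + Rabs (Im z))%R.
Proof.
replace z with (RtoC (Re z) + RtoC (Im z) * Ci) at 1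
  by (apply injective_projections; unfold Re, Im; simpl; ring).
eapply Rle_trans; [ apply Cmod_triangle | ].
rewrite Cmod_mult, Cmod_Ci, !Cmod_R; lra.
Qed.

Lemma im_le_Cmod (z : C) : (Rabs (Im z) <= Cmod z)%R.
Proof.
unfold Cmod; rewrite <- (sqrt_Rsqr_abs (Im z)); apply sqrt_le_1_alt.
unfold Rsqr, Im; simpl; nra.
Qed.

Lemma Cmod_sqr (z : C) : (Cmod z * Cmod z = Re z * Re z + Im z * Im z)%R.
Proof. unfold Cmod, Re, Im; rewrite sqrt_sqrt; simpl; nra. Qed.

Lemma clim_eps {T : Type} (F : (T -> Prop) -> Prop) {FF : Filter F}
  (f : T -> C) (l : C) :
  filterlim f F (locally l) <->
  (forall eps : R, (0 < eps)%R -> F (fun t => (Cmod (f t - l) < eps)%R)).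
Proof.
rewrite (clim_split F f l); split.
- intros [H1 H2] eps Heps.
  assert (He : (0 < eps / 2)%R) by lra.
  apply filterlim_locally with (eps := mkposreal _ He) in H1.
  apply filterlim_locally with (eps := mkposreal _ He) in H2.
  generalize (filter_and _ _ H1 H2); apply filter_imp.
  intros t [Ht1 Ht2].
  assert (E1 : (Rabs (Re (f t) - Re l) < eps / 2)%R) by exact Ht1.
  assert (E2 : (Rabs (Im (f t) - Im l) < eps / 2)%R) by exact Ht2.
  eapply Rle_lt_trans; [ apply Cmod_le_Re_Im | ].
  change (Rabs (Re (f t) - Re l) + Rabs (Im (f t) - Im l) < eps)%R; lra.
- intros H; split; apply filterlim_locally; intros eps;
  generalize (H eps (cond_pos eps)); apply filter_imp; intros t Ht.
  + eapply Rle_lt_trans; [ | exact Ht ]. apply (re_le_Cmod (f t - l)).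
  + eapply Rle_lt_trans; [ | exact Ht ]. apply (im_le_Cmod (f t - l)).
Qed.

Section Limits.
Context {T : Type} (F : (T -> Prop) -> Prop) {FF : Filter F}.

Lemma rlim_plus (f g : T -> R) (a b : R) :
  filterlim f F (locally a) -> filterlim g F (locally b) ->
  filterlim (fun t => f t + g t)%R F (locally (a + b)%R).
Proof.
intros Hf Hg; eapply filterlim_comp_2; [ exact Hf | exact Hg | ].
apply (filterlim_plus a b).
Qed.

Lemma rlim_mult (f g : T -> R) (a b : R) :
  filterlim f F (locally a) -> filterlim g F (locally b) ->
  filterlim (fun t => f t * g t)%R F (locally (a * b)%R).
Proof.
intros Hf Hg; eapply filterlim_comp_2; [ exact Hf | exact Hg | ].
apply (filterlim_mult a b).
Qed.

Lemma rlim_cont (f : T -> R) (h : R -> R) (a : R) :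
  continuous h a -> filterlim f F (locally a) ->
  filterlim (fun t => h (f t)) F (locally (h a)).
Proof. intros Hh Hf; eapply filterlim_comp; [ exact Hf | exact Hh ]. Qed.

Lemma rlim_opp (f : T -> R) (a : R) :
  filterlim f F (locally a) -> filterlim (fun t => - f t)%R F (locally (- a)%R).
Proof. apply (rlim_cont f Ropp); apply (filterlim_opp a). Qed.

Lemma rlim_minus (f g : T -> R) (a b : R) :
  filterlim f F (locally a) -> filterlim g F (locally b) ->
  filterlim (fun t => f t - g t)%R F (locally (a - b)%R).
Proof. intros Hf Hg; apply rlim_plus; [ exact Hf | apply rlim_opp, Hg ]. Qed.

Lemma rlim_inv (f : T -> R) (a : R) :
  a <> 0%R -> filterlim f F (locally a) ->
  filterlim (fun t => / f t)%R F (locally (/ a)%R).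
Proof. intros Ha; apply rlim_cont, continuous_Rinv; exact Ha. Qed.

Lemma rlim_pos (f : T -> R) (a : R) :
  (0 < a)%R -> filterlim f F (locally a) -> F (fun t => (0 < f t)%R).
Proof.
intros Ha Hf; apply filterlim_locally with (eps := mkposreal _ Ha) in Hf; revert Hf.
apply filter_imp; intros t Ht; assert (H : (Rabs (f t - a) < a)%R) by exact Ht.
apply Rabs_def2 in H; lra.
Qed.

Lemma clim_plus (f g : T -> C) (a b : C) :
  filterlim f F (locally a) -> filterlim g F (locally b) ->
  filterlim (fun t => f t + g t) F (locally (a + b)).
Proof.
intros Hf Hg; apply (clim_split F) in Hf, Hg; apply (clim_split F).
split; simpl; apply rlim_plus; tauto.
Qed.

Lemma clim_opp (f : T -> C) (a : C) :
  filterlim f F (locally a) -> filterlim (fun t => - f t) F (locally (- a)).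
Proof.
intros Hf; apply (clim_split F) in Hf; apply (clim_split F).
split; simpl; apply rlim_opp; tauto.
Qed.

Lemma clim_minus (f g : T -> C) (a b : C) :
  filterlim f F (locally a) -> filterlim g F (locally b) ->
  filterlim (fun t => f t - g t) F (locally (a - b)).
Proof. intros Hf Hg; apply clim_plus; [ exact Hf | apply clim_opp, Hg ]. Qed.

Lemma clim_mult (f g : T -> C) (a b : C) :
  filterlim f F (locally a) -> filterlim g F (locally b) ->
  filterlim (fun t => f t * g t) F (locally (a * b)).
Proof.
intros Hf Hg; apply (clim_split F) in Hf, Hg; apply (clim_split F).
split; simpl; [ apply rlim_minus | apply rlim_plus ]; apply rlim_mult; tauto.
Qed.

Lemma clim_inv (f : T -> C) (a : C) :
  a <> 0 -> filterlim f F (locally a) ->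
  filterlim (fun t => / f t) F (locally (/ a)).
Proof.
intros Ha Hf; apply (clim_split F) in Hf; apply (clim_split F).
assert (Hn : (fst a ^ 2 + snd a ^ 2)%R <> 0%R).
{ intros H; apply Ha, injective_projections; simpl in *; nra. }
assert (HD : filterlim (fun t => / (fst (f t) ^ 2 + snd (f t) ^ 2))%R F
               (locally (/ (fst a ^ 2 + snd a ^ 2))%R)).
{ apply rlim_inv; [ exact Hn | ].
  apply rlim_plus; simpl; repeat apply rlim_mult; try apply filterlim_const;
  apply Hf. }
split; simpl; apply rlim_mult; try exact HD; try apply rlim_opp; apply Hf.
Qed.

Lemma clim_div (f g : T -> C) (a b : C) :
  b <> 0 -> filterlim f F (locally a) -> filterlim g F (locally b) ->
  filterlim (fun t => f t / g t) F (locally (a / b)).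
Proof. intros Hb Hf Hg; apply clim_mult; [ exact Hf | apply clim_inv; auto ]. Qed.

Lemma clim_Cmod (f : T -> C) (a : C) :
  filterlim f F (locally a) ->
  filterlim (fun t => Cmod (f t)) F (locally (Cmod a)).
Proof.
intros Hf; apply (clim_split F) in Hf.
apply (rlim_cont (fun t => (fst (f t) ^ 2 + snd (f t) ^ 2)%R) sqrt).
- apply continuous_sqrt.
- apply rlim_plus; simpl; repeat apply rlim_mult; try apply filterlim_const;
  apply Hf.
Qed.

Lemma clim_Cexp (f : T -> C) (a : C) :
  filterlim f F (locally a) ->
  filterlim (fun t => Cexp (f t)) F (locally (Cexp a)).
Proof.
intros Hf; apply (clim_split F) in Hf; apply (clim_split F).
split; simpl; apply rlim_mult; apply rlim_cont; try apply Hf.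
- apply continuous_exp.
- apply continuous_cos.
- apply continuous_exp.
- apply continuous_sin.
Qed.

Lemma clim_RtoC (f : T -> R) (a : R) :
  filterlim f F (locally a) -> filterlim (fun t => RtoC (f t)) F (locally (RtoC a)).
Proof.
intros Hf; apply (clim_split F); split; simpl; [ exact Hf | apply filterlim_const ].
Qed.

Lemma clim_squeeze (f : T -> C) (l : C) (g : T -> R) :
  F (fun t => (Cmod (f t - l) <= g t)%R) -> filterlim g F (locally 0%R) ->
  filterlim f F (locally l).
Proof.
intros H1 H2; apply clim_eps; auto; intros eps Heps.
apply filterlim_locally with (eps := mkposreal _ Heps) in H2.
generalize (filter_and _ _ H1 H2); apply filter_imp; intros t [Ha Hb].
assert (Hc : (Rabs (g t - 0) < eps)%R) by exact Hb.
rewrite Rminus_0_r in Hc; apply Rabs_def2 in Hc; lra.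
Qed.

End Limits.

Lemma filterlim_within {T U : UniformSpace} (D : T -> Prop) (f : T -> U) (t : T)
  (G : (U -> Prop) -> Prop) :
  filterlim f (locally t) G -> filterlim f (within D (locally t)) G.
Proof. apply filterlim_filter_le_1, filter_le_within. Qed.

Local Notation seqlim u l := (filterlim u eventually (locally l)) (only parsing).

Lemma clim_unique {T : Type} (F : (T -> Prop) -> Prop) {FF : ProperFilter F}
  (f : T -> C) (a b : C) :
  filterlim f F (locally a) -> filterlim f F (locally b) -> a = b.
Proof.
intros Ha Hb.
exact (@filterlim_locally_unique T C_AbsRing C_NormedModule F _ f a b Ha Hb).
Qed.

(** * The complex exponential *)

Lemma Cexp_plus (a b : C) : Cexp (a + b) = Cexp a * Cexp b.
Proof.
apply injective_projections; unfold Cexp, Re, Im; simpl;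
rewrite exp_plus, ?cos_plus, ?sin_plus; ring.
Qed.

Lemma Cexp_0 : Cexp 0 = 1.
Proof.
apply injective_projections; simpl; rewrite exp_0, ?cos_0, ?sin_0; ring.
Qed.

Lemma Cmod_Cexp (z : C) : Cmod (Cexp z) = exp (Re z).
Proof.
pose proof (Cmod_ge_0 (Cexp z)); pose proof (exp_pos (Re z)).
pose proof (Cmod_sqr (Cexp z)) as H1; simpl in H1.
pose proof (sin2_cos2 (Im z)) as H2; unfold Rsqr in H2.
apply Rsqr_inj; [ lra | lra | unfold Rsqr ].
rewrite H1; fold (Re z) (Im z); nra.
Qed.

Lemma Cexp_neq_0 (z : C) : Cexp z <> 0.
Proof.
intros H; pose proof (Cmod_Cexp z) as H1; rewrite H, Cmod_0 in H1.
pose proof (exp_pos (Re z)); lra.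
Qed.

Lemma Cexp_opp (z : C) : Cexp (- z) = / Cexp z.
Proof.
assert (H : Cexp z * Cexp (- z) = 1).
{ rewrite <- Cexp_plus, Cplus_opp_r; apply Cexp_0. }
rewrite <- (Cmult_1_r (/ Cexp z)), <- H; field; apply Cexp_neq_0.
Qed.

Lemma Cexp_minus (a b : C) : Cexp (a - b) = Cexp a / Cexp b.
Proof. unfold Cminus, Cdiv; rewrite Cexp_plus, Cexp_opp; reflexivity. Qed.

Lemma Re_le_Cmod (z : C) : (Re z <= Cmod z)%R.
Proof. eapply Rle_trans; [ apply Rle_abs | apply re_le_Cmod ]. Qed.

(** Componentwise, so that the real mean value theorem and [is_derive] apply; all functions below
    are differentiated along a real parameter. *)
Definition cderiv (f : R -> C) (t : R) (l : C) : Prop :=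
  is_derive (fun s => Re (f s)) t (Re l) /\ is_derive (fun s => Im (f s)) t (Im l).

Lemma cderiv_eq (f : R -> C) (t : R) (l l' : C) :
  cderiv f t l -> l = l' -> cderiv f t l'.
Proof. intros H <-; exact H. Qed.

Lemma cderiv_const (c : C) (t : R) : cderiv (fun _ => c) t 0.
Proof. split; simpl; apply @is_derive_const. Qed.

Lemma cderiv_RtoC (f : R -> R) (t l : R) :
  is_derive f t l -> cderiv (fun s => RtoC (f s)) t (RtoC l).
Proof. intros H; split; simpl; [ exact H | apply @is_derive_const ]. Qed.

Lemma cderiv_id (t : R) : cderiv (fun s => RtoC s) t 1.
Proof. apply cderiv_RtoC, @is_derive_id. Qed.

Lemma cderiv_plus (f g : R -> C) (t : R) (a b : C) :
  cderiv f t a -> cderiv g t b -> cderiv (fun s => f s + g s) t (a + b).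
Proof.
intros [H1 H2] [H3 H4]; split; simpl.
- apply (is_derive_plus _ _ t _ _ H1 H3).
- apply (is_derive_plus _ _ t _ _ H2 H4).
Qed.

Lemma cderiv_opp (f : R -> C) (t : R) (a : C) :
  cderiv f t a -> cderiv (fun s => - f s) t (- a).
Proof.
intros [H1 H2]; split; simpl; [ apply (is_derive_opp _ t _ H1) | apply (is_derive_opp _ t _ H2)].
Qed.

Lemma cderiv_minus (f g : R -> C) (t : R) (a b : C) :
  cderiv f t a -> cderiv g t b -> cderiv (fun s => f s - g s) t (a - b).
Proof. intros H1 H2; apply cderiv_plus; [ exact H1 | apply cderiv_opp, H2 ]. Qed.

Lemma is_derive_mult_R (f g : R -> R) (t a b : R) :
  is_derive f t a -> is_derive g t b ->
  is_derive (fun s => f s * g s)%R t (a * g t + f t * b)%R.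
Proof. intros H1 H2; apply (is_derive_mult f g t a b H1 H2); intros; apply Rmult_comm. Qed.

Lemma cderiv_mult (f g : R -> C) (t : R) (a b : C) :
  cderiv f t a -> cderiv g t b ->
  cderiv (fun s => f s * g s) t (a * g t + f t * b).
Proof.
intros [H1 H2] [H3 H4]; split; simpl.
- evar_last.
  + apply (is_derive_minus (fun s => Re (f s) * Re (g s))%R
             (fun s => Im (f s) * Im (g s))%R); apply is_derive_mult_R; eassumption.
  + unfold minus, plus, opp, Re, Im; simpl; ring.
- evar_last.
  + apply (is_derive_plus (fun s => Re (f s) * Im (g s))%R
             (fun s => Im (f s) * Re (g s))%R); apply is_derive_mult_R; eassumption.
  + unfold plus, Re, Im; simpl; ring.
Qed.

Lemma cderiv_Cexp (f : R -> C) (t : R) (a : C) :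
  cderiv f t a -> cderiv (fun s => Cexp (f s)) t (a * Cexp (f t)).
Proof.
intros [H1 H2]; split; simpl.
- evar_last.
  + apply is_derive_mult_R.
    * apply (is_derive_comp exp _ t); [ apply is_derive_exp | exact H1 ].
    * apply (is_derive_comp cos _ t); [ apply is_derive_cos | exact H2 ].
  + unfold scal; simpl; unfold mult, Re, Im; simpl; ring.
- evar_last.
  + apply is_derive_mult_R.
    * apply (is_derive_comp exp _ t); [ apply is_derive_exp | exact H1 ].
    * apply (is_derive_comp sin _ t); [ apply is_derive_sin | exact H2 ].
  + unfold scal; simpl; unfold mult, Re, Im; simpl; ring.
Qed.

Lemma cderiv_clim (f : R -> C) (t : R) (a : C) :
  cderiv f t a -> filterlim f (locally t) (locally (f t)).
Proof.
intros [H1 H2]; apply clim_split; [ apply locally_filter | ].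
split; apply (ex_derive_continuous (V := R_NormedModule)); eexists; eassumption.
Qed.

(** A complex function has no intermediate point, so the real mean value theorem is applied to [Re]
    and [Im] separately; this costs the factor 2 that recurs in later constants. *)
Lemma cmean_value (f f' : R -> C) (a b M : R) :
  (a <= b)%R ->
  (forall t, (a <= t <= b)%R -> cderiv f t (f' t)) ->
  (forall t, (a <= t <= b)%R -> (Cmod (f' t) <= M)%R) ->
  (Cmod (f b - f a) <= 2 * M * (b - a))%R.
Proof.
intros Hab Hd HM.
assert (HR : forall (p : C -> R) (g : R -> R),
  (forall t, (a <= t <= b)%R -> is_derive g t (p (f' t))) ->
  (forall z, (Rabs (p z) <= Cmod z)%R) ->
  (Rabs (g b - g a) <= M * (b - a))%R).
{ intros p g Hg Hp.
  destruct (MVT_gen g a b (fun t => p (f' t))) as [c [Hc1 Hc2]].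
  - intros t Ht; rewrite Rmin_left, Rmax_right in Ht by lra; apply Hg; lra.
  - intros t Ht; rewrite Rmin_left, Rmax_right in Ht by lra.
    apply continuity_pt_filterlim, (ex_derive_continuous (V := R_NormedModule)).
    eexists; apply Hg; lra.
  - rewrite Rmin_left, Rmax_right in Hc1 by lra.
    rewrite Hc2, Rabs_mult, (Rabs_pos_eq (b - a)) by lra.
    apply Rmult_le_compat_r; [ lra | ].
    eapply Rle_trans; [ apply Hp | apply HM; exact Hc1 ]. }
eapply Rle_trans; [ apply Cmod_le_Re_Im | ].
pose proof (HR Re (fun s => Re (f s)) (fun t Ht => proj1 (Hd t Ht)) re_le_Cmod) as H1.
pose proof (HR Im (fun s => Im (f s)) (fun t Ht => proj2 (Hd t Ht)) im_le_Cmod) as H2.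
change (Re (f b - f a)) with (Re (f b) - Re (f a))%R.
change (Im (f b - f a)) with (Im (f b) - Im (f a))%R.
lra.
Qed.

Lemma exp_le (a b : R) : (a <= b)%R -> (exp a <= exp b)%R.
Proof. intros [H | ->]; [ left; apply exp_increasing, H | right; reflexivity ]. Qed.

Lemma Cmod_scal_le (t : R) (z : C) :
  (0 <= t <= 1)%R -> (Cmod (RtoC t * z) <= Cmod z)%R.
Proof.
intros Ht; rewrite Cmod_mult, Cmod_R, Rabs_pos_eq by lra.
pose proof (Cmod_ge_0 z); nra.
Qed.

Lemma Cexp_sub_1_le (z : C) :
  (Cmod (Cexp z - 1) <= 2 * (Cmod z * exp (Cmod z)))%R.
Proof.
assert (H : (Cmod (Cexp (RtoC 1 * z) - Cexp (RtoC 0 * z))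
             <= 2 * (Cmod z * exp (Cmod z)) * (1 - 0))%R).
{ apply (cmean_value (fun s => Cexp (RtoC s * z)) (fun s => z * Cexp (RtoC s * z)));
    [ lra | intros t _ | intros t Ht ].
  - eapply cderiv_eq.
    + apply cderiv_Cexp, cderiv_mult; [ apply cderiv_id | apply cderiv_const ].
    + cbv beta; ring.
  - rewrite Cmod_mult, Cmod_Cexp; apply Rmult_le_compat_l; [ apply Cmod_ge_0 | ].
    apply exp_le; eapply Rle_trans; [ apply Re_le_Cmod | apply Cmod_scal_le; lra ]. }
rewrite Cmult_1_l, Cmult_0_l, Cexp_0, Rminus_0_r, Rmult_1_r in H; exact H.
Qed.

(** The derivative of [Cexp (s z) - s z] in [s] is [z (Cexp (s z) - 1)], bounded by [Cexp_sub_1_le];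
    two uses of [cmean_value] give the constant 4. *)
Lemma Cexp_sub_1_sub_le (z : C) :
  (Cmod (Cexp z - 1 - z) <= 4 * (Cmod z * Cmod z * exp (Cmod z)))%R.
Proof.
assert (H : (Cmod ((Cexp (RtoC 1 * z) - RtoC 1 * z) - (Cexp (RtoC 0 * z) - RtoC 0 * z))
             <= 2 * (Cmod z * (2 * (Cmod z * exp (Cmod z)))) * (1 - 0))%R).
{ apply (cmean_value (fun s => Cexp (RtoC s * z) - RtoC s * z)
           (fun s => z * (Cexp (RtoC s * z) - 1)));
    [ lra | intros t _ | intros t Ht ].
  - eapply cderiv_eq.
    + apply cderiv_minus; [ apply cderiv_Cexp | ]; apply cderiv_mult;
      [ apply cderiv_id | apply cderiv_const | apply cderiv_id | apply cderiv_const ].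
    + cbv beta; ring.
  - rewrite Cmod_mult; apply Rmult_le_compat_l; [ apply Cmod_ge_0 | ].
    eapply Rle_trans; [ apply Cexp_sub_1_le | ].
    pose proof (Cmod_scal_le t z Ht) as H1.
    pose proof (exp_le _ _ H1) as H2.
    pose proof (Cmod_ge_0 (RtoC t * z)); pose proof (exp_pos (Cmod (RtoC t * z))).
    pose proof (exp_pos (Cmod z)); nra. }
rewrite !Cmult_1_l, !Cmult_0_l, Cexp_0 in H.
replace (Cexp z - 1 - z) with (Cexp z - z - (1 - 0)) by ring.
lra.
Qed.

(** * Principal square root and logarithm *)

Lemma Cmult_0_reg (a b : C) : a * b = 0 -> a = 0 \/ b = 0.
Proof.
intros H; apply (f_equal Cmod) in H; rewrite Cmod_mult, Cmod_0 in H.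
destruct (Rmult_integral _ _ H); [ left | right ]; now apply Cmod_eq_0.
Qed.

Lemma Re_mult (a b : C) : Re (a * b) = (Re a * Re b - Im a * Im b)%R.
Proof. reflexivity. Qed.

Lemma Im_mult (a b : C) : Im (a * b) = (Re a * Im b + Im a * Re b)%R.
Proof. reflexivity. Qed.

Lemma Csqr_eq (a b : C) : a * a = b * b -> a = b \/ a = - b.
Proof.
intros H.
assert (H0 : (a - b) * (a + b) = 0).
{ replace ((a - b) * (a + b)) with (a * a - b * b) by ring; rewrite H; ring. }
destruct (Cmult_0_reg _ _ H0) as [H1 | H1]; [ left | right ].
- replace a with (a - b + b) by ring; rewrite H1; ring.
- replace a with (a + b - b) by ring; rewrite H1; ring.
Qed.

Lemma Csqrt_sqr (z : C) : Csqrt z * Csqrt z = z.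
Proof.
pose proof (Cmod_sqr z) as Hm; pose proof (Cmod_ge_0 z).
pose proof (re_le_Cmod z) as Hr; apply Rabs_le_between in Hr.
assert (H1 : (0 <= (Cmod z + Re z) / 2)%R) by lra.
assert (H2 : (0 <= (Cmod z - Re z) / 2)%R) by lra.
(* The product of the radicands is [(Im z / 2)^2]. The sign lost here is restored by the case split
   in [Csqrt]. *)
assert (H3 : (sqrt ((Cmod z + Re z) / 2) * sqrt ((Cmod z - Re z) / 2) = Rabs (Im z) / 2)%R).
{ rewrite <- sqrt_mult by assumption.
  replace ((Cmod z + Re z) / 2 * ((Cmod z - Re z) / 2))%R
    with (Rsqr (Rabs (Im z) / 2)).
  - apply sqrt_Rsqr; pose proof (Rabs_pos (Im z)); lra.
  - unfold Rsqr; pose proof (Rsqr_abs (Im z)) as H4; unfold Rsqr in H4; nra. }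
pose proof (sqrt_sqrt _ H1) as S1; pose proof (sqrt_sqrt _ H2) as S2.
unfold Csqrt; destruct (Rle_dec 0 (Im z)) as [Hi | Hi];
apply injective_projections; simpl; fold (Re z) (Im z).
- lra.
- rewrite Rabs_pos_eq in H3 by assumption; lra.
- lra.
- rewrite Rabs_left in H3 by lra; lra.
Qed.

Lemma Re_Csqrt_ge_0 (z : C) : (0 <= Re (Csqrt z))%R.
Proof. unfold Csqrt; destruct (Rle_dec 0 (Im z)); simpl; apply sqrt_pos. Qed.

Lemma Re_Csqrt_pos (z : C) :
  (Im z = 0%R -> (0 < Re z)%R) -> (0 < Re (Csqrt z))%R.
Proof.
intros H; destruct (Re_Csqrt_ge_0 z) as [H1 | H1]; [ exact H1 | exfalso ].
pose proof (Csqrt_sqr z) as H2.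
assert (Hi : Im z = 0%R) by (rewrite <- H2, Im_mult, <- H1; ring).
specialize (H Hi); rewrite <- H2, Re_mult, <- H1 in H; nra.
Qed.

(** Principal roots are evaluated below by exhibiting a root with positive real part; the work then
    lies in that positivity. *)
Lemma Csqrt_unique (a z : C) : a * a = z -> (0 < Re a)%R -> Csqrt z = a.
Proof.
intros H Ha; pose proof (Csqrt_sqr z) as H1; rewrite <- H in H1 at 3.
destruct (Csqr_eq _ _ H1) as [H2 | H2]; [ exact H2 | exfalso ].
pose proof (Re_Csqrt_ge_0 z) as H3; rewrite H2 in H3; change (Re (- a)) with (- Re a)%R in H3; lra.
Qed.

Lemma Csqrt_0 : Csqrt 0 = 0.
Proof. destruct (Cmult_0_reg _ _ (Csqrt_sqr 0)); assumption. Qed.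

Lemma Csqrt_neq_0 (z : C) : z <> 0 -> Csqrt z <> 0.
Proof. intros H H1; apply H; rewrite <- (Csqrt_sqr z), H1; ring. Qed.

Lemma Cmod_Csqrt (z : C) : (Cmod (Csqrt z) * Cmod (Csqrt z) = Cmod z)%R.
Proof. rewrite <- Cmod_mult, Csqrt_sqr; reflexivity. Qed.

(* On the negative half-axis [Csqrt] is continuous from above only. *)
Lemma clim_Csqrt {T : Type} (F : (T -> Prop) -> Prop) {FF : Filter F}
  (f : T -> C) (a : C) :
  (Im a = 0%R -> (Re a < 0)%R -> F (fun t => (0 <= Im (f t))%R)) ->
  filterlim f F (locally a) ->
  filterlim (fun t => Csqrt (f t)) F (locally (Csqrt a)).
Proof.
intros Hcut Hf.
pose proof (clim_Cmod F f a Hf) as Hm.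
destruct (proj1 (clim_split F f a) Hf) as [Hr Hi].
assert (HA : filterlim (fun t => sqrt ((Cmod (f t) + Re (f t)) / 2)) F
               (locally (sqrt ((Cmod a + Re a) / 2)))).
{ apply (rlim_cont F _ sqrt); [ apply continuous_sqrt | ].
  apply rlim_mult; auto; [ apply rlim_plus; assumption | apply filterlim_const ]. }
assert (HB : filterlim (fun t => sqrt ((Cmod (f t) - Re (f t)) / 2)) F
               (locally (sqrt ((Cmod a - Re a) / 2)))).
{ apply (rlim_cont F _ sqrt); [ apply continuous_sqrt | ].
  apply rlim_mult; auto; [ apply rlim_minus; assumption | apply filterlim_const ]. }
apply (clim_split F); split.
- replace (Re (Csqrt a)) with (sqrt ((Cmod a + Re a) / 2))
    by (unfold Csqrt; destruct (Rle_dec 0 (Im a)); reflexivity).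
  eapply filterlim_ext; [ | exact HA ].
  intros t; unfold Csqrt; destruct (Rle_dec 0 (Im (f t))); reflexivity.
- destruct (Rlt_le_dec (Im a) 0) as [Ha | Ha].
  { replace (Im (Csqrt a)) with (- sqrt ((Cmod a - Re a) / 2))%R
      by (unfold Csqrt; destruct (Rle_dec 0 (Im a)); [ lra | reflexivity ]).
    eapply filterlim_ext_loc; [ | apply (rlim_opp F); exact HB ].
    generalize (rlim_pos F _ (- Im a) ltac:(lra) (rlim_opp F _ _ Hi)).
    apply filter_imp; intros t Ht.
    unfold Csqrt; destruct (Rle_dec 0 (Im (f t))); [ lra | reflexivity ]. }
  replace (Im (Csqrt a)) with (sqrt ((Cmod a - Re a) / 2))%R
    by (unfold Csqrt; destruct (Rle_dec 0 (Im a)); [ reflexivity | lra ]).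
  assert (HP : F (fun t => (0 <= Im (f t))%R) \/ (Cmod a - Re a = 0)%R).
  { destruct Ha as [Ha | Ha].
    - left; generalize (rlim_pos F _ _ Ha Hi); apply filter_imp; intros t; lra.
    - symmetry in Ha; destruct (Rlt_le_dec (Re a) 0) as [Hn | Hn]; [ left; auto | right ].
      pose proof (Cmod_sqr a); rewrite Ha in *; pose proof (Cmod_ge_0 a).
      assert (Cmod a = Re a) by nra; lra. }
  destruct HP as [HP | Hz].
  + eapply filterlim_ext_loc; [ | exact HB ].
    revert HP; apply filter_imp; intros t Ht.
    unfold Csqrt; destruct (Rle_dec 0 (Im (f t))); [ reflexivity | contradiction ].
  + rewrite Hz in HB |- *; rewrite Rdiv_0_l, sqrt_0 in *.
    apply filterlim_locally; intros eps.
    apply filterlim_locally with (eps := eps) in HB; revert HB.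
    apply filter_imp; intros t Ht.
    assert (Ht' : (Rabs (sqrt ((Cmod (f t) - Re (f t)) / 2) - 0) < eps)%R) by exact Ht.
    rewrite Rminus_0_r in Ht'.
    change (Rabs (Im (Csqrt (f t)) - 0) < eps)%R; rewrite Rminus_0_r.
    unfold Csqrt; destruct (Rle_dec 0 (Im (f t))); simpl; [ | rewrite Rabs_Ropp ];
    exact Ht'.
Qed.

Lemma is_derive_sqrt_comp (g : R -> R) (t l : R) :
  (0 < g t)%R -> is_derive g t l ->
  is_derive (fun s => sqrt (g s)) t (l / (2 * sqrt (g t)))%R.
Proof.
intros Hg Hl; evar_last.
- apply (is_derive_comp sqrt g t); [ | exact Hl ].
  apply is_derive_Reals, derivable_pt_lim_sqrt, Hg.
- unfold scal; simpl; unfold mult; simpl; field.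
  apply Rgt_not_eq, sqrt_lt_R0, Hg.
Qed.

Lemma cderiv_Cmod (f : R -> C) (t : R) (l : C) :
  cderiv f t l -> f t <> 0 ->
  is_derive (fun s => Cmod (f s)) t
    ((Re (f t) * Re l + Im (f t) * Im l) / Cmod (f t))%R.
Proof.
intros [H1 H2] H0.
assert (Hp : (0 < Re (f t) * Re (f t) + Im (f t) * Im (f t))%R).
{ rewrite <- Cmod_sqr; pose proof (proj1 (Cmod_gt_0 (f t)) H0); nra. }
assert (E : forall s, sqrt (Re (f s) * Re (f s) + Im (f s) * Im (f s)) = Cmod (f s)).
{ intros s; unfold Cmod, Re, Im; f_equal; ring. }
eapply is_derive_ext; [ intros s; apply E | ].
evar_last.
- apply is_derive_sqrt_comp; [ exact Hp | ].
  apply (is_derive_plus (fun s => Re (f s) * Re (f s))%R (fun s => Im (f s) * Im (f s))%R);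
  apply is_derive_mult_R; eassumption.
- cbv beta; rewrite E; unfold plus; simpl; field; apply Rgt_not_eq, Cmod_gt_0, H0.
Qed.

(** [Csqrt] branches on the sign of [Im], so its definition cannot be differentiated as it stands
    across the positive axis. The real part has one formula everywhere; the imaginary part is
    recovered from [2 Re (Csqrt z) Im (Csqrt z) = Im z]. *)
Lemma cderiv_Csqrt (f : R -> C) (t : R) (l : C) :
  (Im (f t) = 0%R -> (0 < Re (f t))%R) -> cderiv f t l ->
  cderiv (fun s => Csqrt (f s)) t (l / (2 * Csqrt (f t))).
Proof.
intros Hcut Hd.
assert (H0 : f t <> 0).
{ intros H; rewrite H in Hcut; simpl in Hcut; specialize (Hcut eq_refl); lra. }
pose proof (proj1 (Cmod_gt_0 _) H0) as Hmp.
pose proof (Re_Csqrt_pos _ Hcut) as Hap.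
assert (EA : forall z, Re (Csqrt z) = sqrt ((Cmod z + Re z) / 2)).
{ intros z; unfold Csqrt; destruct (Rle_dec 0 (Im z)); reflexivity. }
pose proof (cderiv_Cmod f t l Hd H0) as Hm.
destruct Hd as [H1 H2].
set (F := Csqrt (f t)) in *.
pose proof (Csqrt_sqr (f t)) as HF; fold F in HF.
assert (HFm : (Re F * Re F + Im F * Im F = Cmod (f t))%R)
  by (rewrite <- Cmod_sqr; apply Cmod_Csqrt).
assert (HR : (Re (f t) = Re F * Re F - Im F * Im F)%R) by (rewrite <- HF; reflexivity).
assert (HI : (Im (f t) = Re F * Im F + Im F * Re F)%R) by (rewrite <- HF; reflexivity).
assert (Hpos : (0 < (Cmod (f t) + Re (f t)) / 2)%R) by nra.
assert (HRe : is_derive (fun s => Re (Csqrt (f s))) t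
          ((Re l * Re F + Im l * Im F) / (2 * Cmod (f t)))%R).
{ eapply is_derive_ext; [ intros s; symmetry; apply EA | ].
  evar_last.
  - apply is_derive_sqrt_comp; [ exact Hpos | ].
    apply is_derive_mult_R; [ | apply @is_derive_const ].
    apply (is_derive_plus (fun s => Cmod (f s)) (fun s => Re (f s))); [ exact Hm | exact H1 ].
  - cbv beta; rewrite <- EA; fold F; unfold plus, zero; simpl.
    rewrite HR, HI, <- HFm; field; split; nra. }
assert (Hloc : locally t (fun s => Im (f s) / (2 * Re (Csqrt (f s))) = Im (Csqrt (f s)))%R).
{ pose proof (ex_derive_continuous (V := R_NormedModule) _ _
    (ex_intro _ _ HRe)) as Hc.
  generalize (rlim_pos (locally t) _ _ Hap Hc); apply filter_imp; intros s Hs.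
  rewrite <- (Csqrt_sqr (f s)) at 1; rewrite Im_mult; field; lra. }
assert (Hd : l / (2 * F) = ((Re l * Re F + Im l * Im F) / (2 * Cmod (f t)),
                            (Im l * Re F - Re l * Im F) / (2 * Cmod (f t)))%R).
{ rewrite <- HFm; apply injective_projections; unfold Re, Im in *; simpl; field; nra. }
rewrite Hd; split; [ exact HRe | simpl ].
eapply is_derive_ext_loc; [ exact Hloc | ].
evar_last.
- apply is_derive_mult_R; [ exact H2 | ].
  apply is_derive_inv; [ | fold F; lra ].
  apply is_derive_mult_R; [ apply @is_derive_const | exact HRe ].
- cbv beta; fold F; unfold zero; simpl; rewrite HI, <- HFm; field; split; nra.
Qed.

(** [acos] is not differentiable at 1, that is on the positive axis, although the argument is smooth
    there. The form with [atan] is the one used for limits and derivatives of [Clog]. *)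
Lemma Carg_atan (z : C) : (0 < Re z)%R -> Carg z = atan (Im z / Re z).
Proof.
intros Hz.
assert (Hm : (0 < Cmod z)%R) by (pose proof (Re_le_Cmod z); lra).
assert (HC : cos (atan (Im z / Re z)) = (Re z / Cmod z)%R).
{ rewrite cos_atan.
  replace (1 + (Im z / Re z)²)%R with ((Cmod z / Re z)²)%R.
  - rewrite sqrt_Rsqr; [ field; lra | ].
    apply Rlt_le, Rdiv_lt_0_compat; assumption.
  - unfold Rsqr; replace (Cmod z / Re z * (Cmod z / Re z))%R
      with ((Cmod z * Cmod z) / (Re z * Re z))%R by (field; lra).
    rewrite Cmod_sqr; field; lra. }
unfold Carg; rewrite <- HC; pose proof (atan_bound (Im z / Re z)); pose proof PI_RGT_0.
assert (Hs : forall x, (0 <= x)%R -> (0 <= atan x)%R).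
{ intros x [Hx | <-]; [ rewrite <- atan_0; left; apply atan_increasing, Hx | rewrite atan_0; lra ]. }
destruct (Rle_dec 0 (Im z)) as [Hi | Hi].
- apply acos_cos; split; [ | lra ].
  apply Hs, Rmult_le_pos; [ exact Hi | left; apply Rinv_0_lt_compat, Hz ].
- rewrite <- cos_neg, acos_cos; [ ring | ].
  split; [ rewrite <- atan_opp; apply Hs | lra ].
  replace (- (Im z / Re z))%R with ((- Im z) / Re z)%R by (field; lra).
  apply Rdiv_le_0_compat; [ lra | apply Hz ].
Qed.

Lemma Clog_scal (r : R) (z : C) :
  (0 < r)%R -> z <> 0 -> Clog (RtoC r * z) = RtoC (ln r) + Clog z.
Proof.
intros Hr Hz; pose proof (proj1 (Cmod_gt_0 _) Hz) as Hm.
assert (HM : Cmod (RtoC r * z) = (r * Cmod z)%R).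
{ rewrite Cmod_mult, Cmod_R, Rabs_pos_eq by lra; reflexivity. }
assert (HI : Im (RtoC r * z) = (r * Im z)%R) by (simpl; unfold Im; ring).
assert (HR : Re (RtoC r * z) = (r * Re z)%R) by (simpl; unfold Re; ring).
unfold Clog, Carg; rewrite HM, HI, HR; apply injective_projections; simpl.
- apply ln_mult; assumption.
- replace (r * Re z / (r * Cmod z))%R with (Re z / Cmod z)%R by (field; lra).
  destruct (Rle_dec 0 (r * Im z)); destruct (Rle_dec 0 (Im z)); try ring; exfalso; nra.
Qed.

Lemma clim_Clog {T : Type} (F : (T -> Prop) -> Prop) {FF : Filter F}
  (f : T -> C) (a : C) :
  (0 < Re a)%R -> filterlim f F (locally a) ->
  filterlim (fun t => Clog (f t)) F (locally (Clog a)).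
Proof.
intros Ha Hf.
pose proof (clim_Cmod F f a Hf) as Hm.
destruct (proj1 (clim_split F f a) Hf) as [Hr Hi].
apply (clim_split F); split; simpl.
- apply (rlim_cont F _ ln); [ | exact Hm ].
  apply continuity_pt_filterlim, derivable_continuous_pt.
  exists (/ Cmod a)%R; apply derivable_pt_lim_ln; pose proof (Re_le_Cmod a); lra.
- rewrite Carg_atan by exact Ha.
  eapply filterlim_ext_loc.
  + generalize (rlim_pos F _ _ Ha Hr); apply filter_imp; intros t Ht.
    symmetry; apply Carg_atan, Ht.
  + apply (rlim_cont F _ atan); [ apply continuous_atan | ].
    apply rlim_mult; auto; apply rlim_inv; auto; lra.
Qed.

Lemma cderiv_Clog (f : R -> C) (t : R) (l : C) :
  (0 < Re (f t))%R -> cderiv f t l ->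
  cderiv (fun s => Clog (f s)) t (l / f t).
Proof.
intros Hp Hd.
assert (Hm : (0 < Cmod (f t))%R) by (pose proof (Re_le_Cmod (f t)); lra).
assert (H0 : f t <> 0) by (now apply Cmod_gt_0).
pose proof (cderiv_Cmod f t l Hd H0) as HM; destruct Hd as [H1 H2].
pose proof (Cmod_sqr (f t)) as Hs.
assert (E : l / f t = ((Re (f t) * Re l + Im (f t) * Im l) / (Cmod (f t) * Cmod (f t)),
   (Re (f t) * Im l - Im (f t) * Re l) / (Cmod (f t) * Cmod (f t)))%R).
{ rewrite Hs; apply injective_projections; unfold Re, Im in *; simpl; field; nra. }
rewrite E; split; simpl.
- evar_last.
  + apply (is_derive_comp ln (fun s => Cmod (f s)) t).
    * apply is_derive_Reals, derivable_pt_lim_ln, Hm.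
    * exact HM.
  + unfold scal; simpl; unfold mult; simpl; field; lra.
- eapply is_derive_ext_loc.
  + pose proof (ex_derive_continuous (V := R_NormedModule) _ _
      (ex_intro _ _ H1)) as Hc.
    generalize (rlim_pos (locally t) _ _ Hp Hc); apply filter_imp; intros s Hs'.
    symmetry; apply Carg_atan, Hs'.
  + evar_last.
    * apply (is_derive_comp atan (fun s => Im (f s) / Re (f s))%R t).
      -- apply is_derive_atan.
      -- apply is_derive_mult_R; [ exact H2 | apply is_derive_inv; [ exact H1 | lra ] ].
    * unfold scal; simpl; unfold mult; simpl; rewrite Hs; unfold Rsqr.
      field; repeat split; nra.
Qed.

(** * Infinite products *)

Lemma exp_sub_1_le (x : R) : (0 <= x <= 1/2)%R -> (exp x - 1 <= 2 * x)%R.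
Proof.
intros Hx; pose proof (exp_ineq1_le (- x)) as H; rewrite exp_Ropp in H.
pose proof (exp_pos x) as Hp.
assert (H1 : (exp x * (1 + - x) <= 1)%R).
{ replace 1%R with (exp x * / exp x)%R at 2 by (field; lra).
  apply Rmult_le_compat_l; lra. }
nra.
Qed.

Lemma archimed_nat (x : R) : exists N : nat, (1 <= N)%nat /\ (x < INR N)%R.
Proof.
destruct (INR_unbounded x) as [n Hn]; exists (S n); split; [ lia | ].
rewrite S_INR; lra.
Qed.

Lemma clim_Cmod_le {T : Type} (F : (T -> Prop) -> Prop) {FF : ProperFilter F}
  (f : T -> C) (l c : C) (M : R) :
  filterlim f F (locally l) -> F (fun t => (Cmod (f t - c) <= M)%R) ->
  (Cmod (l - c) <= M)%R.
Proof.
intros Hf HM; apply Rnot_lt_le; intros Hlt.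
pose proof (proj1 (clim_eps F f l) Hf (Cmod (l - c) - M)%R ltac:(lra)) as H1.
destruct (filter_ex _ (filter_and _ _ H1 HM)) as [t [Ha Hb]].
pose proof (Cmod_triangle (f t - c) (- (f t - l))) as H2.
rewrite Cmod_opp in H2.
replace (f t - c + - (f t - l)) with (l - c) in H2 by ring; lra.
Qed.

Lemma Ccauchy_cv (u : nat -> C) :
  (forall eps : R, (0 < eps)%R ->
     exists N, forall n, (N <= n)%nat -> (Cmod (u n - u N) < eps)%R) ->
  exists l : C, seqlim u l.
Proof.
intros H.
assert (HC : forall p : C -> R,
  (forall a b, (Rabs (p a - p b) <= Cmod (a - b))%R) ->
  ex_finite_lim_seq (fun n => p (u n))).
{ intros p Hp; apply ex_lim_seq_cauchy_corr; intros eps.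
  destruct (H (eps / 2)%R) as [N HN]; [ pose proof (cond_pos eps); lra | ].
  exists N; intros n m Hn Hm.
  pose proof (Rle_lt_trans _ _ _ (Hp _ _) (HN n Hn)) as H1.
  pose proof (Rle_lt_trans _ _ _ (Hp _ _) (HN m Hm)) as H2.
  apply Rabs_def2 in H1; apply Rabs_def2 in H2; apply Rabs_def1; lra. }
destruct (HC Re) as [a Ha]; [ intros; apply (re_le_Cmod (a - b)) | ].
destruct (HC Im) as [b Hb]; [ intros; apply (im_le_Cmod (a0 - b)) | ].
exists (a, b); apply (clim_split eventually); split; assumption.
Qed.

(* Junk value if u diverges. *)
Definition Clim (u : nat -> C) : C :=
  (real (Lim_seq (fun n => Re (u n))), real (Lim_seq (fun n => Im (u n)))).

Lemma Clim_correct (u : nat -> C) (l : C) :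
  seqlim u l -> Clim u = l.
Proof.
intros H; apply (clim_split eventually) in H; destruct H as [H1 H2].
assert (E1 : is_lim_seq (fun n => Re (u n)) (Re l)) by exact H1.
assert (E2 : is_lim_seq (fun n => Im (u n)) (Im l)) by exact H2.
unfold Clim; rewrite (is_lim_seq_unique _ _ E1), (is_lim_seq_unique _ _ E2).
destruct l; reflexivity.
Qed.

Lemma clim_shift (u : nat -> C) (l : C) (N : nat) :
  seqlim (fun n => u (N + n)%nat) l <->
  seqlim u l.
Proof.
rewrite !(clim_eps eventually); split; intros H eps Heps;
destruct (H eps Heps) as [M HM].
- exists (N + M)%nat; intros n Hn.
  replace n with (N + (n - N))%nat by lia; apply HM; lia.
- exists M; intros n Hn; apply HM; lia.
Qed.

Lemma Cprod_ext (f g : nat -> C) (n : nat) :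
  (forall k, (1 <= k <= n)%nat -> f k = g k) -> Cprod f n = Cprod g n.
Proof.
induction n as [ | n IH]; intros H; [ reflexivity | simpl ].
rewrite IH, (H (S n)); [ reflexivity | lia | intros k Hk; apply H; lia ].
Qed.

Lemma Cprod_mult (f g : nat -> C) (n : nat) :
  Cprod (fun k => f k * g k) n = Cprod f n * Cprod g n.
Proof. induction n as [ | n IH]; simpl; [ ring | rewrite IH; ring ]. Qed.

Lemma Cprod_neq_0 (f : nat -> C) (n : nat) :
  (forall k, (1 <= k <= n)%nat -> f k <> 0) -> Cprod f n <> 0.
Proof.
induction n as [ | n IH]; intros H; simpl.
- exact C1_nz.
- apply Cmult_neq_0; [ apply IH; intros k Hk; apply H; lia | apply H; lia ].
Qed.

Lemma Cprod_split (f : nat -> C) (N m : nat) :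
  Cprod f (N + m) = Cprod f N * Cprod (fun k => f (N + k)%nat) m.
Proof.
induction m as [ | m IH]; [ rewrite Nat.add_0_r; simpl; ring | ].
rewrite Nat.add_succ_r; simpl; rewrite IH, Nat.add_succ_r; ring.
Qed.

Lemma clim_Cprod {T : Type} (F : (T -> Prop) -> Prop) {FF : Filter F}
  (f : T -> nat -> C) (g : nat -> C) (n : nat) :
  (forall k, (1 <= k <= n)%nat -> filterlim (fun t => f t k) F (locally (g k))) ->
  filterlim (fun t => Cprod (f t) n) F (locally (Cprod g n)).
Proof.
induction n as [ | n IH]; intros H; simpl.
- apply filterlim_const.
- apply clim_mult; auto; [ apply IH; intros k Hk; apply H; lia | apply H; lia ].
Qed.

(* s stands for the partial sums of a majorant of |f - 1|; with K/n^2 majorants it is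
   chosen so that the sum telescopes. *)
Lemma Cmod_Cprod_sub_1 (f : nat -> C) (s : nat -> R) (n : nat) :
  (forall k, (k < n)%nat -> (Cmod (f (S k) - 1) <= s (S k) - s k)%R) ->
  (Cmod (Cprod f n - 1) <= exp (s n - s O) - 1)%R.
Proof.
induction n as [ | n IH]; intros H; simpl.
- replace (1 - 1) with (RtoC 0) by ring; rewrite Cmod_0, Rminus_diag, exp_0; lra.
- specialize (IH ltac:(intros k Hk; apply H; lia)).
  specialize (H n ltac:(lia)).
  replace (Cprod f n * f (S n) - 1)
    with ((Cprod f n - 1) * (f (S n) - 1) + (Cprod f n - 1) + (f (S n) - 1)) by ring.
  eapply Rle_trans; [ apply Cmod_triangle | ].
  pose proof (Cmod_triangle ((Cprod f n - 1) * (f (S n) - 1)) (Cprod f n - 1)) as H1.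
  rewrite Cmod_mult in H1.
  replace (s (S n) - s O)%R with ((s n - s O) + (s (S n) - s n))%R by ring.
  rewrite exp_plus.
  pose proof (exp_ineq1_le (s (S n) - s n)).
  pose proof (Cmod_ge_0 (Cprod f n - 1)); pose proof (Cmod_ge_0 (f (S n) - 1)).
  pose proof (exp_pos (s n - s O)).
  nra.
Qed.

(** From [1/(n+1)^2 <= 1/(n (n+1))]. This telescoping majorant stands in for every sum of
    [1/n^2]. *)
Lemma inv_sqr_telescope (K : R) (n : nat) :
  (0 <= K)%R -> (1 <= n)%nat ->
  (K / INR (S n) ^ 2 <= K / INR n - K / INR (S n))%R.
Proof.
intros HK Hn; apply le_INR in Hn; change (INR 1) with 1%R in Hn; rewrite S_INR.
replace (K / INR n - K / (INR n + 1))%R with (K * / (INR n * (INR n + 1)))%R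
  by (field; lra).
apply Rmult_le_compat_l; [ exact HK | apply Rinv_le_contravar; nra ].
Qed.

Lemma Cprod_tail_sub_1 (f : nat -> C) (K : R) (N m : nat) :
  (0 <= K)%R -> (1 <= N)%nat ->
  (forall n, (N < n)%nat -> (Cmod (f n - 1) <= K / INR n ^ 2)%R) ->
  (Cmod (Cprod (fun k => f (N + k)%nat) m - 1) <= exp (K / INR N) - 1)%R.
Proof.
intros HK HN Hf.
eapply Rle_trans.
- apply (Cmod_Cprod_sub_1 _ (fun k => - (K / INR (N + k)))%R).
  intros k Hk; eapply Rle_trans; [ apply Hf; lia | ].
  rewrite Nat.add_succ_r.
  pose proof (inv_sqr_telescope K (N + k) HK ltac:(lia)); lra.
- apply Rplus_le_compat_r, exp_le; rewrite Nat.add_0_r.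
  assert (0 <= K / INR (N + m))%R; [ | lra ].
  apply Rdiv_le_0_compat; [ exact HK | apply lt_0_INR; lia ].
Qed.

Lemma Cprod_sub_1 (f : nat -> C) (K : R) (m : nat) :
  (0 <= K)%R ->
  (forall n, (1 <= n)%nat -> (Cmod (f n - 1) <= K / INR n ^ 2)%R) ->
  (Cmod (Cprod f m - 1) <= exp (2 * K) - 1)%R.
Proof.
intros HK Hf.
eapply Rle_trans.
(* The first term is at most [K] and the others telescope to less than [K] in total: hence [2 * K].
   Index 0 is set apart because the majorant starts at [n = 1]. *)
- apply (Cmod_Cprod_sub_1 _ (fun k => match k with O => 0 | _ => 2 * K - K / INR k end)%R).
  intros [ | k] Hk; (eapply Rle_trans; [ apply Hf; lia | ]).
  + simpl; apply Req_le; field.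
  + pose proof (inv_sqr_telescope K (S k) HK ltac:(lia)); lra.
- apply Rplus_le_compat_r, exp_le; destruct m; [ lra | ].
  assert (0 <= K / INR (S m))%R; [ | lra ].
  apply Rdiv_le_0_compat; [ exact HK | apply lt_0_INR; lia ].
Qed.

Lemma Cmod_Cprod_le (f : nat -> C) (K : R) (m : nat) :
  (0 <= K)%R ->
  (forall n, (1 <= n)%nat -> (Cmod (f n - 1) <= K / INR n ^ 2)%R) ->
  (Cmod (Cprod f m) <= exp (2 * K))%R.
Proof.
intros HK Hf; pose proof (Cprod_sub_1 f K m HK Hf) as H.
pose proof (Cmod_triangle (Cprod f m - 1) 1) as H1.
replace (Cprod f m - 1 + 1) with (Cprod f m) in H1 by ring.
rewrite Cmod_1 in H1; lra.
Qed.

Lemma Cprod_diff_le (f : nat -> C) (K : R) (N n : nat) :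
  (0 <= K)%R -> (1 <= N <= n)%nat ->
  (forall n, (1 <= n)%nat -> (Cmod (f n - 1) <= K / INR n ^ 2)%R) ->
  (Cmod (Cprod f n - Cprod f N) <= exp (2 * K) * (exp (K / INR N) - 1))%R.
Proof.
intros HK HN Hf; replace n with (N + (n - N))%nat by lia; rewrite Cprod_split.
replace (Cprod f N * Cprod (fun k => f (N + k)%nat) (n - N) - Cprod f N)
  with (Cprod f N * (Cprod (fun k => f (N + k)%nat) (n - N) - 1)) by ring.
rewrite Cmod_mult; apply Rmult_le_compat; try apply Cmod_ge_0.
- apply Cmod_Cprod_le; assumption.
- apply Cprod_tail_sub_1; [ exact HK | lia | intros k Hk; apply Hf; lia ].
Qed.

Lemma exp_tail_small (K eps : R) : (0 <= K)%R -> (0 < eps)%R ->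
  exists N, (1 <= N)%nat /\ (exp (K / INR N) - 1 < eps)%R.
Proof.
intros HK Heps.
destruct (archimed_nat (2 * K + 2 * K / eps)) as [N [HN1 HN]].
exists N; split; [ exact HN1 | ].
assert (HNp : (0 < INR N)%R) by (apply lt_0_INR; lia).
assert (Hq : (0 <= 2 * K / eps)%R)
  by (apply Rdiv_le_0_compat; [ lra | apply Heps ]).
eapply Rle_lt_trans; [ apply exp_sub_1_le; split | ].
- apply Rdiv_le_0_compat; [ lra | apply HNp ].
- apply (Rmult_le_reg_r (INR N)); [ exact HNp | ].
  unfold Rdiv; rewrite Rmult_assoc, Rinv_l; lra.
- apply (Rmult_lt_reg_r (INR N)); [ exact HNp | ].
  replace (2 * (K / INR N) * INR N)%R with (eps * (2 * K / eps))%R by (field; lra).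
  apply Rmult_lt_compat_l; lra.
Qed.

Lemma infprod_cv (f : nat -> C) (K : R) :
  (0 <= K)%R ->
  (forall n, (1 <= n)%nat -> (Cmod (f n - 1) <= K / INR n ^ 2)%R) ->
  exists P : C, seqlim (Cprod f) P.
Proof.
intros HK Hf; apply Ccauchy_cv; intros eps Heps.
assert (He : (0 < eps / exp (2 * K))%R)
  by (apply Rdiv_lt_0_compat; [ exact Heps | apply exp_pos ]).
destruct (exp_tail_small K _ HK He) as [N [HN1 HN]].
exists N; intros n Hn.
eapply Rle_lt_trans; [ apply (Cprod_diff_le f K); auto | ].
pose proof (exp_pos (2 * K)).
apply (Rmult_lt_compat_l (exp (2 * K))) in HN; [ | assumption ].
replace (exp (2 * K) * (eps / exp (2 * K)))%R with eps in HN by (field; lra).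
exact HN.
Qed.

Lemma infprod_diff_le (f : nat -> C) (K : R) (P : C) (N : nat) :
  (0 <= K)%R -> (1 <= N)%nat ->
  (forall n, (1 <= n)%nat -> (Cmod (f n - 1) <= K / INR n ^ 2)%R) ->
  seqlim (Cprod f) P ->
  (Cmod (P - Cprod f N) <= exp (2 * K) * (exp (K / INR N) - 1))%R.
Proof.
intros HK HN Hf HP; apply (clim_Cmod_le eventually _ _ _ _ HP).
exists N; intros n Hn; apply Cprod_diff_le; auto.
Qed.

(** Beyond a large [N] all products of tail factors stay within 1/2 of 1, so their limit is not
    0. *)
Lemma is_infprod_intro (f : nat -> C) (K : R) (P : C) :
  (0 <= K)%R ->
  (forall n, (1 <= n)%nat -> (Cmod (f n - 1) <= K / INR n ^ 2)%R) ->
  seqlim (Cprod f) P -> is_infprod f P.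
Proof.
intros HK Hf HP; split; [ exact HP | ].
destruct (exp_tail_small K (1/2) HK ltac:(lra)) as [N [HN1 HN]].
destruct (infprod_cv (fun k => f (N + k)%nat) K HK) as [L HL].
{ intros n Hn; eapply Rle_trans; [ apply Hf; lia | ].
  apply Rmult_le_compat_l; [ exact HK | apply Rinv_le_contravar ].
  - apply pow_lt, lt_0_INR; lia.
  - apply pow_incr; split; [ apply pos_INR | apply le_INR; lia ]. }
exists N, L; split; [ intros HL0 | exact HL ].
assert (H : (Cmod (L - 1) <= exp (K / INR N) - 1)%R).
{ apply (clim_Cmod_le eventually _ _ _ _ HL); exists O; intros m _.
  apply Cprod_tail_sub_1; [ exact HK | exact HN1 | intros k Hk; apply Hf; lia ]. }
rewrite HL0 in H; replace (0 - 1) with (Copp 1) in H by ring.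
rewrite Cmod_opp, Cmod_1 in H; lra.
Qed.

Lemma is_infprod_neq_0 (f : nat -> C) (P : C) :
  is_infprod f P -> (forall n, (1 <= n)%nat -> f n <> 0) -> P <> 0.
Proof.
intros [HP [N [L [HL0 HL]]]] Hf.
assert (E : P = Cprod f N * L).
{ apply (clim_unique eventually (fun m => Cprod f (N + m))).
  - apply (clim_shift (Cprod f) P N), HP.
  - eapply filterlim_ext; [ intros m; symmetry; apply Cprod_split | ].
    apply clim_mult; [ apply eventually_filter | apply filterlim_const | exact HL ]. }
rewrite E; apply Cmult_neq_0; [ | exact HL0 ].
apply Cprod_neq_0; intros k Hk; apply Hf; lia.
Qed.

(** The quotient of consecutive partial products of the tail tends to [L / L]. This is how
    convergence of the two products will force [Re (x1 / x2) > 0]. *)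
Lemma is_infprod_term (f : nat -> C) (P : C) :
  is_infprod f P -> seqlim f (RtoC 1).
Proof.
intros [_ [N [L [HL0 HL]]]].
apply (clim_shift f 1 (S N)).
set (Q := Cprod (fun k => f (N + k)%nat)) in *.
assert (HQ : seqlim (fun n => Q (S n) / Q n) (L / L)).
{ apply clim_div; [ apply eventually_filter | exact HL0 | | exact HL ].
  apply (clim_shift Q L 1), HL. }
replace (L / L) with (RtoC 1) in HQ by (field; exact HL0).
eapply filterlim_ext_loc; [ | exact HQ ].
destruct (proj1 (clim_eps eventually Q L) HL (Cmod L)) as [M HM].
{ apply Cmod_gt_0, HL0. }
exists M; intros n Hn.
assert (Hq : Q n <> 0).
{ intros H; specialize (HM n Hn); rewrite H in HM.
  replace (0 - L) with (- L) in HM by ring; rewrite Cmod_opp in HM; lra. }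
change (Q (S n)) with (Q n * f (N + S n)%nat); rewrite Nat.add_succ_r; simpl.
field; exact Hq.
Qed.

(** The majorant is uniform in [t], hence so is the approximation of [P] by partial products: an
    [eps / 3] argument. *)
Lemma infprod_continuous_on (D : R -> Prop) (f : R -> nat -> C) (P : R -> C) (K : R) :
  (0 <= K)%R ->
  (forall t n, D t -> (1 <= n)%nat -> (Cmod (f t n - 1) <= K / INR n ^ 2)%R) ->
  (forall n, (1 <= n)%nat -> continuous_on D (fun t => f t n)) ->
  (forall t, D t -> seqlim (Cprod (f t)) (P t)) ->
  continuous_on D P.
Proof.
intros HK Hf Hc HP t Ht; apply (clim_eps (within D (locally t))); intros eps Heps.
assert (He : (0 < eps / 3 / exp (2 * K))%R)
  by (apply Rdiv_lt_0_compat; [ lra | apply exp_pos ]).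
destruct (exp_tail_small K _ HK He) as [N [HN1 HN]].
assert (HB : forall s, D s -> (Cmod (P s - Cprod (f s) N) < eps / 3)%R).
{ intros s Hs; eapply Rle_lt_trans; [ apply (infprod_diff_le (f s) K); auto | ].
  pose proof (exp_pos (2 * K)).
  apply (Rmult_lt_compat_l (exp (2 * K))) in HN; [ | assumption ].
  replace (exp (2 * K) * (eps / 3 / exp (2 * K)))%R with (eps / 3)%R in HN by (field; lra).
  exact HN. }
assert (HL : filterlim (fun s => Cprod (f s) N) (within D (locally t))
               (locally (Cprod (f t) N))).
{ apply (clim_Cprod (within D (locally t))); intros k Hk.
  apply (Hc k ltac:(lia) t Ht). }
pose proof (proj1 (clim_eps (within D (locally t)) _ _) HL (eps / 3)%R ltac:(lra)) as H1.
unfold within in H1 |- *; revert H1; apply filter_imp; intros s Hs HDs.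
specialize (Hs HDs); pose proof (HB s HDs) as H1; pose proof (HB t Ht) as H2.
replace (P s - P t) with ((P s - Cprod (f s) N) + (Cprod (f s) N - Cprod (f t) N)
   + - (P t - Cprod (f t) N)) by ring.
eapply Rle_lt_trans; [ apply Cmod_triangle | ].
pose proof (Cmod_triangle (P s - Cprod (f s) N) (Cprod (f s) N - Cprod (f t) N)).
rewrite Cmod_opp; lra.
Qed.

(** * Euler's product for sinh *)

Definition Ccosh (z : C) : C := (Cexp z + Cexp (- z)) / 2.

Lemma C2_neq_0 : RtoC 2 <> 0.
Proof. apply RtoC_neq_0; lra. Qed.

Lemma cderiv_Csinh (f : R -> C) (t : R) (a : C) :
  cderiv f t a -> cderiv (fun s => Csinh (f s)) t (a * Ccosh (f t)).
Proof.
intros H; eapply cderiv_eq.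
- apply cderiv_mult; [ apply cderiv_minus | apply cderiv_const ].
  + apply cderiv_Cexp, H.
  + apply cderiv_Cexp, cderiv_opp, H.
- unfold Ccosh; cbv beta; field; exact C2_neq_0.
Qed.

Lemma cderiv_Ccosh (f : R -> C) (t : R) (a : C) :
  cderiv f t a -> cderiv (fun s => Ccosh (f s)) t (a * Csinh (f t)).
Proof.
intros H; eapply cderiv_eq.
- apply cderiv_mult; [ apply cderiv_plus | apply cderiv_const ].
  + apply cderiv_Cexp, H.
  + apply cderiv_Cexp, cderiv_opp, H.
- unfold Csinh; cbv beta; field; exact C2_neq_0.
Qed.

(** * Integrals over [0, PI/2] and complex Wallis integrals *)

Definition ccont (f : R -> C) : Prop :=
  forall t, filterlim f (locally t) (locally (f t)).

Definition Cint (f : R -> C) : C :=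
  (RInt (fun t => Re (f t)) 0 (PI / 2), RInt (fun t => Im (f t)) 0 (PI / 2)).

Lemma ccont_ex_RInt (f : R -> C) (a b : R) : ccont f ->
  ex_RInt (fun t => Re (f t)) a b /\ ex_RInt (fun t => Im (f t)) a b.
Proof.
intros Hf; split; apply (ex_RInt_continuous (V := R_CompleteNormedModule)); intros t _;
apply (clim_split (locally t) f (f t)), Hf.
Qed.

Lemma ccont_cderiv (f f' : R -> C) : (forall t, cderiv f t (f' t)) -> ccont f.
Proof. intros H t; exact (cderiv_clim _ _ _ (H t)). Qed.

Lemma ccont_mult (f g : R -> C) : ccont f -> ccont g -> ccont (fun t => f t * g t).
Proof. intros Hf Hg t; apply clim_mult; auto; apply locally_filter. Qed.

Lemma ccont_minus (f g : R -> C) : ccont f -> ccont g -> ccont (fun t => f t - g t).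
Proof. intros Hf Hg t; apply clim_minus; auto; apply locally_filter. Qed.

Lemma ccont_const (c : C) : ccont (fun _ => c).
Proof. intros t; apply filterlim_const. Qed.

Lemma ccont_RtoC (f : R -> R) : (forall t, continuous f t) -> ccont (fun t => RtoC (f t)).
Proof. intros H t; apply clim_RtoC; [ apply locally_filter | apply H ]. Qed.

Lemma Cint_derive (G g : R -> C) :
  (forall t, cderiv G t (g t)) -> ccont g -> Cint g = G (PI / 2)%R - G 0%R.
Proof.
intros HG Hg; apply injective_projections; unfold Cint; cbn [fst snd].
- apply is_RInt_unique, (is_RInt_derive (V := R_CompleteNormedModule) (fun t => Re (G t)) (fun t => Re (g t)));
  intros t _; [ apply (HG t) | apply (clim_split (locally t) g (g t)), Hg ].
- apply is_RInt_unique, (is_RInt_derive (V := R_CompleteNormedModule) (fun t => Im (G t)) (fun t => Im (g t)));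
  intros t _; [ apply (HG t) | apply (clim_split (locally t) g (g t)), Hg ].
Qed.

Lemma Cint_minus (f g : R -> C) : ccont f -> ccont g ->
  Cint (fun t => f t - g t) = Cint f - Cint g.
Proof.
intros Hf Hg; destruct (ccont_ex_RInt f 0 (PI / 2) Hf), (ccont_ex_RInt g 0 (PI / 2) Hg).
apply injective_projections; simpl; apply (RInt_minus (V := R_CompleteNormedModule));
assumption.
Qed.

Lemma Cint_scal (c : C) (f : R -> C) : ccont f ->
  Cint (fun t => c * f t) = c * Cint f.
Proof.
intros Hf; destruct (ccont_ex_RInt f 0 (PI / 2) Hf) as [H1 H2].
assert (HS : forall (k : R) g, ex_RInt g 0 (PI / 2) ->
          ex_RInt (fun t => k * g t)%R 0 (PI / 2) /\
          RInt (fun t => k * g t)%R 0 (PI / 2) = (k * RInt g 0 (PI / 2))%R).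
{ intros k g Hg; split.
  - apply (ex_RInt_scal (V := R_NormedModule)), Hg.
  - apply (RInt_scal (V := R_CompleteNormedModule)), Hg. }
apply injective_projections; unfold Cint; cbn [fst snd].
- transitivity (minus (RInt (fun t => Re c * Re (f t))%R 0 (PI / 2))
                      (RInt (fun t => Im c * Im (f t))%R 0 (PI / 2))).
  + apply (RInt_minus (V := R_CompleteNormedModule)); apply HS; assumption.
  + rewrite (proj2 (HS _ _ H1)), (proj2 (HS _ _ H2)); reflexivity.
- transitivity (plus (RInt (fun t => Re c * Im (f t))%R 0 (PI / 2))
                     (RInt (fun t => Im c * Re (f t))%R 0 (PI / 2))).
  + apply (RInt_plus (V := R_CompleteNormedModule)); apply HS; assumption.
  + rewrite (proj2 (HS _ _ H1)), (proj2 (HS _ _ H2)); reflexivity.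
Qed.

Lemma Cmod_Cint_le (f : R -> C) (g : R -> R) : ccont f -> (forall t, continuous g t) ->
  (forall t, (0 <= t <= PI / 2)%R -> (Cmod (f t) <= g t)%R) ->
  (Cmod (Cint f) <= 2 * RInt g 0 (PI / 2))%R.
Proof.
intros Hf Hg Hfg; destruct (ccont_ex_RInt f 0 (PI / 2) Hf) as [H1 H2].
assert (Hg' : ex_RInt g 0 (PI / 2)).
{ apply (ex_RInt_continuous (V := R_CompleteNormedModule)); intros t _; apply Hg. }
pose proof PI_RGT_0 as HPI.
assert (HB : forall h : R -> R, ex_RInt h 0 (PI / 2) ->
   (forall t, (0 <= t <= PI / 2)%R -> (Rabs (h t) <= g t)%R) ->
   (Rabs (RInt h 0 (PI / 2)) <= RInt g 0 (PI / 2))%R).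
{ intros h Hh Hb; apply Rabs_le; split.
  - rewrite <- (RInt_opp (V := R_CompleteNormedModule) g) by exact Hg'.
    apply RInt_le; [ lra | apply (ex_RInt_opp (V := R_NormedModule)), Hg' | exact Hh | ].
    intros t Ht; specialize (Hb t ltac:(lra)); apply Rabs_le_between in Hb.
    unfold opp; simpl; lra.
  - apply RInt_le; [ lra | exact Hh | exact Hg' | ].
    intros t Ht; specialize (Hb t ltac:(lra)); apply Rabs_le_between in Hb; lra. }
eapply Rle_trans; [ apply Cmod_le_Re_Im | simpl ].
pose proof (HB _ H1 (fun t Ht => Rle_trans _ _ _ (re_le_Cmod (f t)) (Hfg t Ht))).
pose proof (HB _ H2 (fun t Ht => Rle_trans _ _ _ (im_le_Cmod (f t)) (Hfg t Ht))).
simpl in *; lra.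
Qed.

(** The elementary route to Euler's product. Integration by parts gives a recurrence in [m]; divided
    by its instance at [z = 0] it produces the factor [1 + z^2 / (2 m + 2)^2]. What remains tends to
    1, since the weight [cos^(2 m)] concentrates at [t = 0]. *)
Definition wallis (m : nat) (z : C) : C :=
  Cint (fun t => Ccosh (RtoC t * z) * RtoC (cos t ^ (2 * m))%R).

Lemma Ccosh_0 : Ccosh 0 = 1.
Proof.
unfold Ccosh; rewrite Copp_0, Cexp_0; field; exact C2_neq_0.
Qed.

Lemma Csinh_0 : Csinh 0 = 0.
Proof. unfold Csinh; rewrite Copp_0, Cexp_0; field; exact C2_neq_0. Qed.

Lemma cderiv_scal_id (z : C) (t : R) : cderiv (fun s => RtoC s * z) t z.
Proof.
eapply cderiv_eq; [ apply cderiv_mult; [ apply cderiv_id | apply cderiv_const ] | ].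
cbv beta; ring.
Qed.

Lemma continuous_cos_pow (n : nat) (t : R) : continuous (fun s => cos s ^ n)%R t.
Proof.
apply (ex_derive_continuous (V := R_NormedModule)); auto_derive; exact I.
Qed.

Lemma ccont_wallis (n : nat) (z : C) :
  ccont (fun t => Ccosh (RtoC t * z) * RtoC (cos t ^ n)%R).
Proof.
apply ccont_mult.
- eapply ccont_cderiv; intros t; apply cderiv_Ccosh, cderiv_scal_id.
- apply ccont_RtoC, continuous_cos_pow.
Qed.

Lemma wallis_0_l (z : C) : z * wallis 0 z = Csinh (RtoC (PI / 2) * z).
Proof.
unfold wallis.
rewrite <- Cint_scal by apply (ccont_wallis (2 * 0)).
rewrite (Cint_derive (fun t => Csinh (RtoC t * z))).
- rewrite Cmult_0_l, Csinh_0; ring.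
- intros t; eapply cderiv_eq; [ apply cderiv_Csinh, cderiv_scal_id | ].
  simpl; ring.
- apply ccont_mult; [ apply ccont_const | apply (ccont_wallis (2 * 0)) ].
Qed.

Lemma is_derive_cos_pow (k : nat) (t : R) :
  is_derive (fun s => cos s ^ S k)%R t (- (INR (S k) * cos t ^ k * sin t))%R.
Proof.
evar_last.
- apply (is_derive_pow cos (S k) t), is_derive_cos.
- simpl pred; ring.
Qed.

Lemma wallis_rec (m : nat) (z : C) :
  (z * z + INR (2 * S m) * INR (2 * S m)) * wallis (S m) z
  = INR (2 * S m) * INR (2 * m + 1) * wallis m z.
Proof.
unfold wallis.
replace (2 * S m)%nat with (S (S (2 * m))) by lia.
replace (2 * m + 1)%nat with (S (2 * m)) by lia.
set (p := (2 * m)%nat); rewrite (S_INR (S p)).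
set (n := INR (S p)).
enough (E : Cint (fun t => (z * z + RtoC (n + 1) * RtoC (n + 1))
          * (Ccosh (RtoC t * z) * RtoC (cos t ^ S (S p))%R)
        - RtoC (n + 1) * n * (Ccosh (RtoC t * z) * RtoC (cos t ^ p)%R)) = 0).
{ rewrite Cint_minus, !Cint_scal in E;
    try (apply ccont_mult; [ apply ccont_const | ]); try apply ccont_wallis.
  set (a := Cint _) in E |- *; set (b := Cint _) in E |- *.
  replace ((z * z + RtoC (n + 1) * RtoC (n + 1)) * a)
    with ((z * z + RtoC (n + 1) * RtoC (n + 1)) * a - RtoC (n + 1) * n * b
          + RtoC (n + 1) * n * b) by ring.
  rewrite E; ring. }
(* The boundary terms of two integrations by parts, collected into one primitive. It vanishes at 0
   because of [sinh] and [sin], and at PI/2 because of the powers of [cos]. *)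
rewrite (Cint_derive (fun t => z * Csinh (RtoC t * z) * RtoC (cos t ^ S (S p))%R
   + RtoC (n + 1) * Ccosh (RtoC t * z) * RtoC (cos t ^ S p * sin t)%R)).
- rewrite cos_PI2, sin_0, Cmult_0_l, Csinh_0, !pow_i by lia.
  rewrite !Rmult_0_r, !Rmult_0_l; ring.
- intros t; eapply cderiv_eq.
  + apply cderiv_plus; apply cderiv_mult.
    * apply cderiv_mult; [ apply cderiv_const | apply cderiv_Csinh, cderiv_scal_id ].
    * apply cderiv_RtoC, is_derive_cos_pow.
    * apply cderiv_mult; [ apply cderiv_const | apply cderiv_Ccosh, cderiv_scal_id ].
    * apply cderiv_RtoC, is_derive_mult_R; [ apply is_derive_cos_pow | apply is_derive_sin ].
  + cbv beta; rewrite (S_INR (S p)); fold n.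
    set (c := (cos t ^ p)%R).
    change (cos t ^ S p)%R with (cos t * c)%R.
    change (cos t ^ S (S p))%R with (cos t * (cos t * c))%R.
    pose proof (sin2_cos2 t) as Hsc; unfold Rsqr in Hsc.
    assert (Hs : (- (n * c * sin t) * sin t + cos t * c * cos t)%R
       = ((n + 1) * (cos t * (cos t * c)) - n * c)%R).
    { transitivity (- n * c * (sin t * sin t) + cos t * cos t * c)%R; [ ring | ].
      replace (sin t * sin t)%R with (1 - cos t * cos t)%R by lra; ring. }
    rewrite Hs, !RtoC_minus, !RtoC_opp, !RtoC_mult; ring.
- apply ccont_minus; (apply ccont_mult; [ apply ccont_const | apply ccont_wallis ]).
Qed.

Definition wallis_R (m : nat) : R := RInt (fun t => cos t ^ (2 * m))%R 0 (PI / 2).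

Lemma wallis_R_RtoC (m : nat) : wallis m 0 = RtoC (wallis_R m).
Proof.
assert (E : forall t, Ccosh (RtoC t * 0) * RtoC (cos t ^ (2 * m))%R
                      = RtoC (cos t ^ (2 * m))%R).
{ intros t; rewrite Cmult_0_r, Ccosh_0; ring. }
unfold wallis, Cint, wallis_R; apply injective_projections; cbn [fst snd RtoC].
- apply RInt_ext; intros t _; rewrite E; reflexivity.
- transitivity (RInt (fun _ => 0%R) 0 (PI / 2)).
  + apply RInt_ext; intros t _; rewrite E; reflexivity.
  + rewrite (RInt_const (V := R_CompleteNormedModule)).
    unfold scal; simpl; unfold mult; simpl; ring.
Qed.

Lemma wallis_R_rec (m : nat) :
  (INR (2 * S m) * wallis_R (S m) = INR (2 * m + 1) * wallis_R m)%R.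
Proof.
pose proof (wallis_rec m 0) as H; rewrite !wallis_R_RtoC in H.
apply (f_equal Re) in H; simpl in H.
assert (Hn : (INR (2 * S m) <> 0)%R) by (apply not_0_INR; lia).
apply (Rmult_eq_reg_l (INR (2 * S m))); [ | exact Hn ].
unfold Re in H; simpl in H |- *; lra.
Qed.

Lemma wallis_R_0 : wallis_R 0 = (PI / 2)%R.
Proof.
unfold wallis_R; simpl; rewrite (RInt_const (V := R_CompleteNormedModule)).
unfold scal; simpl; unfold mult; simpl; ring.
Qed.

Lemma wallis_R_pos (m : nat) : (0 < wallis_R m)%R.
Proof.
induction m as [ | m IH].
- rewrite wallis_R_0; pose proof PI_RGT_0; lra.
- pose proof (wallis_R_rec m) as H.
  assert (0 < INR (2 * S m))%R by (apply lt_0_INR; lia).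
  assert (0 < INR (2 * m + 1))%R by (apply lt_0_INR; lia).
  nra.
Qed.

(** A weak Jordan inequality: [sin t >= t - t^3 / 6], and [t <= 2] because PI is at most 4. *)
Lemma jordan (t : R) : (0 <= t <= PI / 2)%R -> (t <= 3 * sin t)%R.
Proof.
intros Ht; pose proof PI_4; pose proof PI_RGT_0.
pose proof (proj1 (sin_bound t 0 ltac:(lra) ltac:(lra))) as Hs.
unfold sin_approx, sin_term in Hs; simpl in Hs.
assert (E : (t * t * t <= 4 * t)%R) by nra.
lra.
Qed.

Lemma Ccosh_sub_1_le (x : C) :
  (Cmod (Ccosh x - 1) <= 4 * (Cmod x * Cmod x * exp (Cmod x)))%R.
Proof.
replace (Ccosh x - 1) with
  (((Cexp x - 1 - x) + (Cexp (- x) - 1 - - x)) * RtoC (/ 2)).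
2: { unfold Ccosh; rewrite RtoC_inv by lra; field; exact C2_neq_0. }
rewrite Cmod_mult, Cmod_R, Rabs_pos_eq by lra.
pose proof (Cmod_triangle (Cexp x - 1 - x) (Cexp (- x) - 1 - - x)).
pose proof (Cexp_sub_1_sub_le x); pose proof (Cexp_sub_1_sub_le (- x)).
rewrite Cmod_opp in *; lra.
Qed.

Lemma wallis_near (m : nat) (z : C) :
  (Cmod (wallis m z / RtoC (wallis_R m) - 1)
   <= 72 * (Cmod z * Cmod z * exp (2 * Cmod z)) / INR (2 * S m))%R.
Proof.
(* [36 = 4 * 3^2], with 4 from [Ccosh_sub_1_le] and 3 from [jordan]; [Cmod_Cint_le] doubles it to
   72. The exponent [2 * Cmod z] uses [t <= 2]. *)
set (K := (36 * (Cmod z * Cmod z * exp (2 * Cmod z)))%R).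
pose proof (wallis_R_pos m) as HW; pose proof PI_4; pose proof PI_RGT_0.
assert (HN : (0 < INR (2 * S m))%R) by (apply lt_0_INR; lia).
assert (HWC : RtoC (wallis_R m) <> 0).
{ apply RtoC_neq_0; lra. }
(* By t <= 3 sin t the error is at most K times the integral of sin^2 cos^(2m), which is
   W_m - W_(m+1) = W_m / (2m + 2). *)
assert (HD : (RInt (fun t => K * (sin t * sin t * cos t ^ (2 * m)))%R 0 (PI / 2)
            = K * (wallis_R m / INR (2 * S m)))%R).
{ assert (Hc : forall n, ex_RInt (fun t => cos t ^ n)%R 0 (PI / 2)).
  { intros n; apply (ex_RInt_continuous (V := R_CompleteNormedModule)); intros t _.
    apply continuous_cos_pow. }
  transitivity (scal K (minus (wallis_R m) (wallis_R (S m)))).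
  - unfold wallis_R; rewrite <- (RInt_minus (V := R_CompleteNormedModule)) by apply Hc.
    rewrite <- (RInt_scal (V := R_CompleteNormedModule))
      by (apply (ex_RInt_minus (V := R_NormedModule)); apply Hc).
    apply RInt_ext; intros t _; unfold scal, minus, plus, opp; simpl.
    unfold mult; simpl; fold (Nat.add m).
    replace (m + S (m + 0))%nat with (S (2 * m)) by lia.
    replace (m + (m + 0))%nat with (2 * m)%nat by lia.
    pose proof (sin2_cos2 t) as Hsc; unfold Rsqr in Hsc.
    replace (sin t * sin t)%R with (1 - cos t * cos t)%R by lra; simpl; ring.
  - change (K * (wallis_R m + - wallis_R (S m)) = K * (wallis_R m / INR (2 * S m)))%R.
    f_equal; pose proof (wallis_R_rec m) as Hr; revert Hr HN.
    replace (2 * S m)%nat with (S (2 * m + 1)) by lia; rewrite S_INR.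
    set (q := INR (2 * m + 1)); intros Hr HN.
    replace (wallis_R (S m)) with (q * wallis_R m / (q + 1))%R
      by (rewrite <- Hr; field; lra).
    field; lra. }
assert (HB : (Cmod (wallis m z - RtoC (wallis_R m)) <= 2 * (K * (wallis_R m / INR (2 * S m))))%R).
{ rewrite <- HD, <- wallis_R_RtoC; unfold wallis; rewrite <- Cint_minus by apply ccont_wallis.
  apply Cmod_Cint_le.
  - apply ccont_minus; apply ccont_wallis.
  - intros t; apply (ex_derive_continuous (V := R_NormedModule)); auto_derive; exact I.
  - intros t Ht.
    replace (Ccosh (RtoC t * z) * RtoC (cos t ^ (2 * m))%R
      - Ccosh (RtoC t * 0) * RtoC (cos t ^ (2 * m))%R)
      with ((Ccosh (RtoC t * z) - 1) * RtoC (cos t ^ (2 * m))%R)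
      by (rewrite Cmult_0_r, Ccosh_0; ring).
    rewrite Cmod_mult, Cmod_R, <- Rmult_assoc, Rabs_pos_eq
      by (rewrite pow_mult; apply pow_le, pow2_ge_0).
    apply Rmult_le_compat_r; [ rewrite pow_mult; apply pow_le, pow2_ge_0 | ].
    eapply Rle_trans; [ apply Ccosh_sub_1_le | ].
    rewrite Cmod_mult, Cmod_R, Rabs_pos_eq by lra.
    pose proof (jordan t Ht) as Hj; pose proof (Cmod_ge_0 z) as Hz.
    assert (He : (exp (t * Cmod z) <= exp (2 * Cmod z))%R) by (apply exp_le; nra).
    unfold K.
    replace (4 * (t * Cmod z * (t * Cmod z) * exp (t * Cmod z)))%R
      with (4 * (Cmod z * Cmod z) * ((t * t) * exp (t * Cmod z)))%R by ring.
    replace (36 * (Cmod z * Cmod z * exp (2 * Cmod z)) * (sin t * sin t))%R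
      with (4 * (Cmod z * Cmod z) * ((9 * (sin t * sin t)) * exp (2 * Cmod z)))%R by ring.
    apply Rmult_le_compat_l; [ apply Rmult_le_pos; nra | ].
    assert (Hsq : (t * t <= (3 * sin t) * (3 * sin t))%R)
      by (apply Rmult_le_compat; lra).
    apply Rmult_le_compat; [ nra | left; apply exp_pos | lra | exact He ]. }
replace (wallis m z / RtoC (wallis_R m) - 1)
  with ((wallis m z - RtoC (wallis_R m)) * / RtoC (wallis_R m)) by (field; exact HWC).
rewrite Cmod_mult, Cmod_inv, Cmod_R, Rabs_pos_eq by (assumption || lra).
apply (Rmult_le_reg_r (wallis_R m)); [ exact HW | ].
rewrite Rmult_assoc, Rinv_l, Rmult_1_r by lra.
eapply Rle_trans; [ exact HB | apply Req_le; unfold K; field; lra ].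
Qed.

Lemma INR_C_neq_0 (n : nat) : (1 <= n)%nat -> RtoC (INR n) <> 0.
Proof.
intros Hn; apply RtoC_neq_0, not_0_INR; lia.
Qed.

Lemma wallis_Cprod (m : nat) (z : C) :
  wallis 0 z / RtoC (PI / 2) =
  Cprod (fun k => 1 + z * z / (INR (2 * k) * INR (2 * k))) m
  * (wallis m z / RtoC (wallis_R m)).
Proof.
assert (HW : forall k, RtoC (wallis_R k) <> 0).
{ intros k; apply RtoC_neq_0; pose proof (wallis_R_pos k); lra. }
induction m as [ | m IH].
- simpl Cprod; rewrite wallis_R_0, Cmult_1_l; reflexivity.
- rewrite IH; cbn [Cprod]; rewrite <- Cmult_assoc; f_equal.
  pose proof (wallis_rec m z) as H1.
  pose proof (f_equal RtoC (wallis_R_rec m)) as H2; rewrite !RtoC_mult in H2.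
  assert (Ha : RtoC (INR (2 * S m)) <> 0) by (apply INR_C_neq_0; lia).
  assert (Hb : RtoC (INR (2 * m + 1)) <> 0) by (apply INR_C_neq_0; lia).
  pose proof (HW m); pose proof (HW (S m)).
  set (n := RtoC (INR (2 * S m))) in *; set (n' := RtoC (INR (2 * m + 1))) in *.
  assert (H3 : wallis m z = (z * z + n * n) * wallis (S m) z / (n * n')).
  { rewrite H1; field; auto. }
  assert (H4 : RtoC (wallis_R m) = n * RtoC (wallis_R (S m)) / n').
  { rewrite H2; field; auto. }
  rewrite H3, H4; clearbody n n'; field; auto.
Qed.

(** Applied at [2 z], [wallis_Cprod] has factors [1 + (2 z)^2 / (2 k)^2 = 1 + z^2 / k^2], and
    [wallis_0_l] yields [sinh (PI/2 * 2 z)]. *)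
Theorem Csinh_product (z : C) :
  seqlim (fun m => RtoC PI * z * Cprod (fun k => 1 + z * z / (INR k * INR k)) m) (Csinh (RtoC PI * z)).
Proof.
set (R := fun m => wallis m (2 * z) / RtoC (wallis_R m)).
pose proof PI_RGT_0 as HPI.
pose proof RtoC_PI_neq_0 as HPC.
assert (HR : seqlim R (RtoC 1)).
{ set (K := (72 * (Cmod (2 * z) * Cmod (2 * z) * exp (2 * Cmod (2 * z))))%R).
  apply (clim_squeeze eventually R 1 (fun m => K * / INR (2 * S m))%R).
  - exists O; intros m _; pose proof (wallis_near m (2 * z)) as H; unfold Rdiv in H; exact H.
  - replace 0%R with (K * 0)%R by ring; apply (rlim_mult eventually).
    + apply filterlim_const.
    + apply (is_lim_seq_inv (fun m => INR (2 * S m)) p_infty).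
      * apply (is_lim_seq_le_p_loc INR); [ exists O; intros n _; apply le_INR; lia | ].
        apply is_lim_seq_INR.
      * discriminate. }
assert (HE : Csinh (RtoC PI * z) = RtoC PI * z * (wallis 0 (2 * z) / RtoC (PI / 2))).
{ replace (RtoC PI * z) with (RtoC (PI / 2) * (2 * z)) at 1.
  - rewrite <- wallis_0_l, RtoC_div by lra; field; exact HPC.
  - rewrite RtoC_div by lra; field; exact C2_neq_0. }
rewrite HE; apply clim_mult; [ apply eventually_filter | apply filterlim_const | ].
(* The partial product is a constant divided by [R m], so the limit is written as that constant over
   [lim R = 1]. *)
assert (E1 : forall c : C, c = c / 1) by (intros c; field; exact C1_nz).
rewrite (E1 (wallis 0 (2 * z) / RtoC (PI / 2))).
eapply filterlim_ext_loc;
  [ | apply (clim_div eventually (fun _ => wallis 0 (2 * z) / RtoC (PI / 2)) R);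
      [ exact C1_nz | apply filterlim_const | exact HR ] ].
destruct (proj1 (clim_eps eventually R 1) HR 1%R ltac:(lra)) as [N HN].
exists N; intros m Hm; cbv beta.
assert (HRm : R m <> 0).
{ intros E; specialize (HN m Hm); rewrite E in HN.
  replace (0 - 1) with (Copp 1) in HN by ring; rewrite Cmod_opp, Cmod_1 in HN; lra. }
rewrite (wallis_Cprod m (2 * z)); fold (R m).
replace (Cprod (fun k => 1 + z * z / (INR k * INR k)) m)
  with (Cprod (fun k => 1 + 2 * z * (2 * z) / (INR (2 * k) * INR (2 * k))) m).
- field; exact HRm.
- apply Cprod_ext; intros k Hk; rewrite mult_INR, RtoC_mult.
  replace (INR 2) with 2%R by (simpl; ring).
  assert (Hk0 : RtoC (INR k) <> 0) by (apply INR_C_neq_0; lia).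
  field; repeat split; auto using C2_neq_0.
Qed.

(** * The products of disp x w n / (x n) *)

Fixpoint Csum (f : nat -> C) (n : nat) : C :=
  match n with
  | O => 0
  | S m => Csum f m + f (S m)
  end.

Lemma Csum_ext (f g : nat -> C) (n : nat) :
  (forall k, (1 <= k <= n)%nat -> f k = g k) -> Csum f n = Csum g n.
Proof.
induction n as [ | n IH]; intros H; [ reflexivity | simpl ].
rewrite IH, (H (S n)); [ reflexivity | lia | intros k Hk; apply H; lia ].
Qed.

Lemma Csum_scal (c : C) (f : nat -> C) (n : nat) :
  Csum (fun k => c * f k) n = c * Csum f n.
Proof. induction n as [ | n IH]; simpl; [ ring | rewrite IH; ring ]. Qed.

Lemma Csum_minus (f g : nat -> C) (n : nat) :
  Csum (fun k => f k - g k) n = Csum f n - Csum g n.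
Proof. induction n as [ | n IH]; simpl; [ ring | rewrite IH; ring ]. Qed.

Lemma Cprod_Cexp (f : nat -> C) (n : nat) :
  Cprod (fun k => Cexp (f k)) n = Cexp (Csum f n).
Proof.
induction n as [ | n IH]; simpl; [ symmetry; apply Cexp_0 | ].
rewrite IH, Cexp_plus; reflexivity.
Qed.

Lemma Csum_split (f : nat -> C) (N m : nat) :
  Csum f (N + m) = Csum f N + Csum (fun k => f (N + k)%nat) m.
Proof.
induction m as [ | m IH]; [ rewrite Nat.add_0_r; simpl; ring | ].
rewrite Nat.add_succ_r; simpl; rewrite IH, Nat.add_succ_r; ring.
Qed.

Lemma Cmod_Csum_le (f : nat -> C) (s : nat -> R) (n : nat) :
  (forall k, (k < n)%nat -> (Cmod (f (S k)) <= s (S k) - s k)%R) ->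
  (Cmod (Csum f n) <= s n - s O)%R.
Proof.
induction n as [ | n IH]; intros H; simpl; [ rewrite Cmod_0; lra | ].
eapply Rle_trans; [ apply Cmod_triangle | ].
specialize (IH ltac:(intros k Hk; apply H; lia)); specialize (H n ltac:(lia)); lra.
Qed.

Lemma Csum_tail_le (f : nat -> C) (K : R) (N m : nat) :
  (0 <= K)%R -> (1 <= N)%nat ->
  (forall n, (N < n)%nat -> (Cmod (f n) <= K / INR n ^ 2)%R) ->
  (Cmod (Csum (fun k => f (N + k)%nat) m) <= K / INR N)%R.
Proof.
intros HK HN Hf.
eapply Rle_trans.
- apply (Cmod_Csum_le _ (fun k => - (K / INR (N + k)))%R).
  intros k Hk; eapply Rle_trans; [ apply Hf; lia | ].
  rewrite Nat.add_succ_r.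
  pose proof (inv_sqr_telescope K (N + k) HK ltac:(lia)); lra.
- rewrite Nat.add_0_r.
  assert (0 <= K / INR (N + m))%R; [ | lra ].
  apply Rdiv_le_0_compat; [ exact HK | apply lt_0_INR; lia ].
Qed.

Lemma div_INR_small (K eps : R) : (0 <= K)%R -> (0 < eps)%R ->
  exists N, (1 <= N)%nat /\ forall n, (N <= n)%nat -> (K / INR n < eps)%R.
Proof.
intros HK Heps; destruct (archimed_nat (K / eps)) as [N [HN1 HN]].
exists N; split; [ exact HN1 | ]; intros n Hn.
apply le_INR in Hn; assert (0 < INR N)%R by (apply lt_0_INR; lia).
apply (Rmult_lt_reg_r (INR n)); [ lra | ].
unfold Rdiv; rewrite Rmult_assoc, Rinv_l, Rmult_1_r by lra.
apply (Rmult_lt_compat_l eps) in HN; [ | exact Heps ].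
replace (eps * (K / eps))%R with K in HN by (field; lra); nra.
Qed.

Lemma Csum_cv (f : nat -> C) (K : R) :
  (0 <= K)%R ->
  (forall n, (1 <= n)%nat -> (Cmod (f n) <= K / INR n ^ 2)%R) ->
  exists s : C, seqlim (Csum f) s.
Proof.
intros HK Hf; apply Ccauchy_cv; intros eps Heps.
destruct (div_INR_small K eps HK Heps) as [N [HN1 HN]].
exists N; intros n Hn; replace n with (N + (n - N))%nat by lia; rewrite Csum_split.
replace (Csum f N + Csum (fun k => f (N + k)%nat) (n - N) - Csum f N)
  with (Csum (fun k => f (N + k)%nat) (n - N)) by ring.
eapply Rle_lt_trans; [ apply (Csum_tail_le f K); auto | apply HN; lia ].
intros k Hk; apply Hf; lia.
Qed.

Lemma is_series_Csum (f : nat -> C) (s : C) :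
  is_series (fun n => f (S n)) s <-> seqlim (Csum f) s.
Proof.
assert (E : forall n, sum_n (fun n => f (S n)) n = Csum f (S n)).
{ induction n as [ | n IH].
  - rewrite sum_O; simpl; ring.
  - rewrite sum_Sn, IH; reflexivity. }
rewrite <- (clim_shift (Csum f) s 1); unfold is_series; split;
apply filterlim_ext; intros n; rewrite E; reflexivity.
Qed.

Lemma disp_sqr (x w : C) (n : nat) :
  disp x w n * disp x w n = x * x * (INR n * INR n) + w * w.
Proof. unfold disp; rewrite Csqrt_sqr; ring. Qed.

Lemma Re_INR_mult (x : C) (n : nat) : Re (x * INR n) = (Re x * INR n)%R.
Proof. rewrite Re_mult; simpl; unfold Re, Im; simpl; ring. Qed.

Lemma disp_w0 (x : C) (n : nat) : (0 < Re x)%R -> (1 <= n)%nat ->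
  disp x 0 n = x * INR n.
Proof.
intros Hx Hn; apply Csqrt_unique; [ ring | ].
rewrite Re_INR_mult; apply Rmult_lt_0_compat; [ exact Hx | apply lt_0_INR; lia ].
Qed.

Lemma Re_gt_0_neq_0 (z : C) : (0 < Re z)%R -> z <> 0.
Proof. intros H E; rewrite E in H; simpl in H; lra. Qed.

(** Both summands have nonnegative real part, so nothing cancels, for any [w]. Every later
    denominator [disp x w n + x n] is controlled by this. *)
Lemma disp_add_ge (x w : C) (n : nat) :
  (INR n * Re x <= Cmod (disp x w n + x * INR n))%R.
Proof.
eapply Rle_trans; [ | apply Re_le_Cmod ].
change (Re (disp x w n + x * INR n)) with (Re (disp x w n) + Re (x * INR n))%R.
rewrite Re_INR_mult; pose proof (Re_Csqrt_ge_0 (x ^ 2 * INR n ^ 2 + w ^ 2)).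
unfold disp; lra.
Qed.

Section Dispersion.
Context (x w : C) (Hx : (0 < Re x)%R).

Lemma INR_pos (n : nat) : (1 <= n)%nat -> (1 <= INR n)%R.
Proof. intros Hn; apply le_INR in Hn; exact Hn. Qed.

Lemma disp_add_neq_0 (n : nat) : (1 <= n)%nat -> disp x w n + x * INR n <> 0.
Proof.
intros Hn E; pose proof (disp_add_ge x w n) as H; rewrite E, Cmod_0 in H.
pose proof (INR_pos n Hn); nra.
Qed.

Lemma disp_sub (n : nat) : (1 <= n)%nat ->
  disp x w n - x * INR n = w * w / (disp x w n + x * INR n).
Proof.
intros Hn; pose proof (disp_add_neq_0 n Hn).
replace (w * w) with ((disp x w n - x * INR n) * (disp x w n + x * INR n)).
- field; assumption.
- transitivity (disp x w n * disp x w n - x * x * (INR n * INR n)); [ ring | ].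
  rewrite disp_sqr; ring.
Qed.

Lemma Cmod_disp_sub_le (n : nat) : (1 <= n)%nat ->
  (Cmod (disp x w n - x * INR n) <= (Cmod w * Cmod w / Re x) / INR n)%R.
Proof.
intros Hn; rewrite disp_sub by exact Hn; pose proof (INR_pos n Hn).
unfold Cdiv; rewrite Cmod_mult, Cmod_inv, Cmod_mult by (apply disp_add_neq_0, Hn).
unfold Rdiv; rewrite (Rmult_assoc (Cmod w * Cmod w)); apply Rmult_le_compat_l.
- pose proof (Cmod_ge_0 w); nra.
- rewrite <- Rinv_mult; apply Rinv_le_contravar; [ nra | ].
  rewrite Rmult_comm; apply disp_add_ge.
Qed.

Definition disp_bound : R := (Cmod w * Cmod w / Re x / Re x)%R.

Lemma disp_bound_ge_0 : (0 <= disp_bound)%R.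
Proof.
unfold disp_bound, Rdiv; pose proof (Rinv_0_lt_compat _ Hx); pose proof (Cmod_ge_0 w).
repeat apply Rmult_le_pos; lra.
Qed.

Lemma disp_ratio_near (n : nat) : (1 <= n)%nat ->
  (Cmod (disp x w n / (x * INR n) - 1) <= disp_bound / INR n ^ 2)%R.
Proof.
intros Hn; pose proof (INR_pos n Hn).
assert (Hx0 : x <> 0) by (apply Re_gt_0_neq_0, Hx).
pose proof (INR_C_neq_0 n Hn) as Hn0.
replace (disp x w n / (x * INR n) - 1) with ((disp x w n - x * INR n) * / (x * INR n))
  by (field; auto).
rewrite Cmod_mult, Cmod_inv by (apply Cmult_neq_0; assumption).
rewrite Cmod_mult, Cmod_R, Rabs_pos_eq by lra.
replace (disp_bound / INR n ^ 2)%R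
  with ((Cmod w * Cmod w / Re x) / INR n * / (Re x * INR n))%R
  by (unfold disp_bound; field; lra).
apply Rmult_le_compat.
- apply Cmod_ge_0.
- left; apply Rinv_0_lt_compat; pose proof (Re_le_Cmod x); nra.
- apply Cmod_disp_sub_le, Hn.
- apply Rinv_le_contravar; [ nra | apply Rmult_le_compat_r; [ lra | apply Re_le_Cmod ] ].
Qed.

(** The leading term [1 / (2 n)] does not depend on [x]. It therefore cancels between [x1] and [x2]
    in [summand], whose two halves are only of order [1/n] while their difference is of order
    [1/n^2]. *)
Lemma disp_recip_near (n : nat) : (1 <= n)%nat ->
  (Cmod (x / (disp x w n + x * INR n) - 1 / (2 * INR n)) <= disp_bound / INR n ^ 2)%R.
Proof.
intros Hn; pose proof (INR_pos n Hn).
pose proof (INR_C_neq_0 n Hn) as Hn0; pose proof (disp_add_neq_0 n Hn) as Hd.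
pose proof (disp_add_ge x w n) as Hge.
set (d := disp x w n) in *.
replace (x / (d + x * INR n) - 1 / (2 * INR n))
  with (- (d - x * INR n) * / (2 * INR n * (d + x * INR n)))
  by (field; repeat split; auto; exact C2_neq_0).
rewrite Cmod_mult, Cmod_opp, Cmod_inv
  by (apply Cmult_neq_0; [ apply Cmult_neq_0; [ exact C2_neq_0 | exact Hn0 ] | exact Hd ]).
rewrite !Cmod_mult, !Cmod_R, (Rabs_pos_eq (INR n)), (Rabs_pos_eq 2) by lra.
replace (disp_bound / INR n ^ 2)%R
  with ((Cmod w * Cmod w / Re x) / INR n * / (INR n * Re x))%R
  by (unfold disp_bound; field; lra).
apply Rmult_le_compat.
- apply Cmod_ge_0.
- left; apply Rinv_0_lt_compat; pose proof (proj1 (Cmod_gt_0 _) Hd); nra.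
- apply Cmod_disp_sub_le, Hn.
- apply Rinv_le_contravar; [ nra | ].
  apply Rle_trans with (1 * (INR n * Re x))%R; [ lra | ].
  apply Rmult_le_compat; nra.
Qed.

(** A square root of [sinh (PI w / x) / (PI w / x)], equal to 1 at [w = 0]. It makes the branch in
    [sqrt_sinh_ratio] explicit. *)
Definition disp_prod : C := Clim (Cprod (fun n => disp x w n / (x * INR n))).

Lemma disp_prod_infprod : is_infprod (fun n => disp x w n / (x * INR n)) disp_prod.
Proof.
destruct (infprod_cv _ _ disp_bound_ge_0 disp_ratio_near) as [P HP].
unfold disp_prod; rewrite (Clim_correct _ _ HP).
apply (is_infprod_intro _ disp_bound); [ apply disp_bound_ge_0 | apply disp_ratio_near | exact HP ].
Qed.

Lemma disp_prod_neq_0 : (forall n, (1 <= n)%nat -> disp x w n <> 0) -> disp_prod <> 0.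
Proof.
intros H; apply (is_infprod_neq_0 _ _ disp_prod_infprod); intros n Hn.
apply Cmult_neq_0; [ apply H, Hn | ].
intros E; assert (H1 : x * INR n <> 0).
{ apply Cmult_neq_0; [ apply Re_gt_0_neq_0, Hx | apply INR_C_neq_0, Hn ]. }
apply C1_nz; rewrite <- (Cinv_r _ H1), E; ring.
Qed.

(** The squared factors are [1 + w^2 / (x^2 n^2)], Euler's factors at [w / x]; the choice of each
    root disappears. *)
Lemma disp_prod_sqr :
  Csinh (PI * w / x) = PI * w / x * (disp_prod * disp_prod).
Proof.
assert (Hx0 : x <> 0) by (apply Re_gt_0_neq_0, Hx).
replace (PI * w / x) with (PI * (w / x)) by (field; exact Hx0).
apply (clim_unique eventually _ _ _ (Csinh_product (w / x))).
destruct disp_prod_infprod as [HP _].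
eapply filterlim_ext; [ | apply clim_mult; [ apply eventually_filter | apply filterlim_const
  | apply clim_mult; [ apply eventually_filter | exact HP | exact HP ] ] ].
intros m; cbv beta; f_equal; rewrite <- Cprod_mult; apply Cprod_ext; intros k Hk.
assert (Hk0 : RtoC (INR k) <> 0) by (apply INR_C_neq_0; lia).
transitivity (disp x w k * disp x w k / (x * x * (INR k * INR k))); [ field; auto | ].
rewrite disp_sqr; field; auto.
Qed.

End Dispersion.

Lemma disp_prod_0 (x : C) : (0 < Re x)%R -> disp_prod x 0 = 1.
Proof.
intros Hx; apply Clim_correct; apply filterlim_ext with (fun _ => RtoC 1);
  [ | apply filterlim_const ].
intros n; induction n as [ | n IH]; [ reflexivity | ]; cbn [Cprod].
rewrite <- IH, disp_w0 by (exact Hx || lia).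
field; split; [ apply INR_C_neq_0; lia | apply Re_gt_0_neq_0, Hx ].
Qed.

Lemma sinh_ratio_disp_prod (x1 x2 w : C) : (0 < Re x1)%R -> (0 < Re x2)%R ->
  disp_prod x2 w <> 0 ->
  sinh_ratio x1 x2 w
  = x2 / x1 * ((disp_prod x1 w / disp_prod x2 w) * (disp_prod x1 w / disp_prod x2 w)).
Proof.
intros H1 H2 HD; pose proof (Re_gt_0_neq_0 _ H1); pose proof (Re_gt_0_neq_0 _ H2).
unfold sinh_ratio; destruct (Ceq_dec w 0) as [-> | Hw].
- rewrite !disp_prod_0 by assumption; field; auto.
- pose proof RtoC_PI_neq_0 as HP.
  rewrite !disp_prod_sqr by assumption; field; repeat split; auto.
Qed.

Lemma disp_prod_continuous_on (J : R -> Prop) (v : R -> C) (x : C) :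
  (0 < Re x)%R -> continuous_on J v ->
  (forall n, (1 <= n)%nat -> continuous_on J (fun t => disp x (v t) n)) ->
  continuous_on J (fun t => disp_prod x (v t)).
Proof.
intros Hx Hv Hd t0 Ht0.
(* The majorant of the factors grows with [Cmod w], so it is uniform only where [v] is bounded. By
   continuity of [v] the set [J'] contains all points of [J] near [t0], which suffices for a limit
   at [t0]. *)
set (V := (Cmod (v t0) + 1)%R).
set (J' := fun t => J t /\ (Cmod (v t) <= V)%R).
pose proof (Cmod_ge_0 (v t0)).
assert (HV : (0 < V)%R) by (unfold V; lra).
set (K := (V * V / Re x / Re x)%R).
assert (HK : (0 <= K)%R).
{ unfold K, Rdiv; pose proof (Rinv_0_lt_compat _ Hx); repeat apply Rmult_le_pos; lra. }
assert (Hc : continuous_on J' (fun t => disp_prod x (v t))).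
{ apply (infprod_continuous_on J' (fun t n => disp x (v t) n / (x * INR n)) _ K HK).
  - intros t n [Ht Htv] Hn; eapply Rle_trans; [ apply disp_ratio_near; assumption | ].
    unfold disp_bound, K, Rdiv.
    assert (0 < / INR n ^ 2)%R
      by (apply Rinv_0_lt_compat, pow_lt; pose proof (INR_pos n Hn); lra).
    pose proof (Rinv_0_lt_compat _ Hx); pose proof (Cmod_ge_0 (v t)).
    repeat (apply Rmult_le_compat_r; [ lra | ]); apply Rmult_le_compat; lra.
  - intros n Hn t [Ht Htv].
    apply (clim_div (within J' (locally t))).
    + apply Cmult_neq_0; [ apply Re_gt_0_neq_0, Hx | apply INR_C_neq_0, Hn ].
    + eapply filterlim_filter_le_1; [ | apply (Hd n Hn t Ht) ].
      intros Q HQ; unfold within in *; revert HQ; apply filter_imp; intros s Hs [Hs' _].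
      exact (Hs Hs').
    + apply filterlim_const.
  - intros t [Ht Htv]; apply disp_prod_infprod, Hx. }
assert (HJ' : J' t0) by (split; [ exact Ht0 | unfold V; lra ]).
eapply filterlim_filter_le_1; [ | apply (Hc t0 HJ') ].
intros Q HQ; unfold within in *.
pose proof (proj1 (clim_eps (within J (locally t0)) _ _) (Hv t0 Ht0) 1%R ltac:(lra)) as H1.
unfold within in H1; generalize (filter_and _ _ HQ H1); apply filter_imp.
intros s [Hs1 Hs2] HJs; apply Hs1; split; [ exact HJs | ].
specialize (Hs2 HJs); unfold V.
pose proof (Cmod_triangle (v s - v t0) (v t0)) as H3.
replace (v s - v t0 + v t0) with (v s) in H3 by ring; lra.
Qed.

Lemma summand_le (x1 x2 w : C) : (0 < Re x1)%R -> (0 < Re x2)%R ->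
  exists K, (0 <= K)%R /\
    forall n, (1 <= n)%nat -> (Cmod (summand x1 x2 w n) <= K / INR n ^ 2)%R.
Proof.
intros H1 H2.
pose proof (Re_gt_0_neq_0 _ H1) as N1; pose proof (Re_gt_0_neq_0 _ H2) as N2.
set (c := w * w / (x1 * x2)).
exists (Cmod c * (disp_bound x2 w + disp_bound x1 w))%R.
pose proof (disp_bound_ge_0 x1 w H1); pose proof (disp_bound_ge_0 x2 w H2).
pose proof (Cmod_ge_0 c); split; [ apply Rmult_le_pos; lra | intros n Hn ].
pose proof (INR_C_neq_0 n Hn) as Hn0.
pose proof (disp_add_neq_0 x1 w H1 n Hn) as A1; pose proof (disp_add_neq_0 x2 w H2 n Hn) as A2.
assert (E : summand x1 x2 w n =
  c * ((x2 / (disp x2 w n + x2 * INR n) - 1 / (2 * INR n))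
     - (x1 / (disp x1 w n + x1 * INR n) - 1 / (2 * INR n)))).
{ unfold summand.
  transitivity ((disp x2 w n - x2 * INR n) / x1 - (disp x1 w n - x1 * INR n) / x2);
    [ field; auto | ].
  rewrite !disp_sub by assumption; unfold c; field; repeat split; auto; exact C2_neq_0. }
rewrite E, Cmod_mult.
unfold Rdiv; rewrite Rmult_assoc; apply Rmult_le_compat_l; [ assumption | ].
eapply Rle_trans; [ apply Cmod_triangle | rewrite Cmod_opp, Rmult_plus_distr_r ].
apply Rplus_le_compat; apply disp_recip_near; assumption.
Qed.

(** * Quotient of the two double products *)

Lemma Re_inv_pos (z : C) : (0 < Re z)%R -> (0 < Re (/ z))%R.
Proof.
intros H; unfold Re in *; simpl; apply Rdiv_lt_0_compat; [ exact H | nra ].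
Qed.

(** The form factors as [(b + i t a) (b - i t a)]. With [t = p + i q] the squared moduli are
    [(b -+ q a)^2 + p^2 a^2], positive definite because [p > 0]. *)
Lemma Cmod_quad_lower (t : C) : (0 < Re t)%R ->
  exists c : R, (0 < c)%R /\ forall a b : R,
    (c * (a * a + b * b) <= Cmod (t * t * RtoC (a * a)%R + RtoC (b * b)%R))%R.
Proof.
intros Ht; set (p := Re t) in *; set (q := Im t).
(* From [b^2 <= 2 (b - q a)^2 + 2 q^2 a^2]: the 2 pays for the first square, the quotient by [p^2]
   for [(2 q^2 + 1) a^2]. *)
set (M := (2 + (2 * (q * q) + 1) / (p * p))%R).
assert (HM : (0 < M)%R).
{ unfold M; assert (0 < (2 * (q * q) + 1) / (p * p))%R; [ | lra ].
  apply Rdiv_lt_0_compat; nra. }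
assert (HB : forall a b q' : R, (q' * q' = q * q)%R ->
   ((a * a + b * b) <= M * ((b - q' * a) * (b - q' * a) + p * p * (a * a)))%R).
{ intros a b q' Hq.
  assert (E : (M * (p * p * (a * a)) = 2 * (p * p * (a * a)) + (2 * (q * q) + 1) * (a * a))%R)
    by (unfold M; field; lra).
  assert (M2 : (2 <= M)%R).
  { unfold M; assert (0 < (2 * (q * q) + 1) / (p * p))%R; [ | lra ].
    apply Rdiv_lt_0_compat; nra. }
  assert (F1 : (2 * ((b - q' * a) * (b - q' * a)) <= M * ((b - q' * a) * (b - q' * a)))%R)
    by (apply Rmult_le_compat_r; [ apply Rle_0_sqr | exact M2 ]).
  rewrite Rmult_plus_distr_l, E.
  assert (F2 : (b * b <= 2 * ((b - q' * a) * (b - q' * a)) + 2 * (q' * q' * (a * a)))%R).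
  { pose proof (Rle_0_sqr (b - 2 * (q' * a))) as Hs; unfold Rsqr in Hs; lra. }
  rewrite Hq in F2; pose proof (Rle_0_sqr (p * a)) as Hs; unfold Rsqr in Hs; lra. }
exists (/ M)%R; split; [ apply Rinv_0_lt_compat, HM | intros a b ].
set (u := RtoC b + Ci * t * RtoC a); set (v := RtoC b - Ci * t * RtoC a).
replace (t * t * RtoC (a * a)%R + RtoC (b * b)%R) with (u * v).
2: { unfold u, v; rewrite !RtoC_mult.
     replace (RtoC b * RtoC b) with (RtoC b * RtoC b - (Ci * Ci + 1) * (t * t * (RtoC a * RtoC a))).
     - ring.
     - replace (Ci * Ci) with (- (1)) by (apply injective_projections; simpl; ring); ring. }
assert (Hu : (Cmod u * Cmod u = (b - q * a) * (b - q * a) + p * p * (a * a))%R).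
{ rewrite Cmod_sqr; unfold u, p, q, Re, Im; simpl; ring. }
assert (Hv : (Cmod v * Cmod v = (b - (- q) * a) * (b - (- q) * a) + p * p * (a * a))%R).
{ rewrite Cmod_sqr; unfold v, p, q, Re, Im; simpl; ring. }
pose proof (HB a b q eq_refl) as B1; rewrite <- Hu in B1.
pose proof (HB a b (- q)%R ltac:(ring)) as B2; rewrite <- Hv in B2.
rewrite Cmod_mult; set (N := (a * a + b * b)%R) in *.
pose proof (Cmod_ge_0 u) as Pu; pose proof (Cmod_ge_0 v) as Pv.
apply (Rmult_le_reg_l M); [ exact HM | ].
rewrite <- Rmult_assoc, Rinv_r, Rmult_1_l by lra.
apply Rsqr_incr_0_var; [ unfold Rsqr | apply Rmult_le_pos; nra ].
assert (HN : (0 <= N)%R) by (unfold N; nra).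
replace (M * (Cmod u * Cmod v) * (M * (Cmod u * Cmod v)))%R
  with ((M * (Cmod u * Cmod u)) * (M * (Cmod v * Cmod v)))%R by ring.
apply Rmult_le_compat; assumption.
Qed.

(** * Rows of the double product over the lattice, and their tails *)

Definition lam (x y : C) (n k : nat) : C :=
  x * x * (INR n * INR n) + y * y * (INR k * INR k).

Lemma lam_sym (x y : C) (n k : nat) : lam x y n k = lam y x k n.
Proof. unfold lam; ring. Qed.

Lemma lam_lower (x y : C) : y <> 0 -> (0 < Re (x / y))%R ->
  exists c : R, (0 < c)%R /\ forall n k,
    (c * (INR n ^ 2 + INR k ^ 2) <= Cmod (lam x y n k))%R.
Proof.
intros Hy Ht; destruct (Cmod_quad_lower _ Ht) as [c [Hc H]].
pose proof (proj1 (Cmod_gt_0 _) Hy) as Hym.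
exists (Cmod y * Cmod y * c)%R; split; [ repeat apply Rmult_lt_0_compat; assumption | ].
intros n k; specialize (H (INR n) (INR k)).
replace (lam x y n k)
  with (y * y * (x / y * (x / y) * RtoC (INR n * INR n)%R + RtoC (INR k * INR k)%R))
  by (unfold lam; rewrite !RtoC_mult; field; exact Hy).
rewrite !Cmod_mult, Rmult_assoc; apply Rmult_le_compat_l; [ nra | ].
simpl; rewrite !Rmult_1_r; exact H.
Qed.

(** The linear terms cancel. With [exp 1 <= 3] the two remainders contribute
    [4 * 3 + 2 * 3 = 18]. *)
Lemma weierstrass_factor_near (z : C) : (Cmod z <= 1)%R ->
  (Cmod ((1 + z) * Cexp (- z) - 1) <= 18 * (Cmod z * Cmod z))%R.
Proof.
intros Hz.
replace ((1 + z) * Cexp (- z) - 1)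
  with ((Cexp (- z) - 1 - - z) + z * (Cexp (- z) - 1)) by ring.
eapply Rle_trans; [ apply Cmod_triangle | ].
pose proof (Cexp_sub_1_sub_le (- z)) as H1; pose proof (Cexp_sub_1_le (- z)) as H2.
rewrite Cmod_opp in H1, H2; rewrite Cmod_mult.
pose proof (Cmod_ge_0 z) as Hz0.
assert (He : (exp (Cmod z) <= 3)%R)
  by (eapply Rle_trans; [ apply exp_le, Hz | apply exp_le_3 ]).
apply (Rmult_le_compat_l (Cmod z) _ _ Hz0) in H2.
assert (H3 : (Cmod z * Cmod z * exp (Cmod z) <= Cmod z * Cmod z * 3)%R)
  by (apply Rmult_le_compat_l; nra).
lra.
Qed.

Lemma Cprod_swap (g : nat -> nat -> C) (N M : nat) :
  Cprod (fun n => Cprod (fun k => g n k) N) M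
  = Cprod (fun k => Cprod (fun n => g n k) M) N.
Proof.
induction M as [ | M IH]; cbn [Cprod].
- induction N as [ | N IHN]; cbn [Cprod]; [ reflexivity | rewrite <- IHN; ring ].
- rewrite IH, <- Cprod_mult; reflexivity.
Qed.

Definition tail_sum (x y : C) (N n : nat) : C :=
  Clim (Csum (fun k => 1 / lam x y n (N + k))).

Definition tail_prod (x y w : C) (N n : nat) : C :=
  Clim (Cprod (fun k => 1 + w * w / lam x y n (N + k))).

Lemma factor_sinh (x y w : C) (n : nat) : y <> 0 ->
  factor x y w n
  = 2 * Csinh (PI * (disp x w n / y)) * Cexp (- (PI * (disp x w n / y))).
Proof.
intros Hy; unfold factor, Csinh; set (z := PI * (disp x w n / y)).
replace (- (2 * PI / y) * disp x w n) with (- z + - z) by (unfold z; field; exact Hy).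
rewrite Cexp_plus, Cexp_opp; field; apply Cexp_neq_0.
Qed.

Lemma Csinh_neq_0 (z : C) : (0 < Re z)%R -> Csinh z <> 0.
Proof.
intros Hz E.
assert (H : Cexp z = Cexp (- z)).
{ replace (Cexp z) with (2 * Csinh z + Cexp (- z))
    by (unfold Csinh; field; exact C2_neq_0).
  rewrite E; ring. }
apply (f_equal Cmod) in H; rewrite !Cmod_Cexp in H; apply exp_inv in H.
change (Re (- z)) with (- Re z)%R in H; lra.
Qed.

Lemma factor_w0_neq_0 (x y : C) (n : nat) : (0 < Re x)%R -> y <> 0 ->
  (0 < Re (x / y))%R -> (1 <= n)%nat -> factor x y 0 n <> 0.
Proof.
intros Hx Hy Ht Hn; rewrite factor_sinh, disp_w0 by assumption.
apply Cmult_neq_0; [ apply Cmult_neq_0; [ exact C2_neq_0 | ] | apply Cexp_neq_0 ].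
apply Csinh_neq_0; replace (PI * (x * INR n / y)) with (RtoC (PI * INR n) * (x / y))
  by (rewrite RtoC_mult; field; exact Hy).
rewrite Re_mult; change (Re (RtoC (PI * INR n))) with (PI * INR n)%R.
change (Im (RtoC (PI * INR n))) with 0%R; rewrite Rmult_0_l, Rminus_0_r.
pose proof PI_RGT_0; pose proof (INR_pos n Hn).
apply Rmult_lt_0_compat; [ apply Rmult_lt_0_compat; lra | exact Ht ].
Qed.

Section Rows.
Context (x y w : C) (Hx : (0 < Re x)%R) (Hy : y <> 0) (Ht : (0 < Re (x / y))%R).

Lemma inv_lam_le : exists c : R, (0 <= c)%R /\ forall n k, (1 <= k)%nat ->
  lam x y n k <> 0 /\ (Cmod (/ lam x y n k) <= c / INR k ^ 2)%R.
Proof.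
destruct (lam_lower x y Hy Ht) as [c [Hc H]].
exists (/ c)%R; split; [ left; apply Rinv_0_lt_compat, Hc | intros n k Hk ].
pose proof (INR_pos k Hk) as Hk1; specialize (H n k).
assert (Hl : (c * INR k ^ 2 <= Cmod (lam x y n k))%R).
{ eapply Rle_trans; [ | exact H ]; apply Rmult_le_compat_l; [ lra | ].
  pose proof (pow2_ge_0 (INR n)); lra. }
assert (Hp : (0 < c * INR k ^ 2)%R) by (apply Rmult_lt_0_compat; [ exact Hc | apply pow_lt; lra ]).
assert (H0 : lam x y n k <> 0) by (apply Cmod_gt_0; lra).
split; [ exact H0 | ].
rewrite Cmod_inv by exact H0; unfold Rdiv; rewrite <- Rinv_mult.
apply Rinv_le_contravar; assumption.
Qed.

Lemma tail_sum_cv (N n : nat) :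
  seqlim (Csum (fun k => 1 / lam x y n (N + k))) (tail_sum x y N n).
Proof.
destruct inv_lam_le as [c [Hc H]].
destruct (Csum_cv (fun k => 1 / lam x y n (N + k)) c Hc) as [s Hs].
- intros k Hk; destruct (H n (N + k)%nat ltac:(lia)) as [H1 H2].
  unfold Cdiv; rewrite Cmult_1_l; eapply Rle_trans; [ exact H2 | ].
  apply Rmult_le_compat_l; [ exact Hc | apply Rinv_le_contravar ].
  + apply pow_lt; pose proof (INR_pos k Hk); lra.
  + apply pow_incr; split; [ apply pos_INR | apply le_INR; lia ].
- unfold tail_sum; rewrite (Clim_correct _ _ Hs); exact Hs.
Qed.

Lemma tail_prod_cv (N n : nat) :
  seqlim (Cprod (fun k => 1 + w * w / lam x y n (N + k))) (tail_prod x y w N n).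
Proof.
destruct inv_lam_le as [c [Hc H]].
pose proof (Cmod_ge_0 w) as Hw.
destruct (infprod_cv (fun k => 1 + w * w / lam x y n (N + k)) (Cmod w * Cmod w * c)) as [s Hs].
- repeat apply Rmult_le_pos; assumption.
- intros k Hk; destruct (H n (N + k)%nat ltac:(lia)) as [H1 H2].
  replace (1 + w * w / lam x y n (N + k) - 1) with (w * w * / lam x y n (N + k))
    by (unfold Cdiv; ring).
  rewrite !Cmod_mult; unfold Rdiv; rewrite (Rmult_assoc (Cmod w * Cmod w) c).
  apply Rmult_le_compat_l; [ nra | eapply Rle_trans; [ exact H2 | ] ].
  apply Rmult_le_compat_l; [ exact Hc | apply Rinv_le_contravar ].
  + apply pow_lt; pose proof (INR_pos k Hk); lra.
  + apply pow_incr; split; [ apply pos_INR | apply le_INR; lia ].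
- unfold tail_prod; rewrite (Clim_correct _ _ Hs); exact Hs.
Qed.

Lemma tail_prod_split (N n : nat) :
  tail_prod x y w 0 n
  = Cprod (fun k => 1 + w * w / lam x y n k) N * tail_prod x y w N n.
Proof.
set (g := fun k => 1 + w * w / lam x y n k).
apply (clim_unique eventually (fun m => Cprod g (N + m))).
- apply (clim_shift (Cprod g)), (tail_prod_cv 0).
- eapply filterlim_ext; [ intros m; symmetry; apply Cprod_split | ].
  apply clim_mult; [ apply eventually_filter | apply filterlim_const | ].
  apply tail_prod_cv.
Qed.

(** Euler's product at [disp x w n / y] is divided by the one at [x n / y], its instance for
    [w = 0]. As [disp^2 = x^2 n^2 + w^2], the quotient of the k-th factors is
    [1 + w^2 / lam x y n k]. *)
Lemma factor_row (n : nat) : (1 <= n)%nat ->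
  factor x y w n
  = factor x y 0 n * (disp x w n / (x * INR n))
    * Cexp (- (PI / y) * (disp x w n - x * INR n)) * tail_prod x y w 0 n.
Proof.
intros Hn; pose proof (INR_C_neq_0 n Hn) as Hn0; pose proof (Re_gt_0_neq_0 _ Hx) as Hx0.
rewrite !factor_sinh, (disp_w0 x n Hx Hn) by exact Hy.
set (d := disp x w n).
assert (E : Csinh (PI * (d / y))
  = Csinh (PI * (x * INR n / y)) * (d / (x * INR n)) * tail_prod x y w 0 n).
{ apply (clim_unique eventually _ _ _ (Csinh_product (d / y))).
  eapply filterlim_ext;
  [ | apply clim_mult; [ apply eventually_filter
      | apply clim_mult; [ apply eventually_filter | apply (Csinh_product (x * INR n / y))
                         | apply filterlim_const ] | apply (tail_prod_cv 0) ] ].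
  intros m; cbv beta.
  transitivity (PI * (d / y)
    * (Cprod (fun k => 1 + x * INR n / y * (x * INR n / y) / (INR k * INR k)) m
       * Cprod (fun k => 1 + w * w / lam x y n k) m)).
  - cbn [Nat.add]; field; auto.
  - f_equal; rewrite <- Cprod_mult; apply Cprod_ext; intros k Hk.
    destruct inv_lam_le as [c [_ Hl]]; destruct (Hl n k ltac:(lia)) as [Hl0 _].
    assert (Hk0 : RtoC (INR k) <> 0) by (apply INR_C_neq_0; lia).
    transitivity (1 + d * d / (y * y * (INR k * INR k))); [ | field; auto ].
    unfold d; rewrite disp_sqr; unfold lam in *; field; repeat split; auto. }
rewrite E.
replace (- (PI * (d / y)))
  with (- (PI * (x * INR n / y)) + - (PI / y) * (d - x * INR n)) by (field; exact Hy).
rewrite Cexp_plus; ring.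
Qed.

Lemma Cprod_factor (N : nat) :
  Cprod (factor x y w) N
  = Cprod (factor x y 0) N * Cprod (fun n => disp x w n / (x * INR n)) N
    * Cexp (- (PI / y) * Csum (fun n => disp x w n - x * INR n) N)
    * (Cprod (fun n => Cprod (fun k => 1 + w * w / lam x y n k) N) N
       * Cprod (tail_prod x y w N) N).
Proof.
rewrite <- Csum_scal, <- Cprod_Cexp, <- !Cprod_mult.
apply Cprod_ext; intros n Hn; rewrite factor_row by lia.
rewrite (tail_prod_split N); ring.
Qed.

(** The compensated factors [(1 + z) exp (-z)] differ from 1 by order [1/k^4], at most a multiple of
    [1/(N^2 k^2)] for [k > N]. A row thus deviates by order [1/N^3], uniformly in [n]. [N0] ensures
    [Cmod z <= 1]. *)
Lemma tail_near : exists K N0, (0 <= K)%R /\ (1 <= N0)%nat /\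
  forall N n, (N0 <= N)%nat ->
  (Cmod (tail_prod x y w N n * Cexp (- (w * w) * tail_sum x y N n) - 1)
   <= exp (K / INR N ^ 2 / INR N) - 1)%R.
Proof.
destruct inv_lam_le as [c [Hc H]]; pose proof (Cmod_ge_0 w) as Hw.
set (b := (Cmod w * Cmod w * c)%R).
assert (Hb : (0 <= b)%R) by (unfold b; repeat apply Rmult_le_pos; assumption).
destruct (div_INR_small b 1 Hb ltac:(lra)) as [N0 [HN01 HN0]].
exists (18 * (b * b))%R, N0; split; [ nra | split; [ exact HN01 | intros N n HN ] ].
set (z := fun k => w * w / lam x y n k).
pose proof (INR_pos N ltac:(lia)) as HN1.
assert (HL : seqlim (Cprod (fun k => (1 + z (N + k)%nat) * Cexp (- z (N + k)%nat))) (tail_prod x y w N n * Cexp (- (w * w) * tail_sum x y N n))).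
{ eapply filterlim_ext; [ | apply clim_mult; [ apply eventually_filter | apply tail_prod_cv
   | apply clim_Cexp; [ apply eventually_filter | apply clim_mult;
      [ apply eventually_filter | apply filterlim_const | apply tail_sum_cv ] ] ] ].
  intros m; cbv beta; rewrite <- Csum_scal, <- Cprod_Cexp, <- Cprod_mult.
  apply Cprod_ext; intros k Hk; unfold z; f_equal; f_equal; unfold Cdiv; ring. }
apply (clim_Cmod_le eventually _ _ _ _ HL); exists O; intros m _.
apply (Cprod_tail_sub_1 (fun k => (1 + z k) * Cexp (- z k))).
- unfold Rdiv; apply Rdiv_le_0_compat; [ nra | apply pow_lt; lra ].
- lia.
- intros k Hk; destruct (H n k ltac:(lia)) as [H1 H2].
  pose proof (INR_pos k ltac:(lia)) as Hk1.
  assert (HNk : (INR N <= INR k)%R) by (apply le_INR; lia).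
  assert (Hz : (Cmod (z k) <= b / INR k ^ 2)%R).
  { unfold z, Cdiv; rewrite !Cmod_mult; unfold b, Rdiv; rewrite (Rmult_assoc (Cmod w * Cmod w)).
    apply Rmult_le_compat_l; [ nra | exact H2 ]. }
  assert (Hb1 : (b / INR k ^ 2 <= 1)%R).
  { pose proof (HN0 k ltac:(lia)) as H3.
    apply Rle_trans with (b / INR k)%R; [ | lra ].
    apply Rmult_le_compat_l; [ exact Hb | apply Rinv_le_contravar; nra ]. }
  eapply Rle_trans; [ apply weierstrass_factor_near; lra | ].
  pose proof (Cmod_ge_0 (z k)) as Hz0.
  apply Rle_trans with (18 * ((b / INR k ^ 2) * (b / INR k ^ 2)))%R.
  + apply Rmult_le_compat_l; [ lra | apply Rmult_le_compat; assumption ].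
  + replace (18 * (b / INR k ^ 2 * (b / INR k ^ 2)))%R
      with (18 * (b * b) * / INR k ^ 2 * / INR k ^ 2)%R by (field; lra).
    unfold Rdiv; apply Rmult_le_compat_r.
    * left; apply Rinv_0_lt_compat, pow_lt; lra.
    * apply Rmult_le_compat_l; [ nra | apply Rinv_le_contravar ].
      -- apply pow_lt; lra.
      -- apply pow_incr; lra.
Qed.

(** There are [N] rows, each with a deviation of order [1/N^3], so the total deviation vanishes. *)
Lemma tail_prod_asymp :
  seqlim (fun N => Cprod (tail_prod x y w N) N
                      * Cexp (- (w * w) * Csum (tail_sum x y N) N)) (RtoC 1).
Proof.
destruct tail_near as [K [N0 [HK [HN0 H]]]].
(* [1/4] keeps the total exponent [2 e N] within the range [[0, 1/2]] of [exp_sub_1_le]. *)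
destruct (div_INR_small K (1/4) HK ltac:(lra)) as [N1 [HN11 HN1]].
apply (clim_squeeze eventually _ _ (fun N => 4 * K * / INR N)%R).
- exists (N0 + N1)%nat; intros N HN.
  pose proof (INR_pos N ltac:(lia)) as HNp.
  rewrite <- Csum_scal, <- Cprod_Cexp, <- Cprod_mult.
  specialize (HN1 N ltac:(lia)).
  set (e := (K / INR N ^ 2 / INR N)%R) in *.
  assert (He0 : (0 <= e)%R).
  { unfold e, Rdiv; repeat apply Rmult_le_pos; try assumption;
    left; apply Rinv_0_lt_compat; try apply pow_lt; lra. }
  assert (HeN : (e * INR N <= K / INR N)%R).
  { unfold e; replace (K / INR N ^ 2 / INR N * INR N)%R with (K * / INR N ^ 2)%R by (field; lra).
    apply Rmult_le_compat_l; [ exact HK | apply Rinv_le_contravar; nra ]. }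
  assert (He1 : (e <= 1/2)%R) by nra.
  eapply Rle_trans.
  + apply (Cmod_Cprod_sub_1 _ (fun k => INR k * (2 * e))%R).
    intros k Hk; eapply Rle_trans; [ apply (H N (S k)); lia | ].
    fold e; pose proof (exp_sub_1_le e ltac:(lra)); rewrite S_INR; lra.
  + simpl (INR 0); rewrite Rmult_0_l, Rminus_0_r.
    eapply Rle_trans; [ apply exp_sub_1_le; split; nra | ].
    unfold Rdiv in HeN; nra.
- replace 0%R with (4 * K * 0)%R by ring; apply (rlim_mult eventually).
  + apply filterlim_const.
  + apply (is_lim_seq_inv INR p_infty); [ apply is_lim_seq_INR | discriminate ].
Qed.

(** Each of the [N] row tails is at most [c / N]. Absolute bounds give no more than boundedness
    here; the limit of [sigma] is found in [product_constants]. *)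
Lemma Csum_tail_sum_bounded : exists B : R, forall N, (1 <= N)%nat ->
  (Cmod (Csum (tail_sum x y N) N) <= B)%R.
Proof.
destruct inv_lam_le as [c [Hc H]]; exists c; intros N HN.
pose proof (INR_pos N HN) as HN1.
eapply Rle_trans.
- apply (Cmod_Csum_le _ (fun k => INR k * (c / INR N))%R); intros k Hk.
  replace (tail_sum x y N (S k)) with (tail_sum x y N (S k) - 0) by ring.
  apply (clim_Cmod_le eventually _ _ _ _ (tail_sum_cv N (S k))); exists O; intros m _.
  rewrite S_INR; replace ((INR k + 1) * (c / INR N) - INR k * (c / INR N))%R
    with (c / INR N)%R by ring.
  replace (Csum (fun j => 1 / lam x y (S k) (N + j)) m - 0)
    with (Csum (fun j => 1 / lam x y (S k) (N + j)) m) by ring.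
  apply (Csum_tail_le (fun j => 1 / lam x y (S k) j)); [ exact Hc | exact HN | ].
  intros j Hj; unfold Cdiv; rewrite Cmult_1_l; apply H; lia.
- simpl (INR 0); apply Req_le; field; lra.
Qed.

End Rows.

Definition sigma (x1 x2 : C) (N : nat) : C :=
  Csum (tail_sum x1 x2 N) N - Csum (tail_sum x2 x1 N) N.

Lemma Re_div_swap (x y : C) : (0 < Re x)%R -> (0 < Re y)%R ->
  (0 < Re (x / y))%R -> (0 < Re (y / x))%R.
Proof.
intros Hx Hy H; replace (y / x) with (/ (x / y)).
- apply Re_inv_pos, H.
- field; split; apply Re_gt_0_neq_0; assumption.
Qed.

Lemma sigma_bounded (x1 x2 : C) : (0 < Re x1)%R -> (0 < Re x2)%R ->
  (0 < Re (x1 / x2))%R ->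
  exists B : R, forall N, (1 <= N)%nat -> (Cmod (sigma x1 x2 N) <= B)%R.
Proof.
intros H1 H2 Ht; pose proof (Re_div_swap _ _ H1 H2 Ht) as Ht'.
destruct (Csum_tail_sum_bounded x1 x2 (Re_gt_0_neq_0 _ H2) Ht) as [B1 HB1].
destruct (Csum_tail_sum_bounded x2 x1 (Re_gt_0_neq_0 _ H1) Ht') as [B2 HB2].
exists (B1 + B2)%R; intros N HN; unfold sigma, Cminus.
eapply Rle_trans; [ apply Cmod_triangle | rewrite Cmod_opp ].
apply Rplus_le_compat; auto.
Qed.

(* Stated without quotients, since P1, P2 and the disp_prod may vanish. *)
Lemma product_ratio_limit (x1 x2 w P1 P2 P10 P20 s : C) :
  (0 < Re x1)%R -> (0 < Re x2)%R -> (0 < Re (x1 / x2))%R ->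
  seqlim (Cprod (factor x1 x2 w)) P1 ->
  seqlim (Cprod (factor x2 x1 w)) P2 ->
  seqlim (Cprod (factor x1 x2 0)) P10 ->
  seqlim (Cprod (factor x2 x1 0)) P20 ->
  seqlim (Csum (summand x1 x2 w)) s ->
  seqlim (fun N => Cexp (w * w * sigma x1 x2 N)
                      * (P2 * P10 * disp_prod x1 w * Cexp (PI * s))) (P1 * P20 * disp_prod x2 w).
Proof.
intros H1 H2 Ht L1 L2 L10 L20 Ls; pose proof (Re_div_swap _ _ H1 H2 Ht) as Ht'.
pose proof (Re_gt_0_neq_0 _ H1) as N1; pose proof (Re_gt_0_neq_0 _ H2) as N2.
pose proof (tail_prod_asymp x1 x2 w N2 Ht) as T1.
pose proof (tail_prod_asymp x2 x1 w N1 Ht') as T2.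
pose proof (proj1 (disp_prod_infprod x1 w H1)) as D1.
pose proof (proj1 (disp_prod_infprod x2 w H2)) as D2.
set (X := P2 * P10 * disp_prod x1 w * Cexp (PI * s)).
set (Y := P1 * P20 * disp_prod x2 w).
set (X' := fun N => Cprod (factor x2 x1 w) N * Cprod (factor x1 x2 0) N
   * Cprod (fun n => disp x1 w n / (x1 * INR n)) N
   * Cexp (PI * Csum (summand x1 x2 w) N)
   * (Cprod (tail_prod x1 x2 w N) N * Cexp (- (w * w) * Csum (tail_sum x1 x2 N) N))).
set (Y' := fun N => Cprod (factor x1 x2 w) N * Cprod (factor x2 x1 0) N
   * Cprod (fun n => disp x2 w n / (x2 * INR n)) N
   * (Cprod (tail_prod x2 x1 w N) N * Cexp (- (w * w) * Csum (tail_sum x2 x1 N) N))).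
assert (LX : seqlim X' X).
{ replace X with (X * 1) by ring; unfold X', X.
  apply (clim_mult eventually); [ | exact T1 ].
  apply (clim_mult eventually).
  - apply (clim_mult eventually); [ | exact D1 ].
    apply (clim_mult eventually); [ exact L2 | exact L10 ].
  - apply (clim_Cexp eventually), (clim_mult eventually); [ apply filterlim_const | exact Ls ]. }
assert (LY : seqlim Y' Y).
{ replace Y with (Y * 1) by ring; unfold Y', Y.
  apply (clim_mult eventually); [ | exact T2 ].
  apply (clim_mult eventually); [ | exact D2 ].
  apply (clim_mult eventually); [ exact L1 | exact L20 ]. }
(* Exact at every finite [N]: the square [n, k <= N] is common to both products by [Cprod_swap] and
   [lam_sym], and the exponentials of the rows make up the partial sum of [summand]. *)
assert (E : forall N, Y' N = Cexp (w * w * sigma x1 x2 N) * X' N).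
{ intros N; unfold X', Y'.
  rewrite (Cprod_factor x1 x2 w H1 N2 Ht N), (Cprod_factor x2 x1 w H2 N1 Ht' N).
  assert (ES : PI * Csum (summand x1 x2 w) N
    = PI / x1 * Csum (fun n => disp x2 w n - x2 * INR n) N
      + - (PI / x2) * Csum (fun n => disp x1 w n - x1 * INR n) N).
  { rewrite <- !Csum_scal.
    replace (- (PI / x2)) with (-1 * (PI / x2)) by ring.
    transitivity (Csum (fun k => PI / x1 * (disp x2 w k - x2 * INR k)
       - (PI / x2) * (disp x1 w k - x1 * INR k)) N).
    - apply Csum_ext; intros k _; unfold summand; field; auto.
    - rewrite Csum_minus; unfold Cminus; f_equal.
      rewrite !Csum_scal; ring. }
  assert (Eg : w * w * sigma x1 x2 N
    = w * w * Csum (tail_sum x1 x2 N) N + - (w * w) * Csum (tail_sum x2 x1 N) N)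
    by (unfold sigma; ring).
  rewrite ES, Eg, !Cexp_plus.
  rewrite (Cprod_swap (fun n k => 1 + w * w / lam x2 x1 n k)).
  replace (Cprod (fun k => Cprod (fun n => 1 + w * w / lam x2 x1 n k) N) N)
    with (Cprod (fun n => Cprod (fun k => 1 + w * w / lam x1 x2 n k) N) N)
    by (apply Cprod_ext; intros n _; apply Cprod_ext; intros k _;
        rewrite lam_sym; reflexivity).
  replace (- (w * w) * Csum (tail_sum x1 x2 N) N)
    with (- (w * w * Csum (tail_sum x1 x2 N) N)) by ring.
  replace (- (PI / x1) * Csum (fun n => disp x2 w n - x2 * INR n) N)
    with (- (PI / x1 * Csum (fun n => disp x2 w n - x2 * INR n) N)) by ring.
  rewrite (Cexp_opp (w * w * _)), (Cexp_opp (PI / x1 * _)).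
  field; split; apply Cexp_neq_0. }
(* [sigma] is not yet known to converge; its boundedness lets [Cexp (w^2 sigma)] multiply the null
   sequence [X' - X]. *)
destruct (sigma_bounded x1 x2 H1 H2 Ht) as [B HB].
set (M := exp (Cmod w * Cmod w * B)).
assert (HM : forall N, (1 <= N)%nat -> (Cmod (Cexp (w * w * sigma x1 x2 N)) <= M)%R).
{ intros N HN; rewrite Cmod_Cexp; apply exp_le.
  eapply Rle_trans; [ apply Re_le_Cmod | rewrite !Cmod_mult ].
  pose proof (Cmod_ge_0 w); apply Rmult_le_compat_l; [ nra | apply HB, HN ]. }
apply (clim_squeeze eventually _ _ (fun N => M * Cmod (X' N - X) + Cmod (Y' N - Y))%R).
- exists 1%nat; intros N HN.
  replace (Cexp (w * w * sigma x1 x2 N) * X - Y)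
    with (- (Cexp (w * w * sigma x1 x2 N) * (X' N - X)) + (Y' N - Y))
    by (rewrite E; ring).
  eapply Rle_trans; [ apply Cmod_triangle | ].
  rewrite Cmod_opp, Cmod_mult; apply Rplus_le_compat_r, Rmult_le_compat_r;
    [ apply Cmod_ge_0 | apply HM, HN ].
- assert (Z : forall (f : nat -> C) l, seqlim f l ->
     filterlim (fun N => Cmod (f N - l)) eventually (locally 0%R)).
  { intros f l Hf; rewrite <- Cmod_0; replace (RtoC 0) with (l - l) by ring.
    apply clim_Cmod; [ apply eventually_filter | ].
    apply clim_minus; [ apply eventually_filter | exact Hf | apply filterlim_const ]. }
  replace 0%R with (M * 0 + 0)%R by ring.
  apply (rlim_plus eventually); [ apply (rlim_mult eventually);
    [ apply filterlim_const | apply Z, LX ] | apply Z, LY ].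
Qed.

(** * Euler-Maclaurin summation of sqrt (t^2 y^2 + T^2) *)

(** Replace the right end by a variable [y]. The defect then vanishes at [a] together with its first
    derivative, and its second derivative involves only [F3] and the first-order Taylor remainder of
    [F1]. Three mean value steps replace the integral remainder. *)
Lemma euler_maclaurin_step (Phi F F1 F2 F3 : R -> C) (a M : R) :
  (forall y, (a <= y <= a + 1)%R -> cderiv Phi y (F y)) ->
  (forall y, (a <= y <= a + 1)%R -> cderiv F y (F1 y)) ->
  (forall y, (a <= y <= a + 1)%R -> cderiv F1 y (F2 y)) ->
  (forall y, (a <= y <= a + 1)%R -> cderiv F2 y (F3 y)) ->
  (forall y, (a <= y <= a + 1)%R -> (Cmod (F3 y) <= M)%R) ->
  (Cmod (Phi (a + 1)%R - Phi a - (F a + F (a + 1)%R) / 2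
         + (F1 (a + 1)%R - F1 a) / 12) <= 4 * M)%R.
Proof.
intros D0 D1 D2 D3 HM.
assert (HM0 : (0 <= M)%R).
{ eapply Rle_trans; [ apply Cmod_ge_0 | apply (HM a); lra ]. }
assert (HD : forall y, cderiv (fun y => RtoC (y - a)%R) y 1).
{ intros y; apply cderiv_RtoC; auto_derive; [ exact I | ring ]. }
assert (B1 : forall y, (a <= y <= a + 1)%R ->
   (Cmod (F1 y - F1 a - RtoC (y - a)%R * F2 y) <= 2 * M)%R).
{ intros y Hy.
  pose proof (cmean_value (fun s => F1 s - F1 a - RtoC (s - a)%R * F2 s)
     (fun s => - (RtoC (s - a)%R * F3 s)) a y M ltac:(lra)) as H; cbv beta in H.
  rewrite Rminus_diag in H.
  replace (F1 y - F1 a - RtoC (y - a)%R * F2 y - (F1 a - F1 a - 0 * F2 a))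
    with (F1 y - F1 a - RtoC (y - a)%R * F2 y) in H by ring.
  eapply Rle_trans; [ apply H | nra ].
  - intros s Hs; eapply cderiv_eq.
    + apply cderiv_minus; [ apply cderiv_minus; [ apply D2; lra | apply cderiv_const ] | ].
      apply cderiv_mult; [ apply HD | apply D3; lra ].
    + cbv beta; ring.
  - intros s Hs; rewrite Cmod_opp; eapply Rle_trans; [ apply Cmod_scal_le; lra | apply HM; lra ]. }
(* [K1] is the derivative of the defect on [[a, y]]. Its own derivative is at most
   [2 M / 6 + M / 12 <= M]. *)
set (K1 := fun y => F y - (F y + F a) / 2 - RtoC (y - a)%R / 2 * F1 y
   + RtoC (y - a)%R / 6 * (F1 y - F1 a) + RtoC (y - a)%R * RtoC (y - a)%R / 12 * F2 y).
assert (B2 : forall y, (a <= y <= a + 1)%R -> (Cmod (K1 y) <= 2 * M)%R).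
{ intros y Hy.
  pose proof (cmean_value K1
     (fun s => (F1 s - F1 a - RtoC (s - a)%R * F2 s) / 6
        + RtoC (s - a)%R * (RtoC (s - a)%R * F3 s) / 12) a y M ltac:(lra)) as H; cbv beta in H.
  replace (K1 y - K1 a) with (K1 y) in H
    by (unfold K1; rewrite Rminus_diag; field; exact C2_neq_0).
  eapply Rle_trans; [ apply H | nra ].
  - intros s Hs; unfold K1, Cdiv; eapply cderiv_eq.
    + apply cderiv_plus; [ apply cderiv_plus; [ apply cderiv_minus; [ apply cderiv_minus | ] | ] | ].
      * apply D1; lra.
      * apply cderiv_mult; [ apply cderiv_plus; [ apply D1; lra | apply cderiv_const ] | apply cderiv_const ].
      * apply cderiv_mult; [ apply cderiv_mult; [ apply HD | apply cderiv_const ] | apply D2; lra ].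
      * apply cderiv_mult; [ apply cderiv_mult; [ apply HD | apply cderiv_const ] | ].
        apply cderiv_minus; [ apply D2; lra | apply cderiv_const ].
      * apply cderiv_mult; [ apply cderiv_mult; [ | apply cderiv_const ] | apply D3; lra ].
        apply cderiv_mult; apply HD.
    + cbv beta; field; exact C2_neq_0.
  - intros s Hs; unfold Cdiv.
    eapply Rle_trans; [ apply Cmod_triangle | rewrite 2!Cmod_mult ].
    assert (I6 : Cmod (/ 6) = (/ 6)%R).
    { rewrite <- RtoC_inv by lra; rewrite Cmod_R; apply Rabs_pos_eq; lra. }
    assert (I12 : Cmod (/ 12) = (/ 12)%R).
    { rewrite <- RtoC_inv by lra; rewrite Cmod_R; apply Rabs_pos_eq; lra. }
    rewrite I6, I12.
    pose proof (B1 s ltac:(lra)).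
    assert (Cmod (RtoC (s - a)%R * (RtoC (s - a)%R * F3 s)) <= M)%R.
    { eapply Rle_trans; [ apply Cmod_scal_le; lra | ].
      eapply Rle_trans; [ apply Cmod_scal_le; lra | apply HM; lra ]. }
    lra. }
pose proof (cmean_value (fun y => Phi y - Phi a - RtoC (y - a)%R / 2 * (F y + F a)
   + RtoC (y - a)%R * RtoC (y - a)%R / 12 * (F1 y - F1 a)) K1 a (a + 1) (2 * M) ltac:(lra)) as H.
cbv beta in H; rewrite Rminus_diag in H; replace (a + 1 - a)%R with 1%R in H by ring.
match type of H with _ -> _ -> (Cmod ?z <= _)%R =>
  replace z with (Phi (a + 1)%R - Phi a - (F a + F (a + 1)%R) / 2
         + (F1 (a + 1)%R - F1 a) / 12) in H by (field; exact C2_neq_0) end.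
eapply Rle_trans; [ apply H | lra ].
- intros s Hs; unfold K1, Cdiv; eapply cderiv_eq.
  + apply cderiv_plus; [ apply cderiv_minus; [ apply cderiv_minus | ] | ].
    * apply D0; lra.
    * apply cderiv_const.
    * apply cderiv_mult; [ apply cderiv_mult; [ apply HD | apply cderiv_const ] | ].
      apply cderiv_plus; [ apply D1; lra | apply cderiv_const ].
    * apply cderiv_mult; [ apply cderiv_mult; [ | apply cderiv_const ] | ].
      -- apply cderiv_mult; apply HD.
      -- apply cderiv_minus; [ apply D2; lra | apply cderiv_const ].
  + cbv beta; field; exact C2_neq_0.
- intros s Hs; apply B2; lra.
Qed.

Lemma cderiv_inv (f : R -> C) (y : R) (l : C) : f y <> 0 -> cderiv f y l ->
  cderiv (fun s => / f s) y (- l / (f y * f y)).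
Proof.
intros H0 [H1 H2].
assert (Hn : (fst (f y) ^ 2 + snd (f y) ^ 2)%R <> 0%R).
{ intros H; apply H0, injective_projections; simpl in *; nra. }
set (d := (- (2 * fst (f y) * fst l + 2 * snd (f y) * snd l)
           / (fst (f y) ^ 2 + snd (f y) ^ 2) ^ 2)%R).
assert (HN : is_derive (fun s => / (fst (f s) ^ 2 + snd (f s) ^ 2))%R y d).
{ apply (is_derive_inv (fun s => fst (f s) ^ 2 + snd (f s) ^ 2)%R); [ | exact Hn ].
  evar_last.
  - apply (is_derive_plus (fun s => fst (f s) ^ 2)%R (fun s => snd (f s) ^ 2)%R);
    apply is_derive_pow; eassumption.
  - unfold plus, Re, Im; simpl; ring. }
assert (E : - l / (f y * f y)
  = ((fst l * / (fst (f y) ^ 2 + snd (f y) ^ 2) + fst (f y) * d)%R,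
     (- snd l * / (fst (f y) ^ 2 + snd (f y) ^ 2) + - snd (f y) * d)%R)).
{ transitivity (- (l * (/ f y * / f y))); [ field; exact H0 | ].
  apply injective_projections; unfold d; simpl; field; simpl in Hn; lra. }
rewrite E; split.
- exact (is_derive_mult_R (fun s => Re (f s)) _ _ _ _ H1 HN).
- exact (is_derive_mult_R (fun s => - Im (f s))%R _ _ _ _
    (is_derive_opp (fun s => Im (f s)) _ _ H2) HN).
Qed.

Section EulerMaclaurin.
Context (t : C) (T : R) (Ht : (0 < Re t)%R) (HT : (0 < T)%R).

Definition quad (y : R) : C := t * t * RtoC (y * y)%R + RtoC (T * T)%R.

(** The imaginary part is [2 Re t Im t y^2]; where it vanishes, [t] is real or [y = 0], and the
    value is positive. The root is therefore smooth in [y]. *)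
Lemma quad_cut (y : R) : Im (quad y) = 0%R -> (0 < Re (quad y))%R.
Proof.
unfold quad, Re, Im in *; simpl; intros H.
assert (H1 : (snd t * (y * y) = 0)%R) by nra.
assert (H2 : (snd t * snd t * (y * y) = 0)%R) by (rewrite Rmult_assoc, H1; ring).
assert (0 <= fst t * fst t * (y * y))%R by nra.
assert (0 < T * T)%R by nra. nra.
Qed.

Definition em_F (y : R) : C := Csqrt (quad y).
Definition em_F1 (y : R) : C := t * t * RtoC y / em_F y.
Definition em_F2 (y : R) : C := t * t * RtoC (T * T)%R / (em_F y * em_F y * em_F y).
Definition em_F3 (y : R) : C :=
  - (3 * (t * t * (t * t)) * RtoC (T * T)%R * RtoC y
     / (em_F y * em_F y * em_F y * em_F y * em_F y)).
(** The primitive of [em_F], with the inverse hyperbolic sine written as a logarithm. For [y >= 0]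
    its argument lies in the right half-plane, where [Clog] is smooth. *)
Definition em_Phi (y : R) : C :=
  RtoC y * em_F y / 2 + RtoC (T * T)%R / (2 * t) * Clog (t * RtoC y + em_F y).

Lemma em_F_sqr (y : R) : em_F y * em_F y = quad y.
Proof. apply Csqrt_sqr. Qed.

Lemma Re_em_F (y : R) : (0 < Re (em_F y))%R.
Proof. apply Re_Csqrt_pos, quad_cut. Qed.

Lemma em_F_neq_0 (y : R) : em_F y <> 0.
Proof. apply Re_gt_0_neq_0, Re_em_F. Qed.

Lemma cderiv_quad (y : R) : cderiv quad y (2 * (t * t) * RtoC y).
Proof.
eapply cderiv_eq.
- apply cderiv_plus; [ apply cderiv_mult; [ apply cderiv_const | apply cderiv_RtoC ]
  | apply cderiv_const ].
  apply is_derive_mult_R; apply @is_derive_id.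
- unfold one; simpl; rewrite RtoC_plus, !RtoC_mult; ring.
Qed.

Lemma cderiv_em_F (y : R) : cderiv em_F y (em_F1 y).
Proof.
eapply cderiv_eq; [ apply cderiv_Csqrt; [ apply quad_cut | apply cderiv_quad ] | ].
fold (em_F y); unfold em_F1; field; apply em_F_neq_0; assumption.
Qed.

Lemma cderiv_em_F1 (y : R) : cderiv em_F1 y (em_F2 y).
Proof.
pose proof (em_F_neq_0 y) as H0.
unfold em_F1, Cdiv; eapply cderiv_eq.
- apply cderiv_mult; [ apply cderiv_mult; [ apply cderiv_const | apply cderiv_id ]
  | apply cderiv_inv; [ exact H0 | apply cderiv_em_F; assumption ] ].
- cbv beta; unfold em_F1, em_F2.
  replace (RtoC (T * T)) with (em_F y * em_F y - t * t * RtoC (y * y)%R)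
    by (rewrite em_F_sqr; unfold quad; ring).
  rewrite RtoC_mult; field; exact H0.
Qed.

Lemma cderiv_em_F2 (y : R) : cderiv em_F2 y (em_F3 y).
Proof.
pose proof (em_F_neq_0 y) as H0.
unfold em_F2, Cdiv; eapply cderiv_eq.
- apply cderiv_mult; [ apply cderiv_const | apply cderiv_inv ].
  + repeat apply Cmult_neq_0; exact H0.
  + apply cderiv_mult; [ apply cderiv_mult | ]; apply cderiv_em_F; assumption.
- cbv beta; unfold em_F1, em_F3; field; exact H0.
Qed.

Lemma Re_arg_pos (y : R) : (0 <= y)%R -> (0 < Re (t * RtoC y + em_F y))%R.
Proof.
intros Hy; pose proof (Re_em_F y).
change (Re (t * RtoC y + em_F y)) with (Re (t * RtoC y) + Re (em_F y))%R.
rewrite Re_mult; simpl; unfold Re in *; simpl; nra.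
Qed.

Lemma cderiv_em_Phi (y : R) : (0 <= y)%R -> cderiv em_Phi y (em_F y).
Proof.
intros Hy; pose proof (em_F_neq_0 y) as H0.
pose proof (Re_arg_pos y Hy) as Ha; pose proof (Re_gt_0_neq_0 _ Ha) as Ha0.
pose proof (Re_gt_0_neq_0 _ Ht) as Ht0.
unfold em_Phi, Cdiv; eapply cderiv_eq.
- apply cderiv_plus.
  + apply cderiv_mult; [ apply cderiv_mult; [ apply cderiv_id | apply cderiv_em_F ]
    | apply cderiv_const ].
  + apply cderiv_mult; [ apply cderiv_const | apply cderiv_Clog; [ exact Ha | ] ].
    apply cderiv_plus; [ apply cderiv_mult; [ apply cderiv_const | apply cderiv_id ]
    | apply cderiv_em_F ].
- cbv beta; unfold em_F1.
  replace (RtoC (T * T)) with (em_F y * em_F y - t * t * RtoC (y * y)%R)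
    by (rewrite em_F_sqr; unfold quad; ring).
  rewrite RtoC_mult; field; repeat split; auto using C2_neq_0.
Qed.

End EulerMaclaurin.

(** With [k = sqrt c], both [k T] and [k y] are at most [Cmod (em_F t T y)]. So [T^2 y] absorbs
    three of the five powers in the denominator, and the remaining two give [1 / (y^2 + T^2)]. *)
Lemma em_F3_bound (t : C) : (0 < Re t)%R -> exists K, (0 <= K)%R /\
  forall T y, (0 < T)%R -> (0 <= y)%R ->
  (Cmod (em_F3 t T y) <= K / (y * y + T * T))%R.
Proof.
intros Ht; destruct (Cmod_quad_lower t Ht) as [c [Hc HQ]].
pose proof (sqrt_lt_R0 c Hc) as Hk; pose proof (sqrt_sqrt c ltac:(lra)) as Hkk.
set (k := sqrt c) in *; pose proof (Cmod_ge_0 t) as Hm0.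
set (A := (3 * (Cmod t * Cmod t * (Cmod t * Cmod t)))%R).
assert (HA : (0 <= A)%R) by (unfold A; repeat apply Rmult_le_pos; lra).
exists (A / (k * k * k) / c)%R; split.
{ unfold Rdiv; repeat apply Rmult_le_pos; try lra; left; apply Rinv_0_lt_compat; try lra.
  repeat apply Rmult_lt_0_compat; exact Hk. }
intros T y HT Hy.
pose proof (em_F_neq_0 t T Ht HT y) as HF0; pose proof (proj1 (Cmod_gt_0 _) HF0) as Hm.
unfold em_F3; set (f := em_F t T y) in *; set (m := Cmod f) in *.
assert (Hmm : (c * (y * y + T * T) <= m * m)%R).
{ unfold m; rewrite <- Cmod_mult; unfold f; rewrite em_F_sqr; apply HQ. }
assert (HTm : (k * T <= m)%R).
{ apply Rsqr_incr_0_var; [ unfold Rsqr | lra ]; nra. }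
assert (Hym : (k * y <= m)%R).
{ apply Rsqr_incr_0_var; [ unfold Rsqr | lra ]; nra. }
rewrite Cmod_opp; unfold Cdiv; rewrite Cmod_mult, Cmod_inv
  by (repeat apply Cmult_neq_0; exact HF0).
rewrite !Cmod_mult, !Cmod_R, (Rabs_pos_eq 3), (Rabs_pos_eq (T * T)), (Rabs_pos_eq y) by nra.
fold m A.
assert (HTy : (T * T * y <= m * m * m / (k * k * k))%R).
{ apply (Rmult_le_reg_r (k * k * k)); [ repeat apply Rmult_lt_0_compat; exact Hk | ].
  replace (m * m * m / (k * k * k) * (k * k * k))%R with (m * m * m)%R by (field; lra).
  replace (T * T * y * (k * k * k))%R with ((k * T) * (k * T) * (k * y))%R by ring.
  apply Rmult_le_compat; [ nra | nra | apply Rmult_le_compat; nra | exact Hym ]. }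
apply Rle_trans with (A * (m * m * m / (k * k * k)) * / (m * m * m * m * m))%R.
- apply Rmult_le_compat_r.
  + left; apply Rinv_0_lt_compat; repeat apply Rmult_lt_0_compat; exact Hm.
  + rewrite Rmult_assoc; apply Rmult_le_compat_l; [ exact HA | exact HTy ].
- replace (A * (m * m * m / (k * k * k)) * / (m * m * m * m * m))%R
    with (A / (k * k * k) * / (m * m))%R by (field; lra).
  replace (A / (k * k * k) / c / (y * y + T * T))%R
    with (A / (k * k * k) * / (c * (y * y + T * T)))%R by (field; nra).
  apply Rmult_le_compat_l.
  + unfold Rdiv; apply Rmult_le_pos; [ exact HA | left; apply Rinv_0_lt_compat ].
    repeat apply Rmult_lt_0_compat; exact Hk.
  + apply Rinv_le_contravar; [ apply Rmult_lt_0_compat; nra | exact Hmm ].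
Qed.

Lemma disp_em_F (t : C) (T : R) (n : nat) : disp t (RtoC T) n = em_F t T (INR n).
Proof. unfold disp, em_F, quad; f_equal; rewrite !RtoC_mult; ring. Qed.

(** The point is an error of order [1/T] uniform in [N], so that [N] can go to infinity before [T].
    At the lower end [em_F t T 0 = T] and [em_F1 t T 0 = 0]. *)
Lemma em_sum (t : C) : (0 < Re t)%R -> exists K, (0 <= K)%R /\
  forall T N, (1 < T)%R ->
  (Cmod (Csum (disp t (RtoC T)) N
         - (em_Phi t T (INR N) + em_F t T (INR N) / 2 + em_F1 t T (INR N) / 12
            - em_Phi t T 0 - RtoC T / 2)) <= K / (T - 1))%R.
Proof.
intros Ht; destruct (em_F3_bound t Ht) as [K [HK HB]].
exists (8 * K)%R; split; [ lra | intros T N HT ].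
assert (HT0 : (0 < T)%R) by lra.
assert (E0 : em_F t T 0 = RtoC T).
{ apply Csqrt_unique; [ unfold quad; rewrite !RtoC_mult; ring | exact HT0 ]. }
assert (E1 : em_F1 t T 0 = 0) by (unfold em_F1; rewrite E0; unfold Cdiv; ring).
assert (H : (Cmod (Csum (disp t (RtoC T)) N
         - (em_Phi t T (INR N) + em_F t T (INR N) / 2 + em_F1 t T (INR N) / 12
            - em_Phi t T 0 - RtoC T / 2)) <= 8 * K / (T - 1) - 8 * K / (INR N + T - 1))%R).
{ induction N as [ | N IH].
  - simpl Csum; simpl INR; rewrite E0, E1.
    match goal with |- (Cmod ?z <= _)%R =>
      replace z with (RtoC 0) by (field; exact C2_neq_0) end.
    rewrite Cmod_0, Rplus_0_l; lra.
  - cbn [Csum]; rewrite disp_em_F, S_INR in *.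
    pose proof (pos_INR N) as HN.
    pose proof (euler_maclaurin_step (em_Phi t T) (em_F t T) (em_F1 t T) (em_F2 t T)
      (em_F3 t T) (INR N) (K / (INR N * INR N + T * T))) as HS.
    match type of IH with (Cmod ?z <= _)%R => set (z0 := z) in IH end.
    match type of HS with _ -> _ -> _ -> _ -> _ -> (Cmod ?z <= _)%R => set (z1 := z) in HS end.
    match goal with |- (Cmod ?z <= _)%R =>
      replace z with (z0 - z1) by (unfold z0, z1; field; exact C2_neq_0) end.
    eapply Rle_trans; [ apply Cmod_triangle | rewrite Cmod_opp ].
    assert (HS' : (Cmod z1 <= 4 * (K / (INR N * INR N + T * T)))%R).
    { apply HS; intros y Hy.
      - apply cderiv_em_Phi; lra.
      - apply cderiv_em_F; lra.
      - apply cderiv_em_F1; lra.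
      - apply cderiv_em_F2; lra.
      - eapply Rle_trans; [ apply HB; lra | ].
        apply Rmult_le_compat_l; [ exact HK | apply Rinv_le_contravar; nra ]. }
    (* Since [2 (N^2 + T^2) >= (N + T)^2], the error of one step is dominated by a telescoping
       difference. *)
    assert (HT' : (4 * (K / (INR N * INR N + T * T))
       <= 8 * K / (INR N + T - 1) - 8 * K / (INR N + 1 + T - 1))%R).
    { replace (8 * K / (INR N + T - 1) - 8 * K / (INR N + 1 + T - 1))%R
        with (4 * (K * (2 / ((INR N + T - 1) * (INR N + T)))))%R by (field; lra).
      apply Rmult_le_compat_l; [ lra | apply Rmult_le_compat_l; [ exact HK | ] ].
      assert (P1 : (0 < (INR N + T - 1) * (INR N + T))%R) by (apply Rmult_lt_0_compat; lra).
      apply (Rmult_le_reg_r ((INR N * INR N + T * T) * ((INR N + T - 1) * (INR N + T)))).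
      { apply Rmult_lt_0_compat; nra. }
      replace (/ (INR N * INR N + T * T) * ((INR N * INR N + T * T)
         * ((INR N + T - 1) * (INR N + T))))%R
        with ((INR N + T - 1) * (INR N + T))%R by (field; nra).
      replace (2 / ((INR N + T - 1) * (INR N + T)) * ((INR N * INR N + T * T)
         * ((INR N + T - 1) * (INR N + T))))%R
        with (2 * (INR N * INR N + T * T))%R by (field; lra).
      pose proof (Rle_0_sqr (INR N - T)) as Hsq; unfold Rsqr in Hsq; lra. }
    lra. }
eapply Rle_trans; [ exact H | ].
assert (0 <= 8 * K / (INR N + T - 1))%R; [ | lra ].
apply Rdiv_le_0_compat; [ lra | pose proof (pos_INR N); lra ].
Qed.

Lemma clim_bound_inv_INR (f : nat -> C) (l : C) (K : R) :
  (forall n, (1 <= n)%nat -> (Cmod (f n - l) <= K / INR n)%R) ->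
  seqlim f l.
Proof.
intros H; apply (clim_squeeze eventually f l (fun n => K * / INR n)%R).
- exists 1%nat; intros n Hn; apply H, Hn.
- replace 0%R with (K * 0)%R by ring; apply (rlim_mult eventually).
  + apply filterlim_const.
  + apply (is_lim_seq_inv INR p_infty); [ apply is_lim_seq_INR | discriminate ].
Qed.

(** The upper boundary terms less their divergent part. [T^2 / (4 t)] is the limit of
    [N (d N - t N) / 2], the logarithm comes from [t N + d N ~ 2 t N], and [t / 12] from the
    derivative term. *)
Lemma em_limit (t : C) (T : R) : (0 < Re t)%R -> (0 < T)%R ->
  seqlim (fun N => em_Phi t T (INR N) + em_F t T (INR N) / 2 + em_F1 t T (INR N) / 12
      - (t * ((INR N * INR N + INR N) / 2) + RtoC (T * T)%R / (2 * t) * RtoC (ln (INR N)))) (RtoC (T * T)%R / (4 * t) + RtoC (T * T)%R / (2 * t) * Clog (2 * t) + t / 12).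
Proof.
intros Ht HT; pose proof (Re_gt_0_neq_0 _ Ht) as Ht0.
set (w := RtoC T); set (d := disp t w).
assert (La : seqlim (fun N => d N - t * INR N) (RtoC 0)).
{ apply (clim_bound_inv_INR _ _ (Cmod w * Cmod w / Re t)%R); intros n Hn.
  replace (d n - t * INR n - 0) with (d n - t * INR n) by ring.
  apply Cmod_disp_sub_le; assumption. }
assert (Lb : seqlim (fun N => INR N * (t / (d N + t * INR N))) (1 / 2)).
{ apply (clim_bound_inv_INR _ _ (disp_bound t w)%R); intros n Hn.
  pose proof (INR_C_neq_0 n Hn) as Hn0; pose proof (INR_pos n Hn) as Hnp.
  replace (INR n * (t / (d n + t * INR n)) - 1 / 2)
    with (INR n * (t / (d n + t * INR n) - 1 / (2 * INR n))).
  2: { pose proof (disp_add_neq_0 t w Ht n Hn); fold d in H; field; auto. }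
  rewrite Cmod_mult, Cmod_R, Rabs_pos_eq by lra.
  replace (disp_bound t w / INR n)%R with (INR n * (disp_bound t w / INR n ^ 2))%R by (field; lra).
  apply Rmult_le_compat_l; [ lra | apply disp_recip_near; assumption ]. }
assert (Lc : seqlim (fun N => d N / (t * INR N)) (RtoC 1)).
{ apply (clim_bound_inv_INR _ _ (disp_bound t w)%R); intros n Hn.
  pose proof (INR_pos n Hn) as Hnp.
  eapply Rle_trans; [ apply disp_ratio_near; assumption | ].
  apply Rmult_le_compat_l; [ apply disp_bound_ge_0, Ht | apply Rinv_le_contravar; nra ]. }
assert (Ld : seqlim (fun N => Clog (t + t * (d N / (t * INR N)))) (Clog (2 * t))).
{ apply (clim_Clog eventually).
  - rewrite Re_mult; unfold Re, Im in *; simpl; lra.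
  - replace (2 * t) with (t + t * 1) by ring.
    apply (clim_plus eventually); [ apply filterlim_const | ].
    apply (clim_mult eventually); [ apply filterlim_const | exact Lc ]. }
(* The same expression regrouped into pieces covered by [La] to [Ld]; [Clog_scal] splits off
   [ln N]. *)
eapply filterlim_ext_loc with (f := fun N =>
  RtoC (T * T)%R / (2 * t) * (INR N * (t / (d N + t * INR N)))
  + RtoC (T * T)%R / (2 * t) * Clog (t + t * (d N / (t * INR N)))
  + (t / (d N / (t * INR N)) / 12 + (d N - t * INR N) / 2)).
- exists 1%nat; intros N HN.
  pose proof (INR_C_neq_0 N HN) as HN0; pose proof (INR_pos N HN) as HNp.
  pose proof (disp_add_neq_0 t w Ht N HN) as Hs.
  pose proof (disp_sub t w Ht N HN) as Hsub.
  unfold em_Phi, em_F1; rewrite <- disp_em_F; fold w d in Hs, Hsub |- *.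
  assert (Hd0 : d N <> 0).
  { unfold d, w; rewrite disp_em_F; apply em_F_neq_0; assumption. }
  replace (t * RtoC (INR N) + d N) with (RtoC (INR N) * (t + t * (d N / (t * INR N))))
    by (field; auto).
  rewrite Clog_scal.
  + replace (RtoC (T * T)) with (w * w) by (unfold w; rewrite RtoC_mult; reflexivity).
    assert (E : w * w / (2 * t) * (INR N * (t / (d N + t * INR N)))
      = INR N * (d N - t * INR N) / 2) by (rewrite Hsub; field; auto).
    rewrite E; field; auto.
  + lra.
  + replace (t + t * (d N / (t * INR N))) with ((d N + t * INR N) * / INR N) by (field; auto).
    apply Cmult_neq_0; [ exact Hs | ].
    rewrite <- RtoC_inv by lra; apply RtoC_neq_0, Rinv_neq_0_compat; lra.
- replace (RtoC (T * T)%R / (4 * t) + RtoC (T * T)%R / (2 * t) * Clog (2 * t) + t / 12)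
    with (RtoC (T * T)%R / (2 * t) * (1 / 2) + RtoC (T * T)%R / (2 * t) * Clog (2 * t)
          + (t / 1 / 12 + 0 / 2)) by (field; auto).
  apply (clim_plus eventually); [ apply (clim_plus eventually) | apply (clim_plus eventually) ].
  + apply (clim_mult eventually); [ apply filterlim_const | exact Lb ].
  + apply (clim_mult eventually); [ apply filterlim_const | exact Ld ].
  + apply (clim_mult eventually); [ | apply filterlim_const ].
    apply (clim_div eventually); [ exact C1_nz | apply filterlim_const | exact Lc ].
  + apply (clim_mult eventually); [ exact La | apply filterlim_const ].
Qed.

(** * Lower bounds for the real part of [disp], and scaling *)

Lemma Re_disp_gt (t : C) (T : R) (n : nat) : (0 < Re t)%R -> (0 < T)%R ->
  (Re t * INR n < Re (disp t (RtoC T) n))%R.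
Proof.
intros Ht HT; rewrite disp_em_F.
pose proof (Re_em_F t T Ht HT (INR n)) as Hp; pose proof (em_F_sqr t T (INR n)) as Hq.
set (f := em_F t T (INR n)) in *; set (p := Re f) in *.
assert (E1 : (p * p - Im f * Im f = (Re t * Re t - Im t * Im t) * (INR n * INR n) + T * T)%R).
{ transitivity (Re (f * f)); [ reflexivity | rewrite Hq ].
  unfold quad, Re, Im; simpl; ring. }
assert (E2 : (p * Im f = Re t * Im t * (INR n * INR n))%R).
{ assert (E : (2 * (p * Im f) = 2 * (Re t * Im t * (INR n * INR n)))%R); [ | lra ].
  transitivity (Im (f * f)); [ rewrite Im_mult; unfold p; ring | rewrite Hq ].
  unfold quad, Re, Im; simpl; ring. }
set (a := Re t) in *; set (b := Im t) in *; set (r := Im f) in *; set (N := INR n) in *.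
assert (HN : (0 <= N)%R) by apply pos_INR.
apply Rnot_le_lt; intros Hle.
assert (H1 : (p * p <= (a * N) * (a * N))%R) by (apply Rmult_le_compat; lra).
(* [p <= a N] forces [r^2 >= b^2 N^2], contradicting [p^2 - r^2 > (a^2 - b^2) N^2]. *)
assert (H2 : (p * p * (r * r) = (a * N) * (a * N) * (b * b * (N * N)))%R).
{ replace (p * p * (r * r))%R with ((p * r) * (p * r))%R by ring; rewrite E2; ring. }
assert (H3 : (b * b * (N * N) <= r * r)%R).
{ apply (Rmult_le_reg_l (p * p)); [ nra | rewrite H2 ].
  apply Rmult_le_compat_r; [ | exact H1 ].
  replace (b * b * (N * N))%R with ((b * N) * (b * N))%R by ring; apply Rle_0_sqr. }
assert (0 < T * T)%R by nra; lra.
Qed.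

(** Linear growth in both [n] and [T] makes all factors on the ray exponentially close to 1. The
    part in [n] is [Re_disp_gt]. *)
Lemma Re_disp_lower (t : C) : (0 < Re t)%R -> exists c, (0 < c)%R /\
  forall T n, (0 < T)%R -> (c * (INR n + T) <= Re (disp t (RtoC T) n))%R.
Proof.
intros Ht; set (a := Re t) in *; set (b := Im t).
(* From the real part of [f^2], [T^2 <= p^2 + b^2 n^2], and [a n < p] bounds the last term by
   [(b / a)^2 p^2]; hence [T <= m p]. In [c], half of [p] pays for [n] and half for [T]. *)
set (m := (1 + Rabs b / a)%R).
assert (Hm : (1 <= m)%R).
{ unfold m; assert (0 <= Rabs b / a)%R; [ | lra ].
  apply Rdiv_le_0_compat; [ apply Rabs_pos | apply Ht ]. }
set (c := Rmin (a / 2) (/ m / 2)).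
assert (Hc : (0 < c)%R).
{ unfold c; apply Rmin_pos; [ lra | ]; pose proof (Rinv_0_lt_compat m ltac:(lra)); lra. }
exists c; split; [ exact Hc | intros T n HT ].
pose proof (Re_disp_gt t T n Ht HT) as H1; fold a in H1.
set (f := disp t (RtoC T) n) in *; set (p := Re f) in *.
assert (Hq : f * f = quad t T (INR n)) by (unfold f; rewrite disp_em_F; apply em_F_sqr).
assert (E1 : (p * p - Im f * Im f = (a * a - b * b) * (INR n * INR n) + T * T)%R).
{ transitivity (Re (f * f)); [ reflexivity | rewrite Hq ].
  unfold quad, a, b, Re, Im; simpl; ring. }
pose proof (pos_INR n) as HN; set (N := INR n) in *.
assert (Hp : (0 <= p)%R) by nra.
assert (HT2 : (T <= m * p)%R).
{ apply Rsqr_incr_0_var; [ unfold Rsqr | nra ].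
  assert (Hb : (Rabs b * N <= Rabs b / a * p)%R).
  { replace (Rabs b * N)%R with (Rabs b / a * (a * N))%R by (field; lra).
    apply Rmult_le_compat_l; [ | lra ].
    apply Rdiv_le_0_compat; [ apply Rabs_pos | apply Ht ]. }
  assert (Hb2 : ((Rabs b * N) * (Rabs b * N) <= (Rabs b / a * p) * (Rabs b / a * p))%R).
  { pose proof (Rabs_pos b); apply Rmult_le_compat; try exact Hb; nra. }
  assert (Hbb : (Rabs b * Rabs b = b * b)%R) by (pose proof (Rsqr_abs b) as Hs; unfold Rsqr in Hs; lra).
  replace ((Rabs b * N) * (Rabs b * N))%R with ((Rabs b * Rabs b) * (N * N))%R in Hb2 by ring.
  rewrite Hbb in Hb2.
  assert (Hba : (0 <= Rabs b / a)%R).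
  { apply Rdiv_le_0_compat; [ apply Rabs_pos | apply Ht ]. }
  unfold m.
  assert (0 <= Rabs b / a * (p * p))%R by (apply Rmult_le_pos; nra).
  assert (0 <= a * a * (N * N))%R by (apply Rmult_le_pos; nra).
  pose proof (Rle_0_sqr (Im f)) as Hr; unfold Rsqr in Hr.
  nra. }
assert (C1 : (c * N <= p / 2)%R).
{ apply Rle_trans with (a / 2 * N)%R; [ | lra ].
  apply Rmult_le_compat_r; [ exact HN | apply Rmin_l ]. }
assert (C2 : (c * T <= p / 2)%R).
{ apply Rle_trans with (/ m / 2 * T)%R.
  - apply Rmult_le_compat_r; [ lra | apply Rmin_r ].
  - apply (Rmult_le_reg_l m); [ lra | ].
    replace (m * (/ m / 2 * T))%R with (T / 2)%R by (field; lra); lra. }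
lra.
Qed.

(** Principal roots are not multiplicative, so [Re (y f) > 0] must be shown for [f = disp t T n],
    [t = x / y]. Multiplied by [Re f], it reads [Re y (Re f)^2 - Im y Re t Im t n^2 > 0]. By
    [Re_disp_gt] the left side exceeds [Re t Re (t y) n^2], and [t y = x]. *)
Lemma disp_scal (x y : C) (T : R) (n : nat) :
  (0 < Re x)%R -> (0 < Re y)%R -> (0 < Re (x / y))%R -> (0 < T)%R ->
  disp x (RtoC T * y) n = y * disp (x / y) (RtoC T) n.
Proof.
intros Hx Hy Ht HT; pose proof (Re_gt_0_neq_0 _ Hy) as Hy0.
pose proof (Re_disp_gt (x / y) T n Ht HT) as H1.
assert (Ex : x = x / y * y) by (field; exact Hy0).
set (t := x / y) in *; rewrite Ex in Hx.
set (f := disp t (RtoC T) n) in *.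
assert (Hq : f * f = quad t T (INR n)) by (unfold f; rewrite disp_em_F; apply em_F_sqr).
apply Csqrt_unique.
- transitivity (y * y * (f * f)); [ ring | rewrite Hq, Ex; unfold quad; rewrite !RtoC_mult ].
  fold t; replace (t * y / y) with t by (field; exact Hy0); ring.
- assert (E2 : (Re f * Im f = Re t * Im t * (INR n * INR n))%R).
  { assert (E : (2 * (Re f * Im f) = 2 * (Re t * Im t * (INR n * INR n)))%R); [ | lra ].
    transitivity (Im (f * f)); [ rewrite Im_mult; ring | rewrite Hq ].
    unfold quad, Re, Im; simpl; ring. }
  rewrite Re_mult in Hx |- *; pose proof (pos_INR n) as HN.
  set (N := INR n) in *; set (a := Re t) in *; set (b := Im t) in *.
  set (p := Re f) in *; set (X := Re y) in *; set (Y := Im y) in *.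
  assert (Hp : (0 < p)%R) by nra.
  apply (Rmult_lt_reg_l p); [ exact Hp | rewrite Rmult_0_r ].
  replace (p * (X * p - Y * Im f))%R with (X * (p * p) - Y * (p * Im f))%R by ring.
  rewrite E2.
  assert (H3 : (0 <= (a * X - b * Y) * (a * (N * N)))%R)
    by (apply Rmult_le_pos; [ lra | apply Rmult_le_pos; nra ]).
  assert (HaN : (0 <= a * N)%R) by (apply Rmult_le_pos; lra).
  assert (H4 : ((a * N) * (a * N) < p * p)%R) by (apply Rmult_le_0_lt_compat; lra).
  assert (H5 : (0 < X * (p * p - (a * N) * (a * N)))%R) by (apply Rmult_lt_0_compat; lra).
  lra.
Qed.

Lemma Clog_RtoC (r : R) : (0 < r)%R -> Clog (RtoC r) = RtoC (ln r).
Proof.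
intros Hr; unfold Clog; rewrite Cmod_R, Rabs_pos_eq, Carg_atan by (simpl; lra).
simpl; rewrite Rdiv_0_l, atan_0; reflexivity.
Qed.

Lemma Csum_linear (a b c d : C) (f g h : nat -> C) (n : nat) :
  Csum (fun k => a * f k + b * g k + c * h k + d * h k) n
  = a * Csum f n + b * Csum g n + c * Csum h n + d * Csum h n.
Proof. induction n as [ | n IH]; simpl; [ ring | rewrite IH; ring ]. Qed.

Lemma Csum_INR (n : nat) : Csum (fun k => RtoC (INR k)) n = (INR n * INR n + INR n) / 2.
Proof.
induction n as [ | n IH]; [ simpl; field | cbn [Csum] ].
rewrite IH, S_INR, RtoC_plus; field.
Qed.

Lemma Rbar_p_infty_le (P : R -> Prop) (M : R) :
  (forall T, (M < T)%R -> P T) -> Rbar_locally p_infty P.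
Proof. intros H; exists M; exact H. Qed.

(** By scaling, the series is [1/t] times the sum for parameter 1 minus the sum for [t]. With these
    weights all contributions of [ln N], [ln T], [ln 2] and [T^2 / (4 u)] cancel, and so does the
    quadratic growth in [N]; of order [T^2] only [Clog t] survives. *)
Lemma summand_asymp (x1 x2 : C) (s : R -> C) :
  (0 < Re x1)%R -> (0 < Re x2)%R -> (0 < Re (x1 / x2))%R ->
  (forall T, (0 < T)%R ->
     seqlim (Csum (summand x1 x2 (RtoC T * x2))) (s T)) ->
  let t := x1 / x2 in
  filterlim (fun T => s T - (- (RtoC (T * T)%R / (2 * t)) * Clog t
      + RtoC T / 2 * (1 - 1 / t) + (1 / t - t) / 12))
    (Rbar_locally p_infty) (locally (RtoC 0)).
Proof.
intros H1 H2 Ht Hs t.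
pose proof (Re_gt_0_neq_0 _ H1) as N1; pose proof (Re_gt_0_neq_0 _ H2) as N2.
pose proof (Re_gt_0_neq_0 _ Ht) as Ht0; fold t in Ht, Ht0.
assert (Hone : (0 < Re 1)%R) by (simpl; lra).
destruct (em_sum t Ht) as [K [HK HE]]; destruct (em_sum 1 Hone) as [K1 [HK1 HE1]].
apply (clim_squeeze _ _ _ (fun T => (K1 * Cmod (1 / t) + K) * / (T - 1))%R).
- apply (Rbar_p_infty_le _ 1); intros T HT.
  assert (HT0 : (0 < T)%R) by lra.
  set (V := fun u N => em_Phi u T (INR N) + em_F u T (INR N) / 2 + em_F1 u T (INR N) / 12
      - (u * ((INR N * INR N + INR N) / 2) + RtoC (T * T)%R / (2 * u) * RtoC (ln (INR N)))).
  set (v := fun u => RtoC (T * T)%R / (4 * u) + RtoC (T * T)%R / (2 * u) * Clog (2 * u) + u / 12).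
  assert (LV : forall u, (0 < Re u)%R -> seqlim (V u) (v u))
    by (intros u Hu; apply em_limit; assumption).
  set (e := fun u N => Csum (disp u (RtoC T)) N
         - (em_Phi u T (INR N) + em_F u T (INR N) / 2 + em_F1 u T (INR N) / 12
            - em_Phi u T 0 - RtoC T / 2)).
  assert (E0 : forall u, (0 < Re u)%R ->
     em_Phi u T 0 = RtoC (T * T)%R / (2 * u) * RtoC (ln T)).
  { intros u Hu; unfold em_Phi.
    replace (em_F u T 0) with (RtoC T).
    - replace (u * 0 + RtoC T) with (RtoC T) by ring.
      rewrite (Clog_RtoC T HT0); field; apply Re_gt_0_neq_0, Hu.
    - symmetry; apply Csqrt_unique; [ unfold quad; rewrite !RtoC_mult; ring | exact HT0 ]. }
  assert (EC : forall u, (0 < Re u)%R -> Clog (2 * u) = RtoC (ln 2) + Clog u).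
  { intros u Hu; apply Clog_scal; [ lra | apply Re_gt_0_neq_0, Hu ]. }
  set (tgt := - (RtoC (T * T)%R / (2 * t)) * Clog t
      + RtoC T / 2 * (1 - 1 / t) + (1 / t - t) / 12).
  (* [N] goes to infinity at fixed [T]; the bound of [em_sum] is independent of [N] and passes to
     the limit. *)
  assert (LS : seqlim (fun N => Csum (summand x1 x2 (RtoC T * x2)) N
       - (1 / t * V 1 N - V t N)) (s T - (1 / t * v 1 - v t))).
  { apply (clim_minus eventually); [ apply Hs, HT0 | apply (clim_minus eventually) ].
    - apply (clim_mult eventually); [ apply filterlim_const | apply LV, Hone ].
    - apply LV, Ht. }
  assert (EL : s T - tgt - 0 = (s T - (1 / t * v 1 - v t))
     - (1 / t * (- em_Phi 1 T 0 - RtoC T / 2) - (- em_Phi t T 0 - RtoC T / 2))).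
  { rewrite !E0 by assumption; unfold v; rewrite !EC by assumption.
    rewrite (Clog_RtoC 1) by lra; rewrite ln_1; unfold tgt; field; exact Ht0. }
  rewrite EL; apply (clim_Cmod_le eventually _ _ _ _ LS).
  exists 1%nat; intros N HN.
  assert (ES : Csum (summand x1 x2 (RtoC T * x2)) N
     = 1 / t * Csum (disp 1 (RtoC T)) N + - (1) * Csum (disp t (RtoC T)) N
       + - (1 / t) * Csum (fun k => RtoC (INR k)) N + t * Csum (fun k => RtoC (INR k)) N).
  { rewrite <- Csum_linear; apply Csum_ext; intros k Hk; unfold summand.
    rewrite (disp_scal x1 x2) by assumption.
    rewrite (disp_scal x2 x2); try assumption.
    - replace (x2 / x2) with (RtoC 1) by (field; exact N2).
      fold t; unfold t; field; auto.
    - replace (x2 / x2) with (RtoC 1) by (field; exact N2); exact Hone. }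
  match goal with |- (Cmod ?z <= _)%R => replace z with (1 / t * e 1 N - e t N) end.
  + eapply Rle_trans; [ apply Cmod_triangle | rewrite Cmod_opp, Cmod_mult ].
    pose proof (HE T N HT) as F1; pose proof (HE1 T N HT) as F2.
    fold (e t N) in F1; fold (e 1 N) in F2.
    pose proof (Cmod_ge_0 (1 / t)) as Hp.
    apply (Rmult_le_compat_l _ _ _ Hp) in F2.
    unfold Rdiv in F1, F2; lra.
  + rewrite ES, Csum_INR; unfold e, V.
    field; exact Ht0.
- replace 0%R with ((K1 * Cmod (1 / t) + K) * 0)%R by ring.
  apply (rlim_mult (Rbar_locally p_infty)); [ apply filterlim_const | ].
  assert (HL : is_lim (fun T => / (T - 1))%R p_infty (Rbar_inv p_infty)).
  { apply is_lim_inv; [ | discriminate ].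
    apply (is_lim_minus _ _ p_infty p_infty 1 p_infty); [ apply is_lim_id | apply is_lim_const | ].
    reflexivity. }
  eapply filterlim_filter_le_1; [ | exact HL ].
  intros Q [M HM]; exists M; intros T HT; apply HM, HT.
Qed.

(** * Asymptotics on the ray w = T x2 *)

(** Squares [exp (x/2) >= 1 + x/2]. It brings exponential decay into the [K / n^2] form that the
    product lemmas take. *)
Lemma exp_neg_le_inv_sqr (x : R) : (0 < x)%R -> (exp (- x) <= 4 / x ^ 2)%R.
Proof.
intros Hx; rewrite exp_Ropp.
replace (4 / x ^ 2)%R with (/ ((x / 2) * (x / 2)))%R by (field; lra).
apply Rinv_le_contravar; [ nra | ].
replace x with (x / 2 + x / 2)%R at 3 by field; rewrite exp_plus.
pose proof (exp_ineq1_le (x / 2)); apply Rmult_le_compat; lra.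
Qed.

Lemma Cmod_factor_sub_1 (x y w : C) (n : nat) :
  Cmod (factor x y w n - 1) = exp (Re (- (2 * PI / y) * disp x w n)).
Proof.
unfold factor; replace (1 - Cexp (- (2 * PI / y) * disp x w n) - 1)
  with (- Cexp (- (2 * PI / y) * disp x w n)) by ring.
rewrite Cmod_opp; apply Cmod_Cexp.
Qed.

(** Since [disp x w n = x n + O(1/n)], the exponent is linear in [n] up to a bounded error. The sign
    of [Re (x / y)] thus decides the convergence of the product, whatever [w] is. *)
Lemma Re_factor_exponent (x y w : C) : (0 < Re x)%R -> y <> 0 ->
  exists M, forall n, (1 <= n)%nat ->
  (Rabs (Re (- (2 * PI / y) * disp x w n) + 2 * PI * Re (x / y) * INR n) <= M)%R.
Proof.
intros Hx Hy.
exists (Cmod (2 * PI / y) * (Cmod w * Cmod w / Re x))%R; intros n Hn.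
replace (Re (- (2 * PI / y) * disp x w n) + 2 * PI * Re (x / y) * INR n)%R
  with (Re (- (2 * PI / y) * (disp x w n - x * INR n))).
- eapply Rle_trans; [ apply re_le_Cmod | ].
  rewrite Cmod_mult, Cmod_opp; apply Rmult_le_compat_l; [ apply Cmod_ge_0 | ].
  eapply Rle_trans; [ apply Cmod_disp_sub_le; assumption | ].
  pose proof (INR_pos n Hn); pose proof (Cmod_ge_0 w).
  assert (0 <= Cmod w * Cmod w / Re x)%R.
  { apply Rdiv_le_0_compat; [ nra | apply Hx ]. }
  apply (Rmult_le_reg_r (INR n)); [ lra | ].
  unfold Rdiv at 1; rewrite Rmult_assoc, Rinv_l by lra; nra.
- replace (- (2 * PI / y) * (disp x w n - x * INR n))
    with (- (2 * PI / y) * disp x w n + RtoC (2 * PI * INR n) * (x / y))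
    by (rewrite !RtoC_mult; field; exact Hy).
  set (z := - (2 * PI / y) * disp x w n).
  change (Re (z + RtoC (2 * PI * INR n) * (x / y)))
    with (Re z + Re (RtoC (2 * PI * INR n) * (x / y)))%R.
  rewrite Re_mult; change (Re (RtoC (2 * PI * INR n))) with (2 * PI * INR n)%R.
  change (Im (RtoC (2 * PI * INR n))) with 0%R; ring.
Qed.

Lemma factor_near (x y w : C) : (0 < Re x)%R -> y <> 0 -> (0 < Re (x / y))%R ->
  exists K, (0 <= K)%R /\ forall n, (1 <= n)%nat ->
    (Cmod (factor x y w n - 1) <= K / INR n ^ 2)%R.
Proof.
intros Hx Hy Ht; destruct (Re_factor_exponent x y w Hx Hy) as [M HM].
set (c := (2 * PI * Re (x / y))%R) in *.
assert (Hc : (0 < c)%R) by (unfold c; pose proof PI_RGT_0; apply Rmult_lt_0_compat; [ lra | exact Ht ]).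
exists (exp M * (4 / c ^ 2))%R; split.
- apply Rmult_le_pos; [ left; apply exp_pos | ].
  apply Rdiv_le_0_compat; [ lra | apply pow_lt, Hc ].
- intros n Hn; rewrite Cmod_factor_sub_1; pose proof (INR_pos n Hn) as Hn1.
  specialize (HM n Hn); apply Rabs_le_between in HM.
  apply Rle_trans with (exp (M + - (c * INR n))).
  + apply exp_le; lra.
  + rewrite exp_plus; unfold Rdiv; rewrite Rmult_assoc.
    apply Rmult_le_compat_l; [ left; apply exp_pos | ].
    eapply Rle_trans; [ apply exp_neg_le_inv_sqr; nra | apply Req_le; field; lra ].
Qed.

Lemma factor_infprod (x y w : C) : (0 < Re x)%R -> y <> 0 -> (0 < Re (x / y))%R ->
  exists P : C, is_infprod (factor x y w) P.
Proof.
intros Hx Hy Ht; destruct (factor_near x y w Hx Hy Ht) as [K [HK H]].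
destruct (infprod_cv _ K HK H) as [P HP]; exists P.
apply (is_infprod_intro _ K); assumption.
Qed.

(** If [Re (x / y) <= 0], every factor keeps the distance [exp (-M)] from 1, contrary to
    [is_infprod_term]. *)
Lemma factor_infprod_Re (x y w P : C) : (0 < Re x)%R -> y <> 0 ->
  is_infprod (factor x y w) P -> (0 < Re (x / y))%R.
Proof.
intros Hx Hy HP; apply Rnot_le_lt; intros Hle.
destruct (Re_factor_exponent x y w Hx Hy) as [M HM].
pose proof (is_infprod_term _ _ HP) as HL.
destruct (proj1 (clim_eps eventually _ _) HL (exp (- M)) (exp_pos _)) as [N HN].
specialize (HN (S N) ltac:(lia)); rewrite Cmod_factor_sub_1 in HN.
apply exp_lt_inv in HN; specialize (HM (S N) ltac:(lia)).
apply Rabs_le_between in HM; pose proof PI_RGT_0; pose proof (pos_INR (S N)).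
assert (0 <= 2 * PI * - Re (x / y) * INR (S N))%R
  by (apply Rmult_le_pos; [ apply Rmult_le_pos | ]; lra).
lra.
Qed.

Lemma lim_exp_neg (c : R) : (0 < c)%R ->
  filterlim (fun T => exp (- (c * T))) (Rbar_locally p_infty) (locally 0%R).
Proof.
intros Hc; apply filterlim_locally; intros eps; pose proof (cond_pos eps) as He.
exists (/ (c * eps))%R; intros T HT.
assert (Hce : (0 < c * eps)%R) by (apply Rmult_lt_0_compat; assumption).
pose proof (Rinv_0_lt_compat _ Hce) as Hi.
change (Rabs (exp (- (c * T)) - 0) < eps)%R; rewrite Rminus_0_r, Rabs_pos_eq
  by (left; apply exp_pos).
rewrite exp_Ropp; pose proof (exp_ineq1_le (c * T)) as H1.
assert (H2 : (/ eps < c * T)%R).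
{ apply (Rmult_lt_compat_l c) in HT; [ | exact Hc ].
  replace (c * / (c * eps))%R with (/ eps)%R in HT by (field; lra); exact HT. }
rewrite <- (Rinv_inv eps); pose proof (Rinv_0_lt_compat _ He).
apply Rinv_lt_contravar; [ apply Rmult_lt_0_compat; [ assumption | apply exp_pos ] | lra ].
Qed.

Lemma infprod_to_1 (f : R -> nat -> C) (P : R -> C) (c : R) : (0 < c)%R ->
  (forall T n, (0 < T)%R -> (1 <= n)%nat ->
     (Cmod (f T n - 1) <= exp (- (c * (INR n + T))))%R) ->
  (forall T, (0 < T)%R -> seqlim (Cprod (f T)) (P T)) ->
  filterlim P (Rbar_locally p_infty) (locally (RtoC 1)).
Proof.
intros Hc Hf HP; set (A := (4 / c ^ 2)%R).
assert (HA : (0 <= A)%R)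
  by (apply Rdiv_le_0_compat; [ lra | apply pow_lt, Hc ]).
apply (clim_squeeze _ _ _ (fun T => exp (2 * (A * exp (- (c * T)))) - 1)%R).
- apply (Rbar_p_infty_le _ 0); intros T HT.
  apply (clim_Cmod_le eventually _ _ _ _ (HP T HT)); exists O; intros n _.
  apply Cprod_sub_1; [ apply Rmult_le_pos; [ exact HA | left; apply exp_pos ] | ].
  intros k Hk; eapply Rle_trans; [ apply Hf; assumption | ].
  pose proof (INR_pos k Hk).
  replace (- (c * (INR k + T)))%R with (- (c * T) + - (c * INR k))%R by ring.
  rewrite exp_plus; unfold Rdiv; rewrite (Rmult_comm A), Rmult_assoc.
  apply Rmult_le_compat_l; [ left; apply exp_pos | ].
  eapply Rle_trans; [ apply exp_neg_le_inv_sqr; nra | apply Req_le; unfold A; field; lra ].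
- replace 0%R with (exp (2 * (A * 0)) - 1)%R
    by (rewrite !Rmult_0_r, exp_0; ring).
  apply (rlim_minus _); [ apply (rlim_cont _ _ exp); [ apply continuous_exp | ]
    | apply filterlim_const ].
  apply (rlim_mult _); [ apply filterlim_const | apply (rlim_mult _) ].
  + apply filterlim_const.
  + apply lim_exp_neg, Hc.
Qed.

Lemma disp_1_real (T : R) (n : nat) : (0 < T)%R ->
  disp 1 (RtoC T) n = RtoC (sqrt (INR n * INR n + T * T)).
Proof.
intros HT; assert (Hp : (0 < INR n * INR n + T * T)%R) by nra.
apply Csqrt_unique.
- rewrite <- RtoC_mult, sqrt_sqrt by lra; rewrite RtoC_plus, !RtoC_mult; ring.
- simpl; apply sqrt_lt_R0, Hp.
Qed.

Lemma factor_scaled_1 (x1 x2 : C) (T : R) (n : nat) :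
  (0 < Re x1)%R -> (0 < Re x2)%R -> (0 < Re (x1 / x2))%R -> (0 < T)%R ->
  Re (- (2 * PI / x2) * disp x1 (RtoC T * x2) n)
  = (- (2 * PI * Re (disp (x1 / x2) (RtoC T) n)))%R.
Proof.
intros H1 H2 Ht HT; rewrite disp_scal by assumption.
set (d := disp (x1 / x2) (RtoC T) n).
replace (- (2 * PI / x2) * (x2 * d)) with (RtoC (- (2 * PI)) * d)
  by (rewrite RtoC_opp, RtoC_mult; field; apply Re_gt_0_neq_0, H2).
rewrite Re_mult; change (Re (RtoC (- (2 * PI)))) with (- (2 * PI))%R.
change (Im (RtoC (- (2 * PI)))) with 0%R; ring.
Qed.

Lemma factor_scaled_2 (x1 x2 : C) (T : R) (n : nat) :
  (0 < Re x1)%R -> (0 < Re x2)%R -> (0 < T)%R ->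
  Re (- (2 * PI / x1) * disp x2 (RtoC T * x2) n)
  = (- (2 * PI * Re (x2 / x1) * Re (disp 1 (RtoC T) n)))%R.
Proof.
intros H1 H2 HT; pose proof (Re_gt_0_neq_0 _ H1); pose proof (Re_gt_0_neq_0 _ H2).
assert (E : x2 / x2 = 1) by (field; assumption).
rewrite disp_scal by (rewrite ?E; simpl; assumption || lra); rewrite E, disp_1_real by exact HT.
set (d := sqrt (INR n * INR n + T * T)).
replace (- (2 * PI / x1) * (x2 * RtoC d)) with (RtoC (- (2 * PI * d)) * (x2 / x1))
  by (rewrite RtoC_opp, !RtoC_mult; field; assumption).
rewrite Re_mult; change (Re (RtoC (- (2 * PI * d)))) with (- (2 * PI * d))%R.
change (Im (RtoC (- (2 * PI * d)))) with 0%R; change (Re (RtoC d)) with d; ring.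
Qed.

(** [disp_prod_sqr] determines the square of the expression, which tends to 1; the sign is the
    issue. It is settled by connectedness: [Re (Z T)] never vanishes for [T > 0], and
    [Z 0 = Csqrt (1 / t)] has positive real part. *)
Lemma disp_prod_asymp (t : C) : (0 < Re t)%R ->
  filterlim (fun T => Csqrt (1 / t) * disp_prod t (RtoC T)
                      * Cexp (- (PI * RtoC T / (2 * t))) * RtoC (sqrt (2 * PI * T)))
    (Rbar_locally p_infty) (locally (RtoC 1)).
Proof.
intros Ht; pose proof (Re_gt_0_neq_0 _ Ht) as Ht0; pose proof PI_RGT_0 as HPI.
pose proof RtoC_PI_neq_0 as HPC.
assert (Hi : (0 < Re (1 / t))%R).
{ replace (1 / t) with (/ t) by (field; exact Ht0); apply Re_inv_pos, Ht. }
set (Z := fun T => Csqrt (1 / t) * disp_prod t (RtoC T) * Cexp (- (PI * RtoC T / (2 * t)))).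
assert (HZ0 : Z 0%R = Csqrt (1 / t)).
{ unfold Z; rewrite disp_prod_0 by exact Ht.
  replace (- (PI * 0 / (2 * t))) with (RtoC 0) by (field; exact Ht0).
  rewrite Cexp_0; ring. }
assert (HZ2 : forall T, (0 < T)%R ->
   Z T * Z T * RtoC (2 * PI * T) = 1 - Cexp (- (2 * PI * RtoC T / t))).
{ intros T HT.
  assert (HTC : RtoC T <> 0) by (apply RtoC_neq_0; lra).
  pose proof (disp_prod_sqr t (RtoC T) Ht) as HD.
  pose proof (Csqrt_sqr (1 / t)) as Hs.
  transitivity (Csqrt (1 / t) * Csqrt (1 / t)
     * (disp_prod t (RtoC T) * disp_prod t (RtoC T))
     * (Cexp (- (PI * RtoC T / (2 * t))) * Cexp (- (PI * RtoC T / (2 * t)))) * RtoC (2 * PI * T)).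
  { unfold Z; ring. }
  rewrite Hs, <- Cexp_plus.
  replace (- (PI * RtoC T / (2 * t)) + - (PI * RtoC T / (2 * t)))
    with (- (PI * RtoC T / t)) by (field; exact Ht0).
  transitivity (2 * (PI * RtoC T / t * (disp_prod t (RtoC T) * disp_prod t (RtoC T)))
      * Cexp (- (PI * RtoC T / t))).
  { rewrite !RtoC_mult; field; exact Ht0. }
  rewrite <- HD; unfold Csinh; set (z := PI * RtoC T / t).
  replace (- (2 * PI * RtoC T / t)) with (- z + - z) by (unfold z; field; exact Ht0).
  rewrite Cexp_plus, Cexp_opp; field; apply Cexp_neq_0. }
assert (Hq : forall T, Cmod (Cexp (- (2 * PI * RtoC T / t))) = exp (- (2 * PI * Re (1 / t) * T))).
{ intros T; rewrite Cmod_Cexp; f_equal.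
  replace (- (2 * PI * RtoC T / t)) with (RtoC (- (2 * PI * T)) * (1 / t))
    by (rewrite RtoC_opp, !RtoC_mult; field; exact Ht0).
  rewrite Re_mult; change (Re (RtoC (- (2 * PI * T)))) with (- (2 * PI * T))%R.
  change (Im (RtoC (- (2 * PI * T)))) with 0%R; ring. }
(* If [Z T] were purely imaginary, [Z T ^ 2 * 2 PI T] would be nonpositive, whereas [1 - Cexp (...)]
   has positive real part. *)
assert (HZre : forall T, (0 < T)%R -> Re (Z T) <> 0%R).
{ intros T HT E.
  assert (HT2 : (0 < 2 * PI * T)%R) by (apply Rmult_lt_0_compat; lra).
  pose proof (f_equal Re (HZ2 T HT)) as H.
  rewrite Re_mult, Re_mult, Im_mult, E in H.
  change (Re (RtoC (2 * PI * T))) with (2 * PI * T)%R in H.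
  change (Im (RtoC (2 * PI * T))) with 0%R in H.
  change (Re (1 - Cexp (- (2 * PI * RtoC T / t))))
    with (1 - Re (Cexp (- (2 * PI * RtoC T / t))))%R in H.
  pose proof (Re_le_Cmod (Cexp (- (2 * PI * RtoC T / t)))) as H1; rewrite Hq in H1.
  assert (H2 : (exp (- (2 * PI * Re (1 / t) * T)) < 1)%R).
  { apply Rlt_le_trans with (exp 0); [ apply exp_increasing | rewrite exp_0; lra ].
    rewrite <- Ropp_0; apply Ropp_lt_contravar.
    apply Rmult_lt_0_compat; [ apply Rmult_lt_0_compat; [ lra | exact Hi ] | exact HT ]. }
  assert (0 <= Im (Z T) * Im (Z T) * (2 * PI * T))%R by (apply Rmult_le_pos; nra).
  lra. }
assert (HZc : forall T, filterlim Z (locally T) (locally (Z T))).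
{ intros T; apply (clim_mult (locally T)); [ apply (clim_mult (locally T)) | ].
  - apply filterlim_const.
  - assert (Hc : continuous_on (fun _ => True) (fun s => disp_prod t (RtoC s))).
    { apply disp_prod_continuous_on; [ exact Ht | | ].
      - intros s _; apply (clim_RtoC _), filterlim_within, filterlim_id.
      - intros n Hn s _; apply filterlim_within.
        apply (clim_Csqrt (locally s) (fun u => t ^ 2 * INR n ^ 2 + RtoC u ^ 2)).
          * intros E1 E2; exfalso; pose proof (INR_pos n Hn) as Hn1.
            unfold Re, Im in *; simpl in *; ring_simplify in E1; ring_simplify in E2.
            assert (E3 : (snd t * (INR n * INR n) = 0)%R) by nra.
            assert (E4 : (snd t = 0)%R) by (destruct (Rmult_integral _ _ E3); nra).
            rewrite E4 in E2; nra.
          * apply (clim_plus _); [ apply filterlim_const | ].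
            simpl; apply (clim_mult _); [ | apply (clim_mult _); [ | apply filterlim_const ] ];
            apply (clim_RtoC _), filterlim_id. }
    pose proof (Hc T I) as H; revert H; apply filterlim_filter_le_1.
    intros Q HQ; unfold within in HQ; revert HQ; apply filter_imp; auto.
  - apply (clim_Cexp _); unfold Cdiv; apply (clim_opp _), (clim_mult _);
      [ | apply filterlim_const ].
    apply (clim_mult _); [ apply filterlim_const | apply (clim_RtoC _), filterlim_id ]. }
assert (HZpos : forall T, (0 < T)%R -> (0 < Re (Z T))%R).
{ intros T HT; apply Rnot_le_lt; intros Hle.
  destruct (IVT_cor (fun s => Re (Z s)) 0 T) as [z [Hz1 Hz2]].
  - intros s; apply continuity_pt_filterlim.
    apply (clim_split (locally s) Z (Z s)), HZc.
  - lra.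
  - rewrite HZ0; pose proof (Re_Csqrt_ge_0 (1 / t)); nra.
  - destruct (Rtotal_order z 0) as [Hz | [Hz | Hz]]; [ lra | | exact (HZre z Hz Hz2) ].
    rewrite Hz, HZ0 in Hz2.
    pose proof (Re_Csqrt_pos (1 / t) (fun _ => Hi)); lra. }
apply (clim_squeeze _ _ _ (fun T => exp (- (2 * PI * Re (1 / t) * T)))).
- apply (Rbar_p_infty_le _ 0); intros T HT.
  set (q := sqrt (2 * PI * T)); change (Cmod (Z T * RtoC q - 1) <= exp (- (2 * PI * Re (1 / t) * T)))%R.
  assert (HT2 : (0 < 2 * PI * T)%R) by (apply Rmult_lt_0_compat; lra).
  assert (Hqp : (0 < q)%R) by (apply sqrt_lt_R0, HT2).
  (* The second factor has modulus at least 1 as [Re (Z T) > 0], so the first is exponentially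
     small. *)
  assert (HY : (Z T * RtoC q - 1) * (Z T * RtoC q + 1) = - Cexp (- (2 * PI * RtoC T / t))).
  { transitivity (Z T * Z T * RtoC (q * q) - 1); [ rewrite RtoC_mult; ring | ].
    unfold q; rewrite sqrt_sqrt, HZ2 by lra; ring. }
  apply (f_equal Cmod) in HY; rewrite Cmod_mult, Cmod_opp, Hq in HY.
  rewrite <- HY.
  assert (H1 : (1 <= Cmod (Z T * RtoC q + 1))%R).
  { eapply Rle_trans; [ | apply Re_le_Cmod ].
    change (Re (Z T * RtoC q + 1)) with (Re (Z T * RtoC q) + 1)%R.
    rewrite Re_mult; change (Re (RtoC q)) with q; change (Im (RtoC q)) with 0%R.
    pose proof (HZpos T HT); nra. }
  pose proof (Cmod_ge_0 (Z T * RtoC q - 1)); nra.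
- apply lim_exp_neg, Rmult_lt_0_compat; [ lra | exact Hi ].
Qed.

(** Local injectivity of exp at 0, quantitatively: for [Cmod z <= 1/24] the quadratic error
    [4 * 3 * (Cmod z)^2] is at most half of [Cmod z]. *)
Lemma Cexp_sub_1_ge (z : C) : (Cmod z <= 1/24)%R ->
  (Cmod z / 2 <= Cmod (Cexp z - 1))%R.
Proof.
intros Hz; pose proof (Cexp_sub_1_sub_le z) as H; pose proof (Cmod_ge_0 z) as H0.
assert (He : (exp (Cmod z) <= 3)%R).
{ eapply Rle_trans; [ apply exp_le | apply exp_le_3 ]; lra. }
pose proof (Cmod_triangle (Cexp z - 1) (- (Cexp z - 1 - z))) as H1.
rewrite Cmod_opp in H1; replace (Cexp z - 1 + - (Cexp z - 1 - z)) with z in H1 by ring.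
assert (H2 : (Cmod z * Cmod z * exp (Cmod z) <= Cmod z * (1/24) * 3)%R).
{ apply Rmult_le_compat; [ nra | left; apply exp_pos | nra | exact He ]. }
lra.
Qed.

(** Differences of the exponents lie in the disc of radius [2 / 48 = 1/24], where [Cexp_sub_1_ge]
    bounds them by differences of the exponentials. *)
Lemma Cexp_seq_cv (z : nat -> C) (g : C) :
  (forall N, (1 <= N)%nat -> (Cmod (z N) <= 1/48)%R) ->
  seqlim (fun N => Cexp (z N)) g ->
  exists l : C, seqlim z l.
Proof.
intros Hz Hg; apply Ccauchy_cv; intros eps Heps.
(* [8 = 2 * 2 * 2]: two terms of the Cauchy difference, [Cmod (Cexp b) >= 1/2], and the 1/2 of
   [Cexp_sub_1_ge]. *)
destruct (proj1 (clim_eps eventually _ _) Hg (eps / 8)%R ltac:(lra)) as [N0 HN0].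
exists (S N0); intros n Hn.
pose proof (Hz n ltac:(lia)) as Hn1; pose proof (Hz (S N0) ltac:(lia)) as Hm1.
set (b := z (S N0)) in *; set (a := z n) in *.
assert (H1 : (Cmod (a - b) <= 1/24)%R).
{ eapply Rle_trans; [ apply Cmod_triangle | rewrite Cmod_opp; lra ]. }
apply Cexp_sub_1_ge in H1.
assert (H2 : (1/2 <= Cmod (Cexp b))%R).
{ rewrite Cmod_Cexp; pose proof (exp_ineq1_le (Re b)).
  pose proof (re_le_Cmod b) as Hb; apply Rabs_le_between in Hb; lra. }
assert (E : Cexp a - Cexp b = Cexp b * (Cexp (a - b) - 1)).
{ rewrite Cexp_minus; field; apply Cexp_neq_0. }
assert (H3 : (Cmod (Cexp a - Cexp b) < eps / 4)%R).
{ pose proof (HN0 n ltac:(lia)) as F1; pose proof (HN0 (S N0) ltac:(lia)) as F2.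
  fold a in F1; fold b in F2; cbv beta in F1, F2.
  replace (Cexp a - Cexp b) with ((Cexp a - g) + - (Cexp b - g)) by ring.
  eapply Rle_lt_trans; [ apply Cmod_triangle | rewrite Cmod_opp; lra ]. }
rewrite E, Cmod_mult in H3.
pose proof (Cmod_ge_0 (Cexp (a - b) - 1)); nra.
Qed.

(** In the variable [T^2], a shift by [h] multiplies the function by [Cexp (h kappa)] without
    changing its nonzero limit, so [Cexp (h kappa) = 1] for all [h > 0]. *)
Lemma Cexp_limit_const (K kappa L : C) : L <> 0 ->
  filterlim (fun T => K * Cexp (RtoC (T * T)%R * kappa)) (Rbar_locally p_infty) (locally L) ->
  kappa = 0 /\ K = L.
Proof.
intros HL H.
assert (HK : kappa = 0).
{ destruct (Ceq_dec kappa 0) as [E | Hk]; [ exact E | exfalso ].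
  pose proof (proj1 (Cmod_gt_0 _) Hk) as Hkm.
  (* Puts [h kappa] on the circle of radius 1/24, where [Cexp_sub_1_ge] excludes the value 1. *)
  set (h := (/ (24 * Cmod kappa))%R).
  assert (Hh : (0 < h)%R) by (apply Rinv_0_lt_compat; lra).
  assert (Hlim : forall d, (0 <= d)%R -> filterlim (fun t => K * Cexp (RtoC (t + d)%R * kappa))
     (Rbar_locally p_infty) (locally L)).
  { intros d Hd; apply (clim_eps _); intros eps Heps.
    destruct (proj1 (clim_eps _ _ _) H eps Heps) as [M HM].
    exists (M * M + 1)%R; intros t Ht.
    assert (Htd : (0 <= t + d)%R) by nra.
    rewrite <- (sqrt_sqrt (t + d)) by exact Htd; apply (HM (sqrt (t + d))).
    apply Rnot_le_lt; intros Hle.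
    pose proof (sqrt_pos (t + d)) as Hs0; pose proof (sqrt_sqrt (t + d) Htd); nra. }
  pose proof (Hlim 0%R ltac:(lra)) as L0; pose proof (Hlim h ltac:(lra)) as Lh.
  assert (E : Cexp (RtoC h * kappa) * L = L).
  { apply (clim_unique (Rbar_locally p_infty) (fun t => K * Cexp (RtoC (t + h)%R * kappa)));
      [ | exact Lh ].
    eapply filterlim_ext; [ | apply (clim_mult _ (fun _ => Cexp (RtoC h * kappa)));
      [ apply filterlim_const | exact L0 ] ].
    intros t; cbv beta; rewrite Rplus_0_r, RtoC_plus.
    replace ((RtoC t + RtoC h) * kappa) with (RtoC t * kappa + RtoC h * kappa) by ring.
    rewrite Cexp_plus; ring. }
  assert (E1 : Cexp (RtoC h * kappa) - 1 = 0).
  { replace (Cexp (RtoC h * kappa) - 1) with ((Cexp (RtoC h * kappa) * L - L) / L)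
      by (field; exact HL).
    rewrite E; field; exact HL. }
  assert (Em : Cmod (RtoC h * kappa) = (1/24)%R).
  { rewrite Cmod_mult, Cmod_R, Rabs_pos_eq by lra; unfold h; field; lra. }
  pose proof (Cexp_sub_1_ge (RtoC h * kappa) ltac:(lra)) as H1.
  rewrite E1, Cmod_0, Em in H1; lra. }
split; [ exact HK | ].
apply (clim_unique (Rbar_locally p_infty) (fun _ : R => K)); [ apply filterlim_const | ].
eapply filterlim_ext; [ | exact H ].
intros T; rewrite HK, Cmult_0_r, Cexp_0; ring.
Qed.

Lemma disp_prod_scal (x y : C) (T : R) :
  (0 < Re x)%R -> (0 < Re y)%R -> (0 < Re (x / y))%R -> (0 < T)%R ->
  disp_prod x (RtoC T * y) = disp_prod (x / y) (RtoC T).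
Proof.
intros Hx Hy Ht HT; apply Clim_correct.
pose proof (proj1 (disp_prod_infprod (x / y) (RtoC T) Ht)) as H.
eapply filterlim_ext; [ | exact H ]; intros n; apply Cprod_ext; intros k Hk.
rewrite disp_scal by assumption; field; repeat split;
  (apply Re_gt_0_neq_0; assumption) || (apply INR_C_neq_0; lia).
Qed.

Lemma factor_neq_0 (x y w : C) (n : nat) :
  (Re (- (2 * PI / y) * disp x w n) < 0)%R -> factor x y w n <> 0.
Proof.
intros H E; pose proof (Cmod_factor_sub_1 x y w n) as H1; rewrite E in H1.
replace (0 - 1) with (Copp 1) in H1 by ring; rewrite Cmod_opp, Cmod_1 in H1.
apply exp_increasing in H; rewrite exp_0 in H; lra.
Qed.

Lemma Csqrt_1 : Csqrt 1 = 1.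
Proof. apply Csqrt_unique; [ ring | simpl; lra ]. Qed.

(** On the ray, [product_ratio_limit] leaves two unknowns, the limit of [sigma] and [P10 / P20]. The
    factor [Csqrt (x2 / x1)] stems from the asymptotics of [disp_prod] for the parameters [t] and
    1. *)
Theorem product_constants (x1 x2 P10 P20 : C) :
  (0 < Re x1)%R -> (0 < Re x2)%R -> (0 < Re (x1 / x2))%R ->
  is_infprod (factor x1 x2 0) P10 -> is_infprod (factor x2 x1 0) P20 ->
  seqlim (sigma x1 x2) (PI * Clog (x1 / x2) / (2 * x1 * x2)) /\
  P10 = P20 * Csqrt (x2 / x1) * Cexp (PI / 12 * (x1 / x2 - x2 / x1)).
Proof.
intros H1 H2 Ht L10 L20; pose proof (Re_div_swap _ _ H1 H2 Ht) as Ht'.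
pose proof (Re_gt_0_neq_0 _ H1) as N1; pose proof (Re_gt_0_neq_0 _ H2) as N2.
pose proof (Re_gt_0_neq_0 _ Ht) as Nt; pose proof PI_RGT_0 as HPI.
assert (Hone : (0 < Re 1)%R) by (simpl; lra).
assert (E22 : x2 / x2 = 1) by (field; exact N2).
assert (N10 : P10 <> 0).
{ apply (is_infprod_neq_0 _ _ L10); intros n Hn; apply factor_w0_neq_0; assumption. }
assert (N20 : P20 <> 0).
{ apply (is_infprod_neq_0 _ _ L20); intros n Hn; apply factor_w0_neq_0; assumption. }
set (t := x1 / x2) in *.
set (P1 := fun T => Clim (Cprod (factor x1 x2 (RtoC T * x2)))).
set (P2 := fun T => Clim (Cprod (factor x2 x1 (RtoC T * x2)))).
set (s := fun T => Clim (Csum (summand x1 x2 (RtoC T * x2)))).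
assert (HP1 : forall T, is_infprod (factor x1 x2 (RtoC T * x2)) (P1 T)).
{ intros T; destruct (factor_infprod x1 x2 (RtoC T * x2) H1 N2 Ht) as [P HP].
  unfold P1; rewrite (Clim_correct _ _ (proj1 HP)); exact HP. }
assert (HP2 : forall T, is_infprod (factor x2 x1 (RtoC T * x2)) (P2 T)).
{ intros T; destruct (factor_infprod x2 x1 (RtoC T * x2) H2 N1 Ht') as [P HP].
  unfold P2; rewrite (Clim_correct _ _ (proj1 HP)); exact HP. }
assert (Hs : forall T, seqlim (Csum (summand x1 x2 (RtoC T * x2))) (s T)).
{ intros T; destruct (summand_le x1 x2 (RtoC T * x2) H1 H2) as [K [HK HB]].
  destruct (Csum_cv _ K HK HB) as [l Hl]; unfold s; rewrite (Clim_correct _ _ Hl); exact Hl. }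
destruct (Re_disp_lower t Ht) as [c [Hc HcB]].
destruct (Re_disp_lower 1 Hone) as [c1 [Hc1 HcB1]].
assert (LP1 : filterlim P1 (Rbar_locally p_infty) (locally (RtoC 1))).
{ apply (infprod_to_1 (fun T => factor x1 x2 (RtoC T * x2)) _ (2 * PI * c)).
  - apply Rmult_lt_0_compat; lra.
  - intros T n HT Hn; rewrite Cmod_factor_sub_1, factor_scaled_1 by assumption.
    apply exp_le, Ropp_le_contravar; rewrite (Rmult_assoc _ c).
    apply Rmult_le_compat_l; [ lra | apply HcB, HT ].
  - intros T HT; apply HP1. }
assert (Hcc : (0 < 2 * PI * Re (x2 / x1))%R)
  by (apply Rmult_lt_0_compat; [ lra | exact Ht' ]).
assert (LP2 : filterlim P2 (Rbar_locally p_infty) (locally (RtoC 1))).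
{ apply (infprod_to_1 (fun T => factor x2 x1 (RtoC T * x2)) _ (2 * PI * Re (x2 / x1) * c1)).
  - apply Rmult_lt_0_compat; assumption.
  - intros T n HT Hn; rewrite Cmod_factor_sub_1, factor_scaled_2 by assumption.
    apply exp_le, Ropp_le_contravar; rewrite (Rmult_assoc _ c1).
    apply Rmult_le_compat_l; [ lra | apply HcB1, HT ].
  - intros T HT; apply HP2. }
assert (NP2 : forall T, (0 < T)%R -> P2 T <> 0).
{ intros T HT; apply (is_infprod_neq_0 _ _ (HP2 T)); intros n Hn; apply factor_neq_0.
  rewrite factor_scaled_2 by assumption.
  rewrite <- Ropp_0; apply Ropp_lt_contravar, Rmult_lt_0_compat; [ exact Hcc | ].
  eapply Rlt_le_trans; [ | apply HcB1, HT ].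
  apply Rmult_lt_0_compat; [ exact Hc1 | pose proof (pos_INR n); lra ]. }
assert (ND : forall u T, (0 < Re u)%R -> (0 < T)%R -> disp_prod u (RtoC T) <> 0).
{ intros u T Hu HT; apply disp_prod_neq_0; [ exact Hu | intros n Hn ].
  rewrite disp_em_F; apply em_F_neq_0; assumption. }
assert (HG : forall T, (0 < T)%R ->
  seqlim (fun N => Cexp (RtoC (T * T)%R * (x2 * x2 * sigma x1 x2 N))) (P1 T * P20 * disp_prod 1 (RtoC T)
     / (P2 T * P10 * disp_prod t (RtoC T) * Cexp (PI * s T)))).
{ intros T HT.
  pose proof (product_ratio_limit x1 x2 (RtoC T * x2) (P1 T) (P2 T) P10 P20 (s T) H1 H2 Ht
    (proj1 (HP1 T)) (proj1 (HP2 T)) (proj1 L10) (proj1 L20) (Hs T)) as H.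
  rewrite !disp_prod_scal in H by (rewrite ?E22; assumption).
  rewrite E22 in H; fold t in H.
  set (X := P2 T * P10 * disp_prod t (RtoC T) * Cexp (PI * s T)) in *.
  assert (NX : X <> 0).
  { unfold X; repeat apply Cmult_neq_0; auto using Cexp_neq_0. }
  eapply filterlim_ext; [ | apply (clim_div eventually _ (fun _ => X) _ X NX H);
    apply filterlim_const ].
  intros N; cbv beta.
  replace (RtoC (T * T)%R * (x2 * x2 * sigma x1 x2 N))
    with (RtoC T * x2 * (RtoC T * x2) * sigma x1 x2 N) by (rewrite RtoC_mult; ring).
  field; exact NX. }
(* sigma_N converges because exp (T0^2 x2^2 sigma_N) does, for T0 so small that all
   exponents lie in a disc on which exp has a Lipschitz inverse. *)
assert (HS : exists S : C, seqlim (sigma x1 x2) S).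
{ destruct (sigma_bounded x1 x2 H1 H2 Ht) as [B HB].
  pose proof (Cmod_ge_0 x2) as Hx2.
  assert (HB0 : (0 <= B)%R).
  { eapply Rle_trans; [ apply Cmod_ge_0 | apply (HB 1%nat); lia ]. }
  set (D := (48 * (Cmod x2 * Cmod x2 * B + 1))%R).
  assert (HD : (48 <= D)%R) by (unfold D; assert (0 <= Cmod x2 * Cmod x2 * B)%R by
    (repeat apply Rmult_le_pos; assumption); lra).
  set (T0 := sqrt (/ D)).
  assert (HDi : (0 < / D)%R) by (apply Rinv_0_lt_compat; lra).
  assert (HT0 : (0 < T0)%R) by (apply sqrt_lt_R0, HDi).
  assert (ET0 : (T0 * T0 = / D)%R) by (apply sqrt_sqrt; lra).
  assert (HZ : forall N, (1 <= N)%nat ->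
    (Cmod (RtoC (T0 * T0)%R * (x2 * x2 * sigma x1 x2 N)) <= 1 / 48)%R).
  { intros N HN; rewrite ET0, !Cmod_mult, Cmod_R, Rabs_pos_eq by lra.
    apply (Rmult_le_reg_l D); [ lra | rewrite <- Rmult_assoc, Rinv_r, Rmult_1_l by lra ].
    apply Rle_trans with (Cmod x2 * Cmod x2 * B)%R.
    + apply Rmult_le_compat_l; [ nra | apply HB, HN ].
    + unfold D; lra. }
  destruct (Cexp_seq_cv _ _ HZ (HG T0 HT0)) as [l Hl].
  - assert (Nc : RtoC (T0 * T0)%R * (x2 * x2) <> 0).
    { repeat apply Cmult_neq_0; try assumption.
      apply RtoC_neq_0; nra. }
    exists (l / (RtoC (T0 * T0)%R * (x2 * x2))).
    eapply filterlim_ext; [ | apply (clim_div eventually _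
      (fun _ => RtoC (T0 * T0)%R * (x2 * x2)) _ _ Nc Hl); apply filterlim_const ].
    intros N; cbv beta; field; split; [ exact N2 | ].
    intros E; apply Nc; rewrite E; ring. }
destruct HS as [S HS].
assert (HE : forall T, (0 < T)%R ->
  Cexp (RtoC (T * T)%R * (x2 * x2 * S)) = P1 T * P20 * disp_prod 1 (RtoC T)
     / (P2 T * P10 * disp_prod t (RtoC T) * Cexp (PI * s T))).
{ intros T HT; eapply (clim_unique eventually); [ | exact (HG T HT) ].
  apply (clim_Cexp eventually); repeat (apply (clim_mult eventually);
    [ apply filterlim_const | ]); exact HS. }
(* [kappa] is [x2^2] times the deviation of [S] from the claimed limit, and [L] is the claimed value
   of [P10 / P20]. *)
set (kappa := x2 * x2 * S - PI * Clog t / (2 * t)).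
set (L := Csqrt (1 / t) * Cexp (- (PI / 12 * (1 / t - t)))).
pose proof (summand_asymp x1 x2 s H1 H2 Ht (fun T _ => Hs T)) as LA.
cbv zeta in LA; fold t in LA.
set (e := fun T => s T - (- (RtoC (T * T)%R / (2 * t)) * Clog t
      + RtoC T / 2 * (1 - 1 / t) + (1 / t - t) / 12)) in LA.
set (Y := fun u T => Csqrt (1 / u) * disp_prod u (RtoC T)
                      * Cexp (- (PI * RtoC T / (2 * u))) * RtoC (sqrt (2 * PI * T))).
assert (LY : forall u, (0 < Re u)%R ->
   filterlim (Y u) (Rbar_locally p_infty) (locally (RtoC 1))) by (intros u Hu; apply disp_prod_asymp, Hu).
assert (E11 : 1 / 1 = RtoC 1) by (field; exact C1_nz).
assert (Ns : Csqrt (1 / t) <> 0).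
{ apply Csqrt_neq_0; intros E; apply C1_nz.
  replace (RtoC 1) with (1 / t * t) by (field; exact Nt); rewrite E; ring. }
assert (HLim : filterlim (fun T => P10 / P20 * Cexp (RtoC (T * T)%R * kappa))
   (Rbar_locally p_infty) (locally L)).
{ eapply filterlim_ext_loc with (f := fun T =>
    P1 T / P2 T * (Y 1 T / Y t T) * (Csqrt (1 / t) * Cexp (- (PI / 12 * (1 / t - t))))
    * Cexp (- (PI * e T))).
  - exists 0%R; intros T HT; unfold kappa.
    assert (Nq : RtoC (sqrt (2 * PI * T)) <> 0).
    { apply RtoC_neq_0, Rgt_not_eq, sqrt_lt_R0, Rmult_lt_0_compat; lra. }
    replace (RtoC (T * T)%R * (x2 * x2 * S - PI * Clog t / (2 * t)))
      with (RtoC (T * T)%R * (x2 * x2 * S) + - (RtoC (T * T)%R * (PI * Clog t / (2 * t)))) by ring.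
    rewrite Cexp_plus, HE by exact HT; unfold Y; rewrite E11, Csqrt_1.
    (* By the definition of [e], the part of [PI s] linear in [T] balances the exponentials that
       normalise [disp_prod]; its quadratic part is the logarithm in [kappa]. *)
    assert (ED : Cexp (- (PI * RtoC T / (2 * 1))) * Cexp (- (PI / 12 * (1 / t - t)))
        * Cexp (- (PI * e T)) * Cexp (PI * s T)
      = Cexp (- (PI * RtoC T / (2 * t))) * Cexp (- (RtoC (T * T)%R * (PI * Clog t / (2 * t))))).
    { rewrite <- !Cexp_plus; f_equal; unfold e; field; exact Nt. }
    transitivity (P1 T / P2 T * (disp_prod 1 (RtoC T) / disp_prod t (RtoC T))
       / (Cexp (- (PI * RtoC T / (2 * t))) * Cexp (PI * s T))
       * (Cexp (- (PI * RtoC T / (2 * 1))) * Cexp (- (PI / 12 * (1 / t - t)))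
          * Cexp (- (PI * e T)) * Cexp (PI * s T))).
    + field; repeat split; auto using Cexp_neq_0.
    + rewrite ED; field; repeat split; auto using Cexp_neq_0.
  - replace L with (1 / 1 * (1 / 1) * (Csqrt (1 / t) * Cexp (- (PI / 12 * (1 / t - t))))
      * Cexp (- (PI * 0))).
    2: { rewrite E11; replace (- (PI * 0)) with (RtoC 0) by ring; rewrite Cexp_0; unfold L; ring. }
    apply (clim_mult _); [ apply (clim_mult _); [ apply (clim_mult _) | apply filterlim_const ] | ].
    + apply (clim_div _); [ exact C1_nz | exact LP1 | exact LP2 ].
    + apply (clim_div _); [ exact C1_nz | apply LY, Hone | apply LY, Ht ].
    + apply (clim_Cexp _), (clim_opp _), (clim_mult _); [ apply filterlim_const | exact LA ]. }
assert (NL : L <> 0) by (unfold L; apply Cmult_neq_0; [ exact Ns | apply Cexp_neq_0 ]).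
destruct (Cexp_limit_const _ _ _ NL HLim) as [Hk HK].
split.
- assert (ES : S = PI * Clog t / (2 * x1 * x2)).
  { transitivity ((kappa + PI * Clog t / (2 * t)) / (x2 * x2));
      [ unfold kappa; field; split; assumption | rewrite Hk ].
    set (l := Clog t); unfold t; field; split; assumption. }
  rewrite <- ES; exact HS.
- replace P10 with (P10 / P20 * P20) by (field; exact N20).
  rewrite HK; unfold L, t.
  replace (1 / (x1 / x2)) with (x2 / x1) by (field; split; assumption).
  replace (- (PI / 12 * (x2 / x1 - x1 / x2))) with (PI / 12 * (x1 / x2 - x2 / x1)) by ring.
  ring.
Qed.

(** * A path from 0 to w *)

Lemma finite_gap (f : nat -> R) (r : R) (M : nat) :
  (forall n, (M <= n)%nat -> (r <= f n \/ f n <= r - 1)%R) ->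
  exists g, (0 < g)%R /\ forall n, (f n < r)%R -> (f n <= r - g)%R.
Proof.
intros H.
assert (HM : forall m, exists g, (0 < g)%R /\ forall n, (n < m)%nat ->
          (f n < r)%R -> (f n <= r - g)%R).
{ induction m as [ | m [g [Hg IH]]].
  - exists 1%R; split; [ lra | intros n Hn; lia ].
  - destruct (Rlt_le_dec (f m) r) as [Hm | Hm].
    + exists (Rmin g (r - f m)); split; [ apply Rmin_pos; lra | intros n Hn Hf ].
      pose proof (Rmin_l g (r - f m)); pose proof (Rmin_r g (r - f m)).
      destruct (Nat.eq_dec n m) as [-> | Hne]; [ lra | ].
      specialize (IH n ltac:(lia) Hf); lra.
    + exists g; split; [ exact Hg | intros n Hn Hf ].
      destruct (Nat.eq_dec n m) as [-> | Hne]; [ lra | apply IH; [ lia | exact Hf ] ]. }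
destruct (HM M) as [g [Hg HgM]].
exists (Rmin g 1); split; [ apply Rmin_pos; lra | intros n Hn ].
pose proof (Rmin_l g 1); pose proof (Rmin_r g 1).
destruct (Nat.lt_ge_cases n M) as [Hl | Hl].
- specialize (HgM n Hl Hn); lra.
- destruct (H n Hl); lra.
Qed.

(** With [b = Im (x^2)] and [r = - Im z]: the cuts in the plane of w^2 lie at the heights [- b n^2],
    a discrete set, so a strip just above the height of [z] contains none of them. The index [n = 0]
    covers the cut of the root of w^2 itself. *)
Lemma square_gap (b r : R) : exists g, (0 < g)%R /\
  forall n, (b * INR n ^ 2 < r)%R -> (b * INR n ^ 2 <= r - g)%R.
Proof.
destruct (Rtotal_order b 0) as [Hb | [-> | Hb]].
- destruct (archimed_nat ((1 - r) / - b)) as [M [HM1 HM]].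
  apply (finite_gap _ _ M); intros n Hn; right.
  apply le_INR in Hn; pose proof (INR_pos M HM1).
  apply (Rmult_lt_compat_l (- b)) in HM; [ | lra ].
  replace (- b * ((1 - r) / - b))%R with (1 - r)%R in HM by (field; lra).
  assert (INR M <= INR n ^ 2)%R by nra. nra.
- destruct (Rlt_le_dec 0 r) as [Hr | Hr].
  + exists r; split; [ exact Hr | intros n _; lra ].
  + exists 1%R; split; [ lra | intros n Hn; lra ].
- destruct (archimed_nat (r / b)) as [M [HM1 HM]].
  apply (finite_gap _ _ M); intros n Hn; left.
  apply le_INR in Hn; pose proof (INR_pos M HM1).
  apply (Rmult_lt_compat_l b) in HM; [ | lra ].
  replace (b * (r / b))%R with r in HM by (field; lra).
  assert (INR M <= INR n ^ 2)%R by nra. nra.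
Qed.

(* A path in the plane of w^2: for t <= 1/2 an arc from 0 to z + i eta that bulges to the
   right by about K, then straight down to z. *)
Definition path_u (z : C) (eta K t : R) : C :=
  let m := Rmin (2 * t) 1 in
  ((m * Re z + K * (m * (1 - m)))%R, (m * (Im z + eta) - eta * (2 * t - m))%R).

(** On the descent the path stays in the strip free of cuts, so [Im q] cannot vanish. On the arc it
    may cross the heights of cuts, and the bulge [K m (1 - m)] moves each crossing to the right of
    the branch point [- x^2 n^2]. *)
Lemma path_u_cut (x z : C) (eta : R) : (0 < Re x)%R ->
  (0 < eta)%R ->
  (forall n, Im (x * x) * INR n ^ 2 < - Im z ->
             Im (x * x) * INR n ^ 2 < - Im z - eta)%R ->
  exists K0, forall K t n, (K0 <= K)%R -> (0 <= t < 1)%R -> (1 <= n)%nat ->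
    let q := x ^ 2 * INR n ^ 2 + path_u z eta K t in
    Im q = 0%R -> (0 < Re q)%R.
Proof.
intros Hx Heta Hgap.
set (a := Re (x * x)) in *; set (b := Im (x * x)) in *.
set (h := (Im z + eta)%R).
assert (Hq : forall K t n, x ^ 2 * INR n ^ 2 + path_u z eta K t
   = ((a * INR n ^ 2 + Re (path_u z eta K t))%R, (b * INR n ^ 2 + Im (path_u z eta K t))%R)).
{ intros K t n; apply injective_projections; unfold a, b, Re, Im; simpl; ring. }
(* The gap at [n = 0]: with [Im z = - eta] it would read [0 < 0]. *)
assert (Hh : h <> 0%R).
{ intros E; specialize (Hgap O); simpl in Hgap; unfold h in E; lra. }
assert (Hb0 : b = 0%R -> (0 < a)%R).
{ unfold a, b; rewrite Re_mult, Im_mult; intros E.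
  assert (E2 : (Im x = 0)%R) by nra.
  rewrite E2; nra. }
assert (H2 : forall K t n, (1/2 <= t < 1)%R ->
   Im (x ^ 2 * INR n ^ 2 + path_u z eta K t) <> 0%R).
{ intros K t n Ht E; rewrite Hq in E; unfold path_u in E; simpl in E.
  rewrite Rmin_right in E by lra; specialize (Hgap n).
  simpl in Hgap; unfold Re, Im in *; nra. }
(* On the arc [Im q = 0] means [n^2 = m r]. The gap of the squares below [r] keeps [1 - m] above
   [g / r] uniformly in [n]; the factor [r / g] in [K0] lets [K (1 - m)] outweigh [r a + Re z]. *)
destruct (square_gap 1 (- h / b)) as [g [Hg Hgg]].
set (r := (- h / b)%R) in *.
set (K0 := ((Rabs (r * a) + Rabs (Re z) + 1) * Rabs r / g)%R).
exists K0; intros K t n HK Ht Hn q; unfold q.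
destruct (Rle_lt_dec (1/2) t) as [Ht2 | Ht2].
{ intros E; exfalso; apply (H2 K t n) in E; [ exact E | lra ]. }
set (m := (2 * t)%R).
assert (EI : Im (path_u z eta K t) = (m * h)%R).
{ change (Rmin (2 * t) 1 * (Im z + eta) - eta * (2 * t - Rmin (2 * t) 1) = m * h)%R.
  rewrite Rmin_left by lra; unfold m, h; ring. }
assert (ER : Re (path_u z eta K t) = (m * Re z + K * (m * (1 - m)))%R).
{ change (Rmin (2 * t) 1 * Re z + K * (Rmin (2 * t) 1 * (1 - Rmin (2 * t) 1))
          = m * Re z + K * (m * (1 - m)))%R.
  rewrite Rmin_left by lra; reflexivity. }
rewrite Hq, EI, ER.
change (b * INR n ^ 2 + m * h = 0 ->
        0 < a * INR n ^ 2 + (m * Re z + K * (m * (1 - m))))%R.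
clear EI ER; assert (Hm : (0 <= m < 1)%R) by (unfold m; lra); clearbody m; intros E.
pose proof (INR_pos n Hn) as Hn1.
assert (HN : (1 <= INR n ^ 2)%R) by (simpl; nra).
set (N := (INR n ^ 2)%R) in *.
destruct (Req_dec b 0) as [Eb | Nb].
- rewrite Eb, Rmult_0_l, Rplus_0_l in E.
  destruct (Rmult_integral _ _ E) as [-> | ]; [ | contradiction ].
  specialize (Hb0 Eb); nra.
- assert (EN : (N = m * r)%R) by (unfold r; field_simplify_eq; [ nra | exact Nb ]).
  assert (Hm0 : (0 < m)%R) by nra.
  assert (Hr : (0 < r)%R) by nra.
  assert (HNr : (1 * N < r)%R) by nra.
  specialize (Hgg n HNr); fold N in Hgg.
  (* [m r = n^2 <= r - g], so [r (1 - m) >= g] *)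
  assert (Hgm : (g <= r * (1 - m))%R) by nra.
  assert (HKg : (Rabs (r * a) + Rabs (Re z) + 1 <= K * (1 - m))%R).
  { assert (HK2 : ((Rabs (r * a) + Rabs (Re z) + 1) * r <= K * g)%R).
    { apply Rle_trans with (K0 * g)%R; [ | apply Rmult_le_compat_r; lra ].
      unfold K0; rewrite (Rabs_pos_eq r) by lra; apply Req_le; field; lra. }
    assert (HK0 : (0 <= K)%R).
    { pose proof (Rabs_pos (r * a)); pose proof (Rabs_pos (Re z)). nra. }
    apply (Rmult_le_reg_r r); [ exact Hr | nra ]. }
  pose proof (Rle_abs (- (r * a))) as A1; rewrite Rabs_Ropp in A1.
  pose proof (Rle_abs (- Re z)) as A2; rewrite Rabs_Ropp in A2.
  rewrite EN; replace (a * (m * r) + (m * Re z + K * (m * (1 - m))))%R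
    with (m * (r * a + Re z + K * (1 - m)))%R by ring.
  apply Rmult_lt_0_compat; lra.
Qed.

Lemma path_u_continuous (z : C) (eta K t : R) :
  filterlim (path_u z eta K) (locally t) (locally (path_u z eta K t)).
Proof.
assert (Hm : filterlim (fun s => Rmin (2 * s) 1)%R (locally t) (locally (Rmin (2 * t) 1)%R)).
{ apply filterlim_locally; intros eps; assert (He : (0 < eps / 2)%R)
    by (pose proof (cond_pos eps); lra).
  exists (mkposreal _ He); intros s Hs.
  assert (Hs' : (Rabs (s - t) < eps / 2)%R) by exact Hs.
  apply Rabs_def2 in Hs'.
  change (Rabs (Rmin (2 * s) 1 - Rmin (2 * t) 1) < eps)%R.
  apply Rabs_def1; unfold Rmin; destruct (Rle_dec (2 * s) 1), (Rle_dec (2 * t) 1); lra. }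
apply (clim_split (locally t)); split.
- change (filterlim (fun s => Rmin (2 * s) 1 * Re z
      + K * (Rmin (2 * s) 1 * (1 - Rmin (2 * s) 1)))%R (locally t)
    (locally (Rmin (2 * t) 1 * Re z + K * (Rmin (2 * t) 1 * (1 - Rmin (2 * t) 1)))%R)).
  apply (rlim_plus _); apply (rlim_mult _); try apply filterlim_const; [ exact Hm | ].
  apply (rlim_mult _); [ exact Hm | apply (rlim_minus _); [ apply filterlim_const | exact Hm ] ].
- change (filterlim (fun s => Rmin (2 * s) 1 * (Im z + eta) - eta * (2 * s - Rmin (2 * s) 1))%R
    (locally t) (locally (Rmin (2 * t) 1 * (Im z + eta) - eta * (2 * t - Rmin (2 * t) 1))%R)).
  apply (rlim_minus _); apply (rlim_mult _); try apply filterlim_const; [ exact Hm | ].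
  apply (rlim_minus _); [ | exact Hm ].
  apply (rlim_mult _); [ apply filterlim_const | apply filterlim_id ].
Qed.

(** [path_u] lives in the plane of w^2 and is lifted by a root. The end point may lie on a cut; the
    descent approaches it from above, the side from which [Csqrt] is continuous there. *)
Theorem sqrt_sinh_ratio_exists (x1 x2 w : C) :
  (0 < Re x1)%R -> (0 < Re x2)%R ->
  (forall n, (1 <= n)%nat -> disp x2 w n <> 0) ->
  exists r, sqrt_sinh_ratio x1 x2 w r.
Proof.
intros H1 H2 Hw2.
set (z := w * w).
destruct (square_gap (Im (x1 * x1)) (- Im z)) as [g1 [Hg1 G1]].
destruct (square_gap (Im (x2 * x2)) (- Im z)) as [g2 [Hg2 G2]].
set (eta := (Rmin g1 g2 / 2)%R).
pose proof (Rmin_l g1 g2) as M1; pose proof (Rmin_r g1 g2) as M2.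
assert (Heta : (0 < eta)%R) by (unfold eta; pose proof (Rmin_pos g1 g2 Hg1 Hg2); lra).
assert (G1' : forall n, (Im (x1 * x1) * INR n ^ 2 < - Im z ->
             Im (x1 * x1) * INR n ^ 2 < - Im z - eta)%R).
{ intros n Hn; specialize (G1 n Hn); unfold eta in *; lra. }
assert (G2' : forall n, (Im (x2 * x2) * INR n ^ 2 < - Im z ->
             Im (x2 * x2) * INR n ^ 2 < - Im z - eta)%R).
{ intros n Hn; specialize (G2 n Hn); unfold eta in *; lra. }
destruct (path_u_cut x1 z eta H1 Heta G1') as [K1 C1].
destruct (path_u_cut x2 z eta H2 Heta G2') as [K2 C2].
set (K := Rmax K1 K2).
set (u := path_u z eta K).
assert (HI : forall t, (1/2 <= t)%R -> Im (u t) = (Im z + eta * (2 - 2 * t))%R).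
{ intros t Ht; change (Rmin (2 * t) 1 * (Im z + eta) - eta * (2 * t - Rmin (2 * t) 1)
    = Im z + eta * (2 - 2 * t))%R.
  rewrite Rmin_right by lra; ring. }
assert (HI1 : forall t, (0 <= t < 1/2)%R -> Im (u t) = (2 * t * (Im z + eta))%R).
{ intros t Ht; change (Rmin (2 * t) 1 * (Im z + eta) - eta * (2 * t - Rmin (2 * t) 1)
    = 2 * t * (Im z + eta))%R.
  rewrite Rmin_left by lra; ring. }
assert (Hu1 : u 1%R = z).
{ unfold u, path_u; cbv zeta; rewrite Rmin_right by lra.
  apply injective_projections; unfold Re, Im; simpl; ring. }
assert (Hu0 : u 0%R = 0).
{ unfold u, path_u; cbv zeta; rewrite Rmin_left by lra.
  apply injective_projections; simpl; ring. }
(* The gap at [n = 0]: if [Im z < 0], the strip above it lies below the real axis, so the descent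
   misses the cut of [Csqrt u] before its end. *)
assert (Himz : forall t, (1/2 <= t < 1)%R -> (Im z + eta * (2 - 2 * t) <> 0)%R).
{ intros t Ht E; pose proof (G1' O) as G.
  replace (Im (x1 * x1) * INR 0 ^ 2)%R with 0%R in G by (simpl (INR 0); ring).
  assert (P1 : (0 < eta * (2 - 2 * t))%R) by (apply Rmult_lt_0_compat; lra).
  assert (P2 : (0 <= eta * (2 * t - 1))%R) by (apply Rmult_le_pos; lra).
  specialize (G ltac:(lra)); lra. }
assert (Hcont : forall (J : R -> Prop) t, filterlim u (within J (locally t)) (locally (u t))).
{ intros J t; apply filterlim_within, path_u_continuous. }
set (I := fun t : R => (0 <= t <= 1)%R).
(* Near [t = 1] the path comes down vertically, hence from above the cut. *)
assert (Hroot : forall c : C,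
   (forall t, (0 <= t < 1)%R -> Im (c + u t) = 0%R -> (0 <= Re (c + u t))%R) ->
   continuous_on I (fun t => Csqrt (c + u t))).
{ intros c Hc t Ht; apply (clim_Csqrt (within I (locally t)) (fun t => c + u t)).
  - intros E1 E2; destruct (Rlt_le_dec t 1) as [Ht1 | Ht1].
    + exfalso; unfold I in Ht; specialize (Hc t ltac:(lra) E1); lra.
    + assert (Et : t = 1%R) by (unfold I in Ht; lra); subst t.
      assert (Hh : (0 < 1/2)%R) by lra.
      exists (mkposreal _ Hh); intros s Hs HsI.
      assert (Hs' : (Rabs (s - 1) < 1/2)%R) by exact Hs.
      apply Rabs_def2 in Hs'; unfold I in HsI.
      change (Im c + Im (u 1%R) = 0)%R in E1; rewrite HI in E1 by lra.
      change (0 <= Im c + Im (u s))%R; rewrite HI by lra; nra.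
  - apply (clim_plus _); [ apply filterlim_const | apply Hcont ]. }
assert (Hcut : forall x, x = x1 \/ x = x2 -> forall t n, (0 <= t < 1)%R -> (1 <= n)%nat ->
   Im (x ^ 2 * INR n ^ 2 + u t) = 0%R -> (0 < Re (x ^ 2 * INR n ^ 2 + u t))%R).
{ intros x [-> | ->] t n Ht Hn; [ apply C1 | apply C2 ]; auto;
  [ apply Rmax_l | apply Rmax_r ]. }
assert (Hv : continuous_on I (fun t => Csqrt (0 + u t))).
{ apply Hroot; intros t Ht; rewrite Cplus_0_l; intros E.
  destruct (Rlt_le_dec t (1/2)) as [Hh | Hh].
  - rewrite HI1 in E by lra.
    assert (Hz : (Im z + eta <> 0)%R).
    { pose proof (Himz (1/2)%R ltac:(lra)) as Hz; intros E'; apply Hz; lra. }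
    assert (Et : t = 0%R).
    { destruct (Rmult_integral _ _ E) as [E' | E']; [ lra | contradiction ]. }
    rewrite Et, Hu0; simpl; lra.
  - exfalso; rewrite HI in E by lra; apply (Himz t); [ lra | exact E ]. }
(* [w] is one of the two roots of [w^2]; a constant sign makes the lift end at [w]. *)
assert (Hsgn : exists sg : C, sg * sg = 1 /\ sg * Csqrt z = w).
{ destruct (Csqr_eq w (Csqrt z)) as [E | E].
  - rewrite Csqrt_sqr; reflexivity.
  - exists 1; split; [ ring | rewrite Cmult_1_l; symmetry; exact E ].
  - exists (- (1)); split; [ ring | transitivity (- Csqrt z); [ ring | symmetry; exact E ] ]. }
destruct Hsgn as [sg [Hsg1 Hsg2]].
set (v := fun t => sg * Csqrt (0 + u t)).
assert (Hvv : forall t, v t * v t = u t).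
{ intros t; unfold v; transitivity (sg * sg * (Csqrt (0 + u t) * Csqrt (0 + u t))); [ ring | ].
  rewrite Hsg1, Csqrt_sqr; ring. }
assert (Hv1 : v 1%R = w) by (unfold v; rewrite Hu1, Cplus_0_l; exact Hsg2).
assert (Hv0 : v 0%R = 0) by (unfold v; rewrite Hu0, Cplus_0_l, Csqrt_0; ring).
assert (Ed : forall x t n, disp x (v t) n = Csqrt (x ^ 2 * INR n ^ 2 + u t)).
{ intros x t n; unfold disp; rewrite <- Hvv; f_equal; ring. }
assert (Hvc : continuous_on I v).
{ intros t Ht; apply (clim_mult _); [ apply filterlim_const | apply (Hv t Ht) ]. }
assert (Hdc : forall x, x = x1 \/ x = x2 -> forall n, (1 <= n)%nat ->
   continuous_on I (fun t => disp x (v t) n)).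
{ intros x Hx n Hn t Ht.
  eapply filterlim_ext; [ intros s; symmetry; apply Ed | rewrite Ed ].
  apply (Hroot (x ^ 2 * INR n ^ 2)); [ | exact Ht ].
  intros s Hs E; left; apply (Hcut x Hx); assumption. }
assert (Hdn : forall x, x = x1 \/ x = x2 -> forall n t, (1 <= n)%nat -> (0 <= t < 1)%R ->
   disp x (v t) n <> 0).
{ intros x Hx n t Hn Ht; rewrite Ed; apply Csqrt_neq_0; intros E.
  pose proof (Hcut x Hx t n Ht Hn) as H; rewrite E in H; simpl in H; specialize (H eq_refl); lra. }
assert (HD2 : forall t, I t -> disp_prod x2 (v t) <> 0).
{ intros t Ht; apply disp_prod_neq_0; [ exact H2 | intros n Hn ].
  destruct (Rlt_le_dec t 1) as [Ht1 | Ht1].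
  - apply Hdn; auto; unfold I in Ht; lra.
  - assert (Et : t = 1%R) by (unfold I in Ht; lra); rewrite Et, Hv1; apply Hw2, Hn. }
exists (Csqrt (x2 / x1) * (disp_prod x1 w / disp_prod x2 w)).
exists v, (fun t => Csqrt (x2 / x1) * (disp_prod x1 (v t) / disp_prod x2 (v t))).
split; [ exact Hvc | split; [ exact Hv0 | split; [ exact Hv1 | ] ] ].
split.
{ intros n Hn; split; [ apply Hdc; auto | split; [ apply Hdc; auto | ] ].
  intros t Ht; split; apply Hdn; auto. }
split.
{ intros t Ht; apply (clim_mult _); [ apply filterlim_const | apply (clim_div _) ].
  - apply HD2, Ht.
  - apply (disp_prod_continuous_on I v x1 H1 Hvc); [ intros n Hn; apply Hdc; auto | exact Ht ].
  - apply (disp_prod_continuous_on I v x2 H2 Hvc); [ intros n Hn; apply Hdc; auto | exact Ht ]. }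
split; [ | split ].
- rewrite Hv0, !disp_prod_0 by assumption; field; exact C1_nz.
- rewrite Hv1; reflexivity.
- intros t Ht; rewrite sinh_ratio_disp_prod by (assumption || apply HD2, Ht).
  set (d := disp_prod x1 (v t) / disp_prod x2 (v t)).
  transitivity (Csqrt (x2 / x1) * Csqrt (x2 / x1) * (d * d));
    [ ring | rewrite Csqrt_sqr; reflexivity ].
Qed.

(** * Uniqueness of the branch *)

Lemma continuous_on_sign (f : R -> C) (T : R) : (0 <= T)%R ->
  continuous_on (fun t => (0 <= t <= T)%R) f ->
  (forall t, (0 <= t <= T)%R -> f t = 1 \/ f t = - (1)) ->
  f T = f 0%R.
Proof.
intros HT Hc Hs.
(* Clamping to [[0, T]] extends [f] continuously to the line, as [IVT_cor] asks for continuity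
   everywhere. *)
set (c := fun s => Rmax 0 (Rmin T s)).
assert (Hc1 : forall s, (0 <= c s <= T)%R).
{ intros s; unfold c, Rmax, Rmin; destruct (Rle_dec T s).
  - destruct (Rle_dec 0 T); lra.
  - destruct (Rle_dec 0 s); lra. }
assert (Hcc : continuity (fun s => Re (f (c s)))).
{ intros s; apply continuity_pt_filterlim.
  apply (clim_split (locally s) (fun s => f (c s)) (f (c s))).
  pose proof (Hc (c s) (Hc1 s)) as H.
  eapply filterlim_comp; [ | exact H ].
  intros Q [eps HQ]; exists eps; intros s' Hs'.
  apply HQ; [ | apply Hc1 ].
  assert (Hs2 : (Rabs (s' - s) < eps)%R) by exact Hs'.
  change (Rabs (c s' - c s) < eps)%R; apply Rabs_def2 in Hs2.
  apply Rabs_def1; unfold c, Rmax, Rmin;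
  destruct (Rle_dec T s'), (Rle_dec T s);
  repeat match goal with |- context [Rle_dec 0 ?y] => destruct (Rle_dec 0 y) end; lra. }
assert (H0 : c 0%R = 0%R).
{ unfold c; rewrite Rmin_right by lra; apply Rmax_left; lra. }
assert (H1 : c T = T).
{ unfold c; rewrite Rmin_left by lra; apply Rmax_right; lra. }
destruct (Hs 0%R ltac:(lra)) as [E0 | E0], (Hs T ltac:(lra)) as [E1 | E1];
rewrite E0, E1; try reflexivity; exfalso;
(destruct (IVT_cor (fun s => Re (f (c s))) 0 T Hcc HT) as [z [_ Hz]];
 [ rewrite H0, H1, E0, E1; simpl; lra
 | destruct (Hs (c z) (Hc1 z)) as [E | E]; rewrite E in Hz; simpl in Hz; lra ]).
Qed.

Lemma continuous_on_subset (J J' : R -> Prop) (f : R -> C) :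
  (forall t, J' t -> J t) -> continuous_on J f -> continuous_on J' f.
Proof.
intros HJ H t Ht; apply (@filterlim_filter_le_1 _ _ (within J (locally t)));
  [ | apply H, HJ, Ht ].
intros Q HQ; unfold within in *; revert HQ; apply filter_imp; intros s Hs Hs'.
apply Hs, HJ, Hs'.
Qed.

(** [rho / g] is continuous with values 1 and -1 while [g] does not vanish, so it keeps its initial
    value 1. At the end of the path [g] may vanish, since [disp x1 w n = 0] is possible; there the
    equality follows by continuity. *)
Lemma sqrt_sinh_ratio_unique (x1 x2 w r : C) : (0 < Re x1)%R -> (0 < Re x2)%R ->
  (forall n, (1 <= n)%nat -> disp x2 w n <> 0) ->
  sqrt_sinh_ratio x1 x2 w r ->
  r = Csqrt (x2 / x1) * (disp_prod x1 w / disp_prod x2 w).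
Proof.
intros H1 H2 Hw2 (v & rho & Hv & Hv0 & Hv1 & Hd & Hrho & Hrho0 & Hrho1 & Hsq).
pose proof (Re_gt_0_neq_0 _ H1) as N1; pose proof (Re_gt_0_neq_0 _ H2) as N2.
set (I := fun t : R => (0 <= t <= 1)%R) in *.
set (g := fun t => Csqrt (x2 / x1) * (disp_prod x1 (v t) / disp_prod x2 (v t))).
assert (HD2 : forall t, I t -> disp_prod x2 (v t) <> 0).
{ intros t Ht; apply disp_prod_neq_0; [ exact H2 | intros n Hn ].
  destruct (Rlt_le_dec t 1) as [Ht1 | Ht1].
  - apply (Hd n Hn); unfold I in Ht; lra.
  - assert (Et : t = 1%R) by (unfold I in Ht; lra); rewrite Et, Hv1; apply Hw2, Hn. }
assert (HD1 : forall t, (0 <= t < 1)%R -> disp_prod x1 (v t) <> 0).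
{ intros t Ht; apply disp_prod_neq_0; [ exact H1 | intros n Hn; apply (Hd n Hn); exact Ht ]. }
assert (Hs0 : Csqrt (x2 / x1) <> 0).
{ apply Csqrt_neq_0; intros E; apply N2.
  replace x2 with (x2 / x1 * x1) by (field; exact N1); rewrite E; ring. }
assert (Hg : continuous_on I g).
{ intros t Ht; apply (clim_mult _); [ apply filterlim_const | apply (clim_div _) ].
  - apply HD2, Ht.
  - apply (disp_prod_continuous_on I v x1 H1 Hv); [ intros n Hn; apply (Hd n Hn) | exact Ht ].
  - apply (disp_prod_continuous_on I v x2 H2 Hv); [ intros n Hn; apply (Hd n Hn) | exact Ht ]. }
assert (Hg0 : forall t, (0 <= t < 1)%R -> g t <> 0).
{ intros t Ht E.
  assert (HX : Csqrt (x2 / x1) * disp_prod x1 (v t) = 0).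
  { transitivity (g t * disp_prod x2 (v t)); [ | rewrite E; ring ].
    unfold g; field; apply HD2; unfold I; lra. }
  destruct (Cmult_0_reg _ _ HX) as [E' | E']; [ exact (Hs0 E') | exact (HD1 t Ht E') ]. }
assert (Hsq' : forall t, I t -> rho t * rho t = g t * g t).
{ intros t Ht; transitivity (rho t ^ 2); [ ring | rewrite Hsq by exact Ht ].
  rewrite sinh_ratio_disp_prod by (assumption || apply HD2, Ht); unfold g.
  set (d := disp_prod x1 (v t) / disp_prod x2 (v t)).
  transitivity (Csqrt (x2 / x1) * Csqrt (x2 / x1) * (d * d));
    [ rewrite Csqrt_sqr; reflexivity | ring ]. }
assert (E : forall T, (0 <= T < 1)%R -> rho T = g T).
{ intros T HT.
  assert (HE : rho T / g T = rho 0%R / g 0%R).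
  { apply (continuous_on_sign (fun t => rho t / g t) T); [ lra | | ].
    - intros t Ht; apply (clim_div _); [ apply Hg0; lra | | ].
      + apply (continuous_on_subset I); [ unfold I; intros; lra | exact Hrho | exact Ht ].
      + apply (continuous_on_subset I); [ unfold I; intros; lra | exact Hg | exact Ht ].
    - intros t Ht; assert (Hgt : g t <> 0) by (apply Hg0; lra).
      destruct (Csqr_eq (rho t) (g t) (Hsq' t ltac:(unfold I; lra))) as [-> | ->];
      [ left | right ]; field; exact Hgt. }
  assert (Hg00 : g 0%R = rho 0%R).
  { unfold g; rewrite Hv0, Hrho0, !disp_prod_0 by assumption; field; exact C1_nz. }
  assert (H0 : g 0%R <> 0) by (apply Hg0; lra); rewrite <- Hg00 in HE.
  assert (HT0 : g T <> 0) by (apply Hg0; exact HT).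
  replace (rho T) with (rho T / g T * g T) by (field; exact HT0).
  rewrite HE; field; exact H0. }
rewrite <- Hrho1, <- Hv1; fold (g 1%R).
destruct (Ceq_dec (rho 1%R - g 1%R) 0) as [E1 | E1].
{ replace (rho 1%R) with (rho 1%R - g 1%R + g 1%R) by ring; rewrite E1; ring. }
exfalso; pose proof (proj1 (Cmod_gt_0 _) E1) as Hm.
assert (HI1 : I 1%R) by (unfold I; lra).
assert (HL : filterlim (fun t => rho t - g t) (within I (locally 1%R))
               (locally (rho 1%R - g 1%R))).
{ apply (clim_minus _); [ apply Hrho, HI1 | apply Hg, HI1 ]. }
destruct (proj1 (clim_eps (within I (locally 1%R)) _ _) HL _ Hm) as [d Hdl].
pose proof (cond_pos d) as Hdp.
(* A point before the end, so close that [rho - g], which is 0 there, should be within less than its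
   own final modulus of the final value. *)
set (t := Rmax (1/2) (1 - d / 2)).
assert (Ht : (1/2 <= t < 1)%R).
{ unfold t; split; [ apply Rmax_l | apply Rmax_lub_lt; lra ]. }
assert (Htd : (1 - d / 2 <= t)%R) by apply Rmax_r.
specialize (Hdl t); cbv beta in Hdl.
rewrite (E t) in Hdl by lra.
replace (g t - g t - (rho 1%R - g 1%R)) with (- (rho 1%R - g 1%R)) in Hdl by ring.
rewrite Cmod_opp in Hdl.
apply (Rlt_irrefl (Cmod (rho 1%R - g 1%R))), Hdl.
- change (Rabs (t - 1) < d)%R; apply Rabs_def1; lra.
- unfold I; lra.
Qed.

(** * Nonvanishing of the denominator, and the identity *)

Lemma Csinh_PI_neq_0 (z : C) : z <> 0 ->
  (forall k, (1 <= k)%nat -> z * z <> - (INR k * INR k)) -> Csinh (PI * z) <> 0.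
Proof.
intros Hz H.
assert (HK : (0 <= Cmod z * Cmod z)%R) by (pose proof (Cmod_ge_0 z); nra).
assert (Hn : forall n, (1 <= n)%nat ->
  (Cmod (1 + z * z / (INR n * INR n) - 1) <= Cmod z * Cmod z / INR n ^ 2)%R).
{ intros n Hn; pose proof (INR_pos n Hn).
  pose proof (INR_C_neq_0 n Hn) as Hn0.
  replace (1 + z * z / (INR n * INR n) - 1) with (z * z * / (INR n * INR n))
    by (unfold Cdiv; ring).
  rewrite Cmod_mult, Cmod_inv, !Cmod_mult, Cmod_R, Rabs_pos_eq
    by (lra || (apply Cmult_neq_0; exact Hn0)).
  apply Req_le; simpl; rewrite Rmult_1_r; reflexivity. }
destruct (infprod_cv _ _ HK Hn) as [P HP].
pose proof (is_infprod_intro _ _ _ HK Hn HP) as HI.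
(* Euler's product converges in the strict sense, so it vanishes only with one of its factors
   [1 + z^2 / n^2]. *)
assert (HP0 : P <> 0).
{ apply (is_infprod_neq_0 _ _ HI); intros n Hn1 E.
  pose proof (INR_C_neq_0 n Hn1) as Hn0; apply (H n Hn1).
  replace (z * z) with ((1 + z * z / (INR n * INR n)) * (INR n * INR n) - INR n * INR n)
    by (field; exact Hn0).
  rewrite E; ring. }
assert (E : Csinh (PI * z) = PI * z * P).
{ apply (clim_unique eventually _ _ _ (Csinh_product z)).
  apply (clim_mult eventually); [ apply filterlim_const | exact HP ]. }
rewrite E; apply Cmult_neq_0; [ apply Cmult_neq_0; [ | exact Hz ] | exact HP0 ].
exact RtoC_PI_neq_0.
Qed.

Theorem proposition4 :
  forall (w x1 x2 : C),
    (0 < Re x1)%R -> (0 < Re x2)%R ->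
    (forall n k : nat, (1 <= n)%nat -> (1 <= k)%nat ->
       x2 ^ 2 * INR n ^ 2 + x1 ^ 2 * INR k ^ 2 <> - w ^ 2) ->
    (forall n : nat, (1 <= n)%nat -> x2 ^ 2 * INR n ^ 2 <> - w ^ 2) ->
    (exists s : C, is_series (fun n : nat => summand x1 x2 w (S n)) s) /\
    (exists r : C, sqrt_sinh_ratio x1 x2 w r) /\
    ((0 < Re (x1 / x2))%R ->
       exists P1 P2 : C,
         is_infprod (factor x1 x2 w) P1 /\ is_infprod (factor x2 x1 w) P2) /\
    (forall P1 P2 r s : C,
       is_infprod (factor x1 x2 w) P1 ->
       is_infprod (factor x2 x1 w) P2 ->
       sqrt_sinh_ratio x1 x2 w r ->
       is_series (fun n : nat => summand x1 x2 w (S n)) s ->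
       P2 <> 0 /\
       P1 / P2 =
         Cpower (x1 / x2) (PI * w ^ 2 / (2 * x1 * x2)) * r
         * Cexp (PI / 12 * (x1 / x2 - x2 / x1) + PI * s)).
Proof.
intros w x1 x2 H1 H2 Hnk Hn0.
pose proof (Re_gt_0_neq_0 _ H1) as N1; pose proof (Re_gt_0_neq_0 _ H2) as N2.
assert (Hd2 : forall n, (1 <= n)%nat -> disp x2 w n <> 0).
{ intros n Hn E; apply (Hn0 n Hn).
  pose proof (disp_sqr x2 w n) as Hq; rewrite E in Hq.
  replace (x2 ^ 2 * INR n ^ 2) with (x2 * x2 * (INR n * INR n) + w * w - w ^ 2) by ring.
  rewrite <- Hq; ring. }
split; [ | split; [ | split ] ].
- destruct (summand_le x1 x2 w H1 H2) as [K [HK HB]].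
  destruct (Csum_cv _ K HK HB) as [s Hs]; exists s; apply is_series_Csum, Hs.
- apply sqrt_sinh_ratio_exists; assumption.
- intros Ht; destruct (factor_infprod x1 x2 w H1 N2 Ht) as [P1 HP1].
  destruct (factor_infprod x2 x1 w H2 N1 (Re_div_swap _ _ H1 H2 Ht)) as [P2 HP2].
  exists P1, P2; split; assumption.
- intros P1 P2 r s HP1 HP2 Hr Hs; apply is_series_Csum in Hs.
  (* The assumed convergence of the first product supplies [0 < Re (x1 / x2)]. *)
  pose proof (factor_infprod_Re x1 x2 w P1 H1 N2 HP1) as Ht.
  pose proof (Re_div_swap _ _ H1 H2 Ht) as Ht'.
  assert (NP2 : P2 <> 0).
  { apply (is_infprod_neq_0 _ _ HP2); intros n Hn; rewrite factor_sinh by exact N1.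
    apply Cmult_neq_0; [ apply Cmult_neq_0; [ exact C2_neq_0 | ] | apply Cexp_neq_0 ].
    pose proof (disp_sqr x2 w n) as Hq.
    (* The factor vanishes only if [disp x2 w n / x1] is [i k] for an integer [k]: [Hn0] excludes
       [k = 0], and [Hnk] the others. *)
    apply Csinh_PI_neq_0.
    - intros E; apply (Hd2 n Hn).
      replace (disp x2 w n) with (disp x2 w n / x1 * x1) by (field; exact N1).
      rewrite E; ring.
    - intros k Hk E; apply (Hnk n k Hn Hk).
      assert (E2 : disp x2 w n * disp x2 w n = - (x1 * x1 * (INR k * INR k))).
      { transitivity (disp x2 w n / x1 * (disp x2 w n / x1) * (x1 * x1));
          [ field; exact N1 | rewrite E; ring ]. }
      rewrite Hq in E2.
      replace (x2 ^ 2 * INR n ^ 2 + x1 ^ 2 * INR k ^ 2)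
        with (x2 * x2 * (INR n * INR n) + w * w + x1 * x1 * (INR k * INR k) - w ^ 2) by ring.
      rewrite E2; ring. }
  split; [ exact NP2 | ].
  rewrite (sqrt_sinh_ratio_unique x1 x2 w r H1 H2 Hd2 Hr).
  assert (ND2 : disp_prod x2 w <> 0) by (apply disp_prod_neq_0; assumption).
  destruct (factor_infprod x1 x2 0 H1 N2 Ht) as [P10 L10].
  destruct (factor_infprod x2 x1 0 H2 N1 Ht') as [P20 L20].
  assert (N20 : P20 <> 0).
  { apply (is_infprod_neq_0 _ _ L20); intros n Hn; apply factor_w0_neq_0; assumption. }
  destruct (product_constants x1 x2 P10 P20 H1 H2 Ht L10 L20) as [Hsig HP10].
  set (a := PI * w ^ 2 / (2 * x1 * x2)).
  (* Two limits of one sequence, now that [sigma] converges. On division, [Csqrt (x2 / x1)] from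
     [HP10] joins the quotient of the [disp_prod] to form [r]. *)
  assert (E : P1 * P20 * disp_prod x2 w
     = Cexp (a * Clog (x1 / x2)) * (P2 * P10 * disp_prod x1 w * Cexp (PI * s))).
  { eapply (clim_unique eventually).
    - apply (product_ratio_limit x1 x2 w P1 P2 P10 P20 s H1 H2 Ht
        (proj1 HP1) (proj1 HP2) (proj1 L10) (proj1 L20) Hs).
    - apply (clim_mult eventually); [ apply (clim_Cexp eventually) | apply filterlim_const ].
      replace (a * Clog (x1 / x2)) with (w * w * (PI * Clog (x1 / x2) / (2 * x1 * x2)))
        by (unfold a; field; split; assumption).
      apply (clim_mult eventually); [ apply filterlim_const | exact Hsig ]. }
  unfold Cpower; rewrite HP10 in E; rewrite Cexp_plus.
  transitivity (P1 * P20 * disp_prod x2 w / (P2 * P20 * disp_prod x2 w));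
    [ field; auto | rewrite E; field; auto ].
Qed.
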